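(* The rank $r$ of any homogeneous (even) Clifford structure on a compact homogeneous manifold $M=G/H$ of non-vanishing Euler characteristic (equivalently, with $\mathrm{rk}(G)=\mathrm{rk}(H)$) is less than or equal to $16$. More precisely, the following restrictions hold for the rank depending on its $2$-valuation: (I) if $r$ is odd, then $r\in\{3,5,7,9\}$; (II) if $r\equiv 2 \bmod 4$, then $r\in\{2,6,10\}$; (III) if $r\equiv 4\bmod 8$, then $r\in\{4,12\}$; (IV) if $r\equiv 0\bmod 8$, then $r\in\{8,16\}$.
   Context: Setting. $G$ is a compact Lie group and $H\subset G$ a closed subgroup, with Lie algebras $\mathfrak{g}$ and $\mathfrak{h}$. Let $\mathfrak{m}$ be the orthogonal complement of $\mathfrak{h}$ in $\mathfrak{g}$ with respect to some $\mathrm{ad}_{\mathfrak g}$-invariant scalar product on $\mathfrak{g}$; the restriction of this scalar product to $\mathfrak m$ defines a homogeneous Riemannian metric $g$ on $M=G/H$. Let $\iota:H\to\mathrm{Aut}(\mathfrak{m})$ be the isotropy representation (the restriction to $H$ of the adjoint representation, acting on $\mathfrak m$). The infinitesimal isotropy representation $\iota_*$ of $\mathfrak h$ on $\mathfrak m$ is assumed to be faithful. Let $\mathrm{Cl}^0_r$ be the even part of the real Clifford algebra of Euclidean $\mathbb{R}^r$, with $\mathfrak{so}(r)=\mathfrak{spin}(r)\subset \mathrm{Cl}^0_r$ in the standard way. $\mathrm{End}^-(\mathfrak m)$ denotes the skew-symmetric endomorphisms of $\mathfrak m$. Definition. A homogeneous (even) Clifford structure of rank $r\ge 2$ on $(G/H,g)$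 is an orthogonal representation $\rho:H\to \mathrm{SO}(r)$ together with an $H$-equivariant representation $\varphi:\mathfrak{so}(r)\to\mathrm{End}^-(\mathfrak{m})$, i.e. $\iota(h)\circ\varphi(A)\circ\iota(h)^{-1}=\varphi(\rho(h)A\rho(h)^{-1})$ for all $h\in H$, $A\in\mathfrak{so}(r)$, which extends to an algebra representation of $\mathrm{Cl}^0_r$ on $\mathfrak{m}$. *)

(* Defs.v *)
From HB Require Import structures.
From mathcomp Require Import all_boot all_order all_algebra.
From mathcomp Require Import sesquilinear ring.
From mathcomp Require Import all_classical all_reals all_analysis.

Set Implicit Arguments.
Unset Strict Implicit.
Unset Printing Implicit Defensive.

Import Order.TTheory GRing.Theory Num.Theory.
Import numFieldNormedType.Exports.

Local Open Scope classical_set_scope.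
Local Open Scope ring_scope.

(* In finite dimension, "for every v, x |-> 'd f x v is C^k on A" is the same
   as "'d f is C^k on A".  Only meant for open A. *)
Fixpoint Ck (R : realType) (U V : normedModType R) (k : nat) (A : set U)
    (f : U -> V) : Prop :=
  match k with
  | 0 => forall x, A x -> {for x, continuous f}
  | k'.+1 => (forall x, A x -> differentiable f x) /\
             (forall v, Ck k' A (fun x => 'd f x v))
  end.

Definition smooth_on (R : realType) (U V : normedModType R) (A : set U)
  (f : U -> V) : Prop := forall k, Ck k A f.

Record chart (R : realType) (n : nat) (T : Type) := Chart {
  chart_dom : set T;
  chart_map :> T -> 'rV[R]_n;
  chart_inv : 'rV[R]_n -> T }.

Definition chart_cod (R : realType) (n : nat) (T : Type) (c : chart R n T) :
  set 'rV[R]_n := c @` chart_dom c.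

Definition is_chart (R : realType) (n : nat) (T : topologicalType)
    (c : chart R n T) : Prop :=
  [/\ open (chart_dom c), open (chart_cod c),
      (forall x, chart_dom c x -> chart_inv c (c x) = x),
      (forall x, chart_dom c x -> {for x, continuous c}) &
      (forall u, chart_cod c u -> {for u, continuous (chart_inv c)})].

HB.mixin Record isLieGroup (R : realType) (n : nat) (G : Type)
    of Topological G & Group G := {
  lie_hausdorff : hausdorff_space G;
  lie_second_countable : @second_countable G;
  atlas : set (chart R n G);
  atlas_chart : forall c, atlas c -> is_chart c;
  atlas_cover : forall x : G, exists2 c, atlas c & chart_dom c x;
  atlas_transition : forall c d, atlas c -> atlas d ->
    smooth_on (c @` (chart_dom c `&` chart_dom d))
      (fun u => d (chart_inv c u));
  lie_mul_continuous : continuous (fun p : G * G => (p.1 * p.2)%g);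
  lie_inv_continuous : continuous (fun x : G => (x^-1)%g);
  lie_mul_smooth : forall c1 c2 d, atlas c1 -> atlas c2 -> atlas d ->
    smooth_on
      [set p : 'rV[R]_n * 'rV[R]_n |
        [/\ chart_cod c1 p.1, chart_cod c2 p.2 &
            chart_dom d (chart_inv c1 p.1 * chart_inv c2 p.2)%g]]
      (fun p => d (chart_inv c1 p.1 * chart_inv c2 p.2)%g);
  lie_inv_smooth : forall c d, atlas c -> atlas d ->
    smooth_on
      [set u | chart_cod c u /\ chart_dom d ((chart_inv c u)^-1)%g]
      (fun u => d ((chart_inv c u)^-1)%g)
}.

#[short(type="lieGroupType")]
HB.structure Definition LieGroup (R : realType) (n : nat) :=
  {G of isLieGroup R n G & Topological G & Group G}.

Section LieGroupTheory.
Context {R : realType} {n : nat} {G : lieGroupType R n}.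

Definition closed_subgroup (H : set G) : Prop :=
  [/\ closed H, H 1%g, (forall x y, H x -> H y -> H (x * y)%g) &
      (forall x, H x -> H (x^-1)%g)].

(* The Lie algebra of [G] is the tangent space at the identity, identified
    with [R^n] by the differential of a chart [c] of the atlas around [1]. *)
Variable c : chart R n G.

Definition Ad (g : G) : {linear 'rV[R]_n -> 'rV[R]_n} :=
  'd (fun u => c (g * chart_inv c u * g^-1)%g) (c 1%g).

(* ad is the differential of Ad at the identity; this gives the bracket of
   left-invariant vector fields. *)
Definition bracket (X Y : 'rV[R]_n) : 'rV[R]_n :=
  'd (fun u => Ad (chart_inv c u) Y) (c 1%g) X.

(* [X] is the initial velocity of a one-parameter subgroup lying in [H], that
   is, exp(tX) lies in [H] for all t. *)
Definition tangent_to_subgroup (H : set G) (X : 'rV[R]_n) : Prop :=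
  exists gamma : R -> G,
    [/\ continuous gamma,
        (forall s t, gamma (s + t) = (gamma s * gamma t)%g),
        (forall t, H (gamma t)) &
        is_derive (0 : R) 1 (fun t => c (gamma t)) X].

(* That this set of vectors is a subspace is part of the closed subgroup
   theorem. *)
Definition is_lie_algebra_of (H : set G) (hh : {vspace 'rV[R]_n}) : Prop :=
  forall X, X \in hh <-> tangent_to_subgroup H X.

(* The rank of a compact Lie group is the dimension of the maximal abelian
   subalgebras (Cartan subalgebras) of its Lie algebra [k]. *)
Definition lie_rank (k : {vspace 'rV[R]_n}) : nat :=
  \max_(d < n.+1 | `[< exists a : {vspace 'rV[R]_n},
      [/\ (a <= k)%VS, \dim a = d &
          {in a &, forall X Y, bracket X Y = 0}] >]) d.

Definition ad_invariant (B : {dot 'rV[R]_n for idfun}) : Prop :=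
  forall X Y Z, B (bracket X Y) Z + B Y (bracket X Z) = 0.

Variable m : {vspace 'rV[R]_n}.

Definition isotropy (h : G) : 'End(subvs_of m) :=
  linfun (fun v : subvs_of m => vsproj m (Ad h (vsval v))).

Definition inf_isotropy (X : 'rV[R]_n) : 'End(subvs_of m) :=
  linfun (fun v : subvs_of m => vsproj m (bracket X (vsval v))).

(* [B] restricted to [m] induces a [G]-invariant metric on [G/H].  When [H] is
   not connected this does not follow from [ad]-invariance. *)
Definition homogeneous_metric (H : set G) (B : {dot 'rV[R]_n for idfun}) :
    Prop :=
  forall h, H h ->
    {in m, forall X, Ad h X \in m} /\
    {in m &, forall X Y, B (Ad h X) (Ad h Y) = B X Y}.

Definition skew_endo (B : {dot 'rV[R]_n for idfun}) (f : 'End(subvs_of m)) :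
    Prop :=
  forall v w : subvs_of m, B (vsval (f v)) (vsval w) = - B (vsval v) (vsval (f w)).

End LieGroupTheory.

Definition symdiff (T : finType) (S S' : {set T}) : {set T} :=
  ((S :\: S') :|: (S' :\: S))%SET.

(* The Clifford algebra of Euclidean R^r, with v * v = - |v|^2 (see [cvec_sqr]).
   An element is the family of its coordinates in the basis
   e_S = e_i1 ... e_ik, where S = {i1 < ... < ik}. *)
Definition clifford (R : realType) (r : nat) : Type := {ffun {set 'I_r} -> R}.

HB.instance Definition _ (R : realType) (r : nat) :=
  GRing.Lmodule.copy (clifford R r) {ffun {set 'I_r} -> R^o}.

Section Clifford.
Context {R : realType} {r : nat}.
Local Notation Cl := (clifford R r).
Implicit Types (S T U : {set 'I_r}) (x y z : Cl) (i j k : 'I_r).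

(* e_S * e_T = csign S T *: e_(S symdiff T): every e_j of e_T moves left past
   the e_i of e_S with j < i, and e_i * e_i = -1. *)
Definition csign S T : R :=
  \prod_(i in S) \prod_(j in T | (j <= i)%N) -1.

Definition cbasis S : Cl := [ffun T => (T == S)%:R].

Definition cmul x y : Cl :=
  [ffun U : {set 'I_r} =>
    \sum_(S : {set 'I_r}) csign S (symdiff S U) * x S * y (symdiff S U)].

Lemma in_symdiff S T i : (i \in symdiff S T) = (i \in S) (+) (i \in T).
Proof. by rewrite !inE; case: (i \in S); case: (i \in T). Qed.

Lemma symdiffC S T : symdiff S T = symdiff T S.
Proof. by apply/setP => i; rewrite !in_symdiff addbC. Qed.

Lemma symdiffA S T U : symdiff S (symdiff T U) = symdiff (symdiff S T) U.
Proof. by apply/setP => i; rewrite !in_symdiff addbA. Qed.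

Lemma symdiffK S T : symdiff S (symdiff S T) = T.
Proof. by apply/setP => i; rewrite !in_symdiff addKb. Qed.

Lemma symdiff0 S : symdiff finset.set0 S = S.
Proof. by apply/setP => i; rewrite in_symdiff inE. Qed.

Lemma prod_symdiff (f : 'I_r -> R) S T : (forall i, f i * f i = 1) ->
  \prod_(i in symdiff S T) f i = \prod_(i in S) f i * \prod_(i in T) f i.
Proof.
move=> ff1; rewrite (big_mkcond (mem (symdiff S T))) (big_mkcond (mem S)).
rewrite (big_mkcond (mem T)) -big_split; apply: eq_bigr => i _ /=.
rewrite in_symdiff; case: (i \in S); case: (i \in T) => /=.
- by rewrite ff1.
- by rewrite mulr1.
- by rewrite mul1r.
- by rewrite mulr1.
Qed.

Lemma csignM S T : csign S T * csign S T = 1.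
Proof.
rewrite /csign -big_split big1 // => i _; rewrite -big_split big1 // => j _.
by rewrite /= mulrNN mulr1.
Qed.

Lemma csignDl S S' T : csign (symdiff S S') T = csign S T * csign S' T.
Proof.
rewrite /csign prod_symdiff // => i; rewrite -big_split big1 // => j _.
by rewrite /= mulrNN mulr1.
Qed.

Lemma csignDr S T T' : csign S (symdiff T T') = csign S T * csign S T'.
Proof.
rewrite /csign -big_split; apply: eq_bigr => i _ /=.
rewrite !big_mkcondr /= prod_symdiff // => j.
by case: ifP => _; rewrite ?mulrNN mulr1.
Qed.

Lemma csign0l T : csign finset.set0 T = 1.
Proof. by rewrite /csign big_set0. Qed.

Lemma csign0r S : csign S finset.set0 = 1.
Proof. by rewrite /csign big1 // => i _; rewrite big_mkcondr big_set0. Qed.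

Fact cmulA : associative cmul.
Proof.
move=> x y z; apply/ffunP => U; rewrite !ffunE.
under eq_bigr do rewrite ffunE mulr_sumr.
under [RHS]eq_bigr do rewrite ffunE mulr_sumr mulr_suml.
rewrite [RHS]exchange_big /=; apply: eq_bigr => T _.
rewrite (reindex_inj (can_inj (symdiffK T))) /=; apply: eq_bigr => S _.
have -> : symdiff (symdiff T S) (symdiff T U) = symdiff S U.
  by apply/setP => i; rewrite !in_symdiff; case: (i \in T); case: (i \in S);
     case: (i \in U).
rewrite !(csignDl, csignDr).
have := csignM T U; set a := csign T U => aa.
transitivity ((a * a) * (csign T T * csign T S * csign S S * csign S U
  * x T * y (symdiff T S) * z (symdiff S U))); last by rewrite aa; ring.
by ring.
Qed.

Fact cmul1l : left_id (cbasis finset.set0) cmul.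
Proof.
move=> x; apply/ffunP => U; rewrite ffunE (bigD1 finset.set0) //= big1.
  by rewrite addr0 ffunE eqxx mulr1 csign0l mul1r symdiff0.
by move=> S /negPf S0; rewrite ffunE S0 mulr0 mul0r.
Qed.

Fact cmul1r : right_id (cbasis finset.set0) cmul.
Proof.
move=> x; apply/ffunP => U; rewrite ffunE (bigD1 U) //= big1.
  rewrite addr0 ffunE.
  have -> : symdiff U U = finset.set0.
    by apply/setP => i; rewrite in_symdiff inE addbb.
  by rewrite eqxx mulr1 csign0r mul1r.
move=> S SU; rewrite ffunE.
case: eqP => [S0|_]; last by rewrite mulr0.
by case/eqP: SU; rewrite -[U](symdiffK S) S0 symdiffC symdiff0.
Qed.

Fact cmulDl : left_distributive cmul +%R.
Proof.
move=> x y z; apply/ffunP => U; rewrite !ffunE -big_split.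
by apply: eq_bigr => S _; rewrite !ffunE mulrDr mulrDl.
Qed.

Fact cmulDr : right_distributive cmul +%R.
Proof.
move=> x y z; apply/ffunP => U; rewrite !ffunE -big_split.
by apply: eq_bigr => S _; rewrite !ffunE mulrDr.
Qed.

Fact cone_neq0 : cbasis finset.set0 != 0 :> Cl.
Proof.
apply/eqP => /ffunP /(_ finset.set0); rewrite !ffunE eqxx => /eqP.
by rewrite oner_eq0.
Qed.

HB.instance Definition _ := GRing.Zmodule_isNzRing.Build Cl
  cmulA cmul1l cmul1r cmulDl cmulDr cone_neq0.

Fact cscaleAl (a : R) x y : a *: (x * y) = (a *: x) * y.
Proof.
apply/ffunP => U; rewrite !ffunE scaler_sumr; apply: eq_bigr => S _.
by rewrite !ffunE /GRing.scale /=; ring.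
Qed.

Fact cscaleAr (a : R) x y : a *: (x * y) = x * (a *: y).
Proof.
apply/ffunP => U; rewrite !ffunE scaler_sumr; apply: eq_bigr => S _.
by rewrite !ffunE /GRing.scale /=; ring.
Qed.

HB.instance Definition _ := GRing.Lmodule_isLalgebra.Build R Cl cscaleAl.
HB.instance Definition _ := GRing.Lalgebra_isAlgebra.Build R Cl cscaleAr.

Definition cgen i : Cl := cbasis [set i]%SET.

Definition cvec (v : 'rV[R]_r) : Cl := \sum_i v 0 i *: cgen i.

Definition even_clifford : {pred Cl} :=
  [pred x : Cl | [forall S : {set 'I_r}, odd #|S| ==> (x S == 0)]].

(* The standard identification of so(r) with spin(r); it is characterized by
   [spin_cvec] below. *)
Definition spin (A : 'M[R]_r) : Cl :=
  \sum_i \sum_j (A i j / 4) *: (cgen j * cgen i).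

Lemma cbasisM S T : cbasis S * cbasis T = csign S T *: cbasis (symdiff S T).
Proof.
apply/ffunP => U; rewrite !ffunE (bigD1 S) //= big1 => [|S' /negPf S'S].
  rewrite !ffunE eqxx addr0 mulr1 /GRing.scale /=.
  have -> : (symdiff S U == T) = (U == symdiff S T).
    by apply/eqP/eqP => [<-|->]; rewrite symdiffK.
  by case: eqP => [->|_]; rewrite ?mulr0 // symdiffK.
by rewrite ffunE S'S mulr0 mul0r.
Qed.

Lemma cgenM i j : cgen i * cgen j + cgen j * cgen i = (- 2 * (i == j)%:R)%:A.
Proof.
have sgn1 (a b : 'I_r) :
    csign [set a]%SET [set b]%SET = if (b <= a)%N then -1 else 1.
  by rewrite /csign big_set1 big_mkcondr big_set1.
rewrite /cgen !cbasisM !sgn1 (symdiffC [set j]%SET); case: (ltngtP i j) => ij.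
- rewrite (ltn_eqF ij : (i == j) = false).
  by rewrite mulr0 scale0r scale1r scaleN1r subrr.
- rewrite eq_sym (ltn_eqF ij : (j == i) = false).
  by rewrite mulr0 scale0r scale1r scaleN1r addNr.
- have -> : i = j by apply: val_inj.
  have -> : symdiff [set j]%SET [set j]%SET = finset.set0.
    by apply/setP => k; rewrite in_symdiff addbb inE.
  by rewrite eqxx mulr1 -scalerDl; congr (_ *: _); ring.
Qed.

Lemma cvec_sqr (v : 'rV[R]_r) : cvec v * cvec v = (- (v *m v^T) 0 0)%:A.
Proof.
have two : (2 : R) != 0 by rewrite pnatr_eq0.
have vvE : cvec v * cvec v
    = \sum_i \sum_j (v 0 i * v 0 j) *: (cgen i * cgen j).
  rewrite /cvec mulr_suml; apply: eq_bigr => i _; rewrite mulr_sumr.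
  by apply: eq_bigr => j _; rewrite -scalerAl -scalerAr scalerA.
apply: (scalerI two); rewrite scaler_nat mulr2n.
rewrite {1}vvE vvE [in X in _ + X]exchange_big -big_split /=.
rewrite mxE -sumrN scaler_suml scaler_sumr; apply: eq_bigr => i _.
rewrite -big_split (bigD1 i) //= big1 => [|j /negPf ji].
  rewrite addr0 -scalerDr cgenM eqxx mulr1 mxE !scalerA.
  by congr (_ *: _); ring.
by rewrite [v 0 j * _]mulrC -scalerDr cgenM eq_sym ji mulr0 scale0r scaler0.
Qed.

Lemma cgen_comm2 i j k :
  cgen j * cgen i * cgen k - cgen k * (cgen j * cgen i) =
  (2 * (k == j)%:R) *: cgen i - (2 * (k == i)%:R) *: cgen j.
Proof.
have comm a b : cgen a * cgen b = (- 2 * (a == b)%:R)%:A - cgen b * cgen a.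
  by rewrite -cgenM addrK.
rewrite mulrA (comm k j) mulrBl -[cgen j * cgen k * _]mulrA (comm k i).
rewrite mulrBr -!scalerAl -!scalerAr !mul1r !mulr1 !mulrA !mulNr !scaleNr.
by rewrite opprB opprK addrC addrAC subrK addrC.
Qed.

Lemma spin_cvec (A : 'M[R]_r) (v : 'rV[R]_r) : A^T = - A ->
  spin A * cvec v - cvec v * spin A = cvec (v *m A^T).
Proof.
move=> /matrixP skewA.
have genE k : spin A * cgen k - cgen k * spin A = \sum_i A i k *: cgen i.
  rewrite /spin mulr_suml mulr_sumr -sumrB.
  transitivity (\sum_i \sum_j
      (A i j / 4) *: ((2 * (k == j)%:R) *: cgen i - (2 * (k == i)%:R) *: cgen j)).
    apply: eq_bigr => i _; rewrite mulr_suml mulr_sumr -sumrB.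
    apply: eq_bigr => j _.
    by rewrite -cgen_comm2 -scalerAl -scalerAr scalerBr.
  under eq_bigr do under eq_bigr do rewrite scalerBr !scalerA.
  under eq_bigr do rewrite sumrB.
  rewrite sumrB [X in _ - X]exchange_big -sumrB /=; apply: eq_bigr => i _.
  rewrite (bigD1 k) //= big1 => [|j /negPf jk]; last first.
    by rewrite eq_sym jk mulr0 mulr0 scale0r.
  rewrite (bigD1 k) //= big1 => [|j /negPf jk]; last first.
    by rewrite eq_sym jk mulr0 mulr0 scale0r.
  have := skewA i k; rewrite !mxE => ->.
  rewrite eqxx !addr0 -scalerBl; congr (_ *: _).
  by rewrite !mulr1; field.
rewrite {1 2}/cvec mulr_sumr mulr_suml -sumrB.
transitivity (\sum_k \sum_i (v 0 k * A i k) *: cgen i).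
  apply: eq_bigr => k _; rewrite -scalerAr -scalerAl -scalerBr genE.
  by rewrite scaler_sumr; apply: eq_bigr => i _; rewrite scalerA.
rewrite exchange_big /cvec /=; apply: eq_bigr => i _.
by rewrite mxE scaler_suml; apply: eq_bigr => k _; rewrite mxE.
Qed.

Lemma spin_even (A : 'M[R]_r) : A^T = - A -> spin A \in even_clifford.
Proof.
move=> /matrixP skewA; apply/forallP => S; apply/implyP => oddS.
rewrite /spin sum_ffunE big1 // => i _; rewrite sum_ffunE big1 // => j _.
rewrite /cgen cbasisM scalerA !ffunE; case: eqP => [SE|_]; last exact: scaler0.
have [ij|ij] := eqVneq i j.
  have := skewA i i; rewrite !mxE -ij => /eqP.
  by rewrite -addr_eq0 -mulr2n mulrn_eq0 /= => /eqP ->; rewrite !mul0r scale0r.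
suff S2 : S = [set j; i]%SET by move: oddS; rewrite S2 cards2 eq_sym ij.
apply/setP => k; rewrite SE in_symdiff !inE.
by have [->|_] := eqVneq k j; rewrite ?[j == i]eq_sym ?(negPf ij) //.
Qed.

End Clifford.

Definition so (R : realType) (r : nat) : {pred 'M[R]_r} :=
  [pred A : 'M[R]_r | A^T == - A].

Definition SO (R : realType) (r : nat) : {pred 'M[R]_r} :=
  [pred A : 'M[R]_r | (A *m A^T == 1%:M) && (\det A == 1)].

Arguments so R r : clear implicits.
Arguments SO R r : clear implicits.

Definition is_orthogonal_representation (R : realType) (n r : nat)
    (G : lieGroupType R n) (H : set G) (rho : G -> 'M[R]_r) : Prop :=
  [/\ {within H, continuous rho},
      (forall h, H h -> rho h \in SO R r) &
      (forall h k, H h -> H k -> rho (h * k)%g = rho h *m rho k)].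

Definition is_lie_representation (R : realType) (r : nat) (vT : vectType R)
    (phi : 'M[R]_r -> 'End(vT)) : Prop :=
  (forall a, {in so R r &, forall A B, phi (a *: A + B) = a *: phi A + phi B}) /\
  {in so R r &, forall A B,
     phi (A *m B - B *m A) = (phi A \o phi B)%VF - (phi B \o phi A)%VF}.

Definition is_even_clifford_representation (R : realType) (r : nat)
    (vT : vectType R) (Phi : clifford R r -> 'End(vT)) : Prop :=
  [/\ Phi 1 = \1%VF,
      (forall a, {in even_clifford &, forall x y,
         Phi (a *: x + y) = a *: Phi x + Phi y}) &
      {in even_clifford &, forall x y, Phi (x * y) = (Phi x \o Phi y)%VF}].

Record is_homogeneous_clifford_structure (R : realType) (n r : nat)
    (G : lieGroupType R n) (c : chart R n G) (H : set G)
    (B : {dot 'rV[R]_n for idfun}) (m : {vspace 'rV[R]_n})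
    (rho : G -> 'M[R]_r) (phi : 'M[R]_r -> 'End(subvs_of m)) : Prop := {
  hcs_rank : (2 <= r)%N;
  hcs_rho : is_orthogonal_representation H rho;
  hcs_phi : is_lie_representation phi;
  hcs_skew : {in so R r, forall A, skew_endo B (phi A)};
  hcs_equivariant : forall h, H h -> {in so R r, forall A,
    (isotropy c m h \o phi A \o (isotropy c m h)^-1)%VF =
    phi (rho h *m A *m invmx (rho h))};
  hcs_extends : exists Phi : clifford R r -> 'End(subvs_of m),
    is_even_clifford_representation Phi /\
    {in so R r, forall A, Phi (spin A) = phi A} }.

(* Main.v *)
(* A maximal abelian subalgebra t of hh is self-centralizing in the Lie algebra
   of G, because the ranks agree.  Hence the weights of t on the complexification
   of m are nonzero; they are roots, so they have multiplicity one and integral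
   Cartan numbers.

   Differentiating the equivariance of phi along one-parameter subgroups, every
   X in hh acts on the Clifford operators of m as the commutator with some A_X in
   so(r).  For r >= 5 the A_X with X in t commute, so R^r has an orthonormal basis
   o_0, o_1, ... in which they are block diagonal, and the operators
   o_2k o_(2k+1) commute with t.  By multiplicity one, a weight vector is an
   eigenvector of each of them, with eigenvalue i or -i: a weight v has a
   signature.  The operator o_2k o_2j changes the signs k and j and turns v into
   the weight v - f_k - f_j; if r is odd, o_2k o_(r-1) turns v into v - f_k.

   Let v be a longest weight.  If w is a weight of another signature, then
   2 <v, v - w> >= |v|^2.  Apply this to four disjoint flips of v and to the
   opposite of the flip of v along their union: the five vectors v - w add up to
   2 v, a contradiction.  This excludes r >= 18 for r even and r >= 11 for r odd.

   For r = 14 set f_8 = 2 v - (f_1 + ... + f_7).  Then 4 <v, f_i> = |v|^2 for all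
   i, and since the volume element of the Clifford algebra commutes with hh,
   f_i + f_8 = v - (v - f_i - f_8) is again a weight.  Comparing signatures, it is
   v - f_j - f_k for some j and k.  For at least four values of i this reads
   v = 2 f_i + f_k + f_8; these f_i are orthogonal, and Bessel's inequality for f_8
   contradicts the maximality of v. *)
Require Import Defs.
From HB Require Import structures.
From mathcomp Require Import all_boot all_order all_algebra.
From mathcomp Require Import sesquilinear spectral ring lra zify.
From mathcomp Require Import all_classical all_reals all_analysis.
From mathcomp Require Import complex.

Set Implicit Arguments.
Unset Strict Implicit.
Unset Printing Implicit Defensive.

Import Order.TTheory GRing.Theory Num.Theory.
Local Open Scope ring_scope.

(** The bounds are a matter of room. A weight [w] of another signature than [v] satisfies the
    inequality because [2 <v, w> / |v|^2] is an integer less than 2, and five differences adding up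
    to [2 v] would give [5 |v|^2 <= 4 |v|^2]. Four disjoint flips and one untouched plane, which
    keeps the fifth signature different from that of [v], need 5 planes if single signs can be
    flipped (r odd) and 9 if signs flip only in pairs (r even). Among the even ranks that remain, 14
    is the only one to exclude: its 7 planes are one pair short, [f_8] stands for the missing eighth
    flip, and four pairs adding up to [2 v] turn every inequality into an equality. From rank 5 on,
    so(r) is seen faithfully by its action on the Clifford operators; in rank 4 one of the two
    ideals of so(4) may act as zero. Ranks below 5 are all allowed. The analytic part is forced by
    the starting point: the bracket is a derivative in a chart and [rho] is only continuous, so
    antisymmetry, the Jacobi identity and the derivative of [rho] along one-parameter subgroups must
    be established before the algebra applies. *)

Section Complexification.
Context {R : realType} {n : nat}.
Local Notation C := R[i].
Local Notation V := 'rV[R]_n.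
Local Notation VC := 'rV[C]_n.
Local Notation "x %:C" := (real_complex R x) : ring_scope.
Implicit Types (x y : V) (z w : VC) (a b : C).

Definition cpair (x y : V) : VC := \row_j Complex (x 0 j) (y 0 j).
Definition reV z : V := \row_j complex.Re (z 0 j).
Definition imV z : V := \row_j complex.Im (z 0 j).
Definition cx (x : V) : VC := cpair x 0.
Definition conjV z : VC := cpair (reV z) (- imV z).

Lemma reV_pair x y : reV (cpair x y) = x.
Proof. by apply/rowP => j; rewrite !mxE. Qed.

Lemma imV_pair x y : imV (cpair x y) = y.
Proof. by apply/rowP => j; rewrite !mxE. Qed.

Lemma cpairE z : cpair (reV z) (imV z) = z.
Proof. by apply/rowP => j; rewrite !mxE; case: (z 0 j). Qed.

Lemma eqVC z w : reV z = reV w -> imV z = imV w -> z = w.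
Proof. by move=> h1 h2; rewrite -(cpairE z) -(cpairE w) h1 h2. Qed.

Lemma reVD z w : reV (z + w) = reV z + reV w.
Proof. by apply/rowP => j; rewrite !mxE; case: (z 0 j); case: (w 0 j). Qed.
Lemma imVD z w : imV (z + w) = imV z + imV w.
Proof. by apply/rowP => j; rewrite !mxE; case: (z 0 j); case: (w 0 j). Qed.
Lemma reV0 : reV 0 = 0. Proof. by apply/rowP => j; rewrite !mxE. Qed.
Lemma imV0 : imV 0 = 0. Proof. by apply/rowP => j; rewrite !mxE. Qed.
Lemma reVN z : reV (- z) = - reV z.
Proof. by apply/rowP => j; rewrite !mxE; case: (z 0 j). Qed.
Lemma imVN z : imV (- z) = - imV z.
Proof. by apply/rowP => j; rewrite !mxE; case: (z 0 j). Qed.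

Lemma reVZ a z : reV (a *: z) =
  complex.Re a *: reV z - complex.Im a *: imV z.
Proof. by apply/rowP => j; rewrite !mxE; case: (z 0 j); case: a. Qed.
Lemma imVZ a z : imV (a *: z) =
  complex.Re a *: imV z + complex.Im a *: reV z.
Proof. by apply/rowP => j; rewrite !mxE; case: (z 0 j); case: a => ? ? ? ? /=; ring. Qed.

Lemma reV_cx x : reV (cx x) = x. Proof. exact: reV_pair. Qed.
Lemma imV_cx x : imV (cx x) = 0. Proof. exact: imV_pair. Qed.

Lemma conjVK : involutive conjV.
Proof. by move=> z; apply: eqVC; rewrite ?reV_pair ?imV_pair ?opprK. Qed.

Lemma conjV_eq0 z : (conjV z == 0) = (z == 0).
Proof.
apply/eqP/eqP => [H|->]; last by apply: eqVC; rewrite ?reV_pair ?imV_pair ?reV0 ?imV0 ?oppr0.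
by rewrite -(conjVK z) H; apply: eqVC; rewrite ?reV_pair ?imV_pair ?reV0 ?imV0 ?oppr0.
Qed.

Lemma conjVZ a z : conjV (a *: z) = conjc a *: conjV z.
Proof.
apply: eqVC; rewrite ?(reV_pair, imV_pair, reVZ, imVZ).
  by case: a => ? ? /=; rewrite scalerN !scaleNr opprK.
by case: a => ? ? /=; rewrite scalerN scaleNr opprD.
Qed.

Definition endC (f : V -> V) z : VC := cpair (f (reV z)) (f (imV z)).

Lemma reV_endC f z : reV (endC f z) = f (reV z).
Proof. exact: reV_pair. Qed.
Lemma imV_endC f z : imV (endC f z) = f (imV z).
Proof. exact: imV_pair. Qed.
Definition endC_parts := (reV_endC, imV_endC).

Section EndC.
Variable f : V -> V.
Hypothesis f_lin : linear f.

Let fD x y : f (x + y) = f x + f y.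
Proof. by have := f_lin 1 x y; rewrite !scale1r. Qed.
Let fZ k x : f (k *: x) = k *: f x.
Proof.
have f0 : f 0 = 0 by have := f_lin (-1) 0 0; rewrite scaler0 addr0 scaleN1r addNr.
by have := f_lin k x 0; rewrite !addr0 f0 addr0.
Qed.
Let fN x : f (- x) = - f x.
Proof. by rewrite -scaleN1r fZ scaleN1r. Qed.

Lemma endCZ a z : endC f (a *: z) = a *: endC f z.
Proof.
by apply: eqVC; rewrite ?(reV_pair, imV_pair, reVZ, imVZ, fD, fZ, fN).
Qed.

Lemma endC_conj z : endC f (conjV z) = conjV (endC f z).
Proof. by apply: eqVC; rewrite !(reV_pair, imV_pair, fN). Qed.

End EndC.

Section Bracket.
Variable br : V -> V -> V.
Hypothesis br_linl : forall y, linear (br^~ y).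
Hypothesis br_linr : forall x, linear (br x).
Hypothesis brC : forall x y, br x y = - br y x.
Hypothesis brJ : forall u x y, br u (br x y) = br (br u x) y + br x (br u y).

Let D1 x x' y : br (x + x') y = br x y + br x' y.
Proof. by have := br_linl y 1 x x'; rewrite !scale1r. Qed.
Let D2 x y y' : br x (y + y') = br x y + br x y'.
Proof. by have := br_linr x 1 y y'; rewrite !scale1r. Qed.
Let Z2 k x y : br x (k *: y) = k *: br x y.
Proof.
have f0 : br x 0 = 0 by have := br_linr x (-1) 0 0; rewrite scaler0 addr0 scaleN1r addNr.
by have := br_linr x k y 0; rewrite !addr0 f0 addr0.
Qed.
Let Z1 k x y : br (k *: x) y = k *: br x y.
Proof. by rewrite brC Z2 -scalerN -brC. Qed.
Let N1 x y : br (- x) y = - br x y.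
Proof. by rewrite -scaleN1r Z1 scaleN1r. Qed.
Let N2 x y : br x (- y) = - br x y.
Proof. by rewrite -scaleN1r Z2 scaleN1r. Qed.

Definition bracketC z w : VC :=
  cpair (br (reV z) (reV w) - br (imV z) (imV w))
        (br (reV z) (imV w) + br (imV z) (reV w)).

Local Notation "[[ z , w ]]" := (bracketC z w).

Let simpl := (reV_pair, imV_pair, reVD, imVD, reVZ, imVZ, reVN, imVN,
  D1, D2, Z1, Z2, N1, N2).

Lemma bracketC_linr z : linear (bracketC z).
Proof.
by move=> a w w'; apply: eqVC; rewrite ?simpl; apply/rowP => j; rewrite !mxE; ring.
Qed.

Lemma bracketC_asym z w : [[z, w]] = - [[w, z]].
Proof.
apply: eqVC; rewrite ?simpl; apply/rowP => j.
  by rewrite (brC (reV w)) (brC (imV w)) !mxE; ring.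
by rewrite (brC (reV w)) (brC (imV w)) !mxE; ring.
Qed.

Lemma bracketC_Zr a z w : [[z, a *: w]] = a *: [[z, w]].
Proof.
by apply: eqVC; rewrite ?simpl; apply/rowP => j; rewrite !mxE; ring.
Qed.

Lemma bracketC_Zl a z w : [[a *: z, w]] = a *: [[z, w]].
Proof. by rewrite bracketC_asym bracketC_Zr -scalerN -bracketC_asym. Qed.

Lemma bracketC_jacobi u z w :
  [[u, [[z, w]]]] = [[ [[u, z]], w]] + [[z, [[u, w]]]].
Proof.
apply: eqVC; rewrite ?simpl; apply/rowP => j.
  by rewrite !(brJ (reV u)) !(brJ (imV u)) !mxE; ring.
by rewrite !(brJ (reV u)) !(brJ (imV u)) !mxE; ring.
Qed.

Lemma bracketC_cx x w : [[cx x, w]] = endC (br x) w.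
Proof.
have br0 y : br 0 y = 0 by have := Z1 0 0 y; rewrite !scale0r.
by apply: eqVC; rewrite ?simpl ?br0 ?addr0 ?subr0.
Qed.

End Bracket.

Section Form.
Variable B : V -> V -> R.
Hypothesis BDl : forall x y u, B (x + y) u = B x u + B y u.
Hypothesis BZl : forall k x u, B (k *: x) u = k * B x u.
Hypothesis Bsym : forall x y, B x y = B y x.

Let D2 x y y' : B x (y + y') = B x y + B x y'.
Proof. by rewrite Bsym BDl !(Bsym x). Qed.
Let Z2 k x y : B x (k *: y) = k * B x y.
Proof. by rewrite Bsym BZl (Bsym x). Qed.
Let N1 x y : B (- x) y = - B x y.
Proof. by rewrite -scaleN1r BZl mulN1r. Qed.
Let N2 x y : B x (- y) = - B x y.
Proof. by rewrite -scaleN1r Z2 mulN1r. Qed.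

(** The complex bilinear extension of [B]; the associated Hermitian form is [formC z (conjV w)]. *)
Definition formC z w : C :=
  Complex (B (reV z) (reV w) - B (imV z) (imV w))
          (B (reV z) (imV w) + B (imV z) (reV w)).

Let simpl := (reV_pair, imV_pair, reVD, imVD, reVZ, imVZ, reVN, imVN,
  BDl, D2, BZl, Z2, N1, N2).

Lemma formC_sym z w : formC z w = formC w z.
Proof.
by rewrite /formC !(Bsym (reV w)) !(Bsym (imV w)) [X in Complex _ X]addrC.
Qed.

Lemma formCDl z w u : formC (z + w) u = formC z u + formC w u.
Proof.
by apply/eqP; rewrite eq_complex /formC /= ?simpl; apply/andP; split; apply/eqP; ring.
Qed.

Lemma formCZl a z u : formC (a *: z) u = a * formC z u.
Proof.
by case: a => p q; apply/eqP; rewrite eq_complex /formC /= ?simpl /=; apply/andP; split; apply/eqP; ring.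
Qed.

Lemma formC_conj z : formC z (conjV z) = (B (reV z) (reV z) + B (imV z) (imV z))%:C.
Proof.
apply/eqP; rewrite eq_complex /formC /= !simpl opprK eqxx /=.
by rewrite (Bsym (imV z)) addNr.
Qed.

End Form.

End Complexification.

(** * Root strings *)

Section Sl2.
Context {C : numFieldType} {n : nat}.
Local Notation VC := 'rV[C]_n.

(** Otherwise the characteristic polynomial, of degree [n], would have [n + 1] distinct roots. This
    is what terminates root strings. *)
Lemma distinct_eigenvalues (f : VC -> VC) (f_lin : linear f) (lam : nat -> C)
    (u : nat -> VC) :
  injective lam -> (forall k, f (u k) = lam k *: u k) -> exists k, u k = 0.
Proof.
move=> lam_inj fu; apply/not_existsP => u0.
pose F : {linear VC -> VC} := HB.pack f (GRing.isLinear.Build _ _ _ _ _ f_lin).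
pose s := [seq lam k | k <- iota 0 n.+1].
have us : uniq s by rewrite map_inj_uniq ?iota_uniq.
have rs : all (root (char_poly (lin1_mx F))) s.
  apply/allP => _ /mapP[k _ ->]; rewrite -eigenvalue_root_char.
  apply/eigenvalueP; exists (u k); first by rewrite mul_rV_lin1 -fu.
  by apply/eqP; exact: u0.
have := max_poly_roots (monic_neq0 (char_poly_monic _)) rs us.
by rewrite size_char_poly size_map size_iota ltnn.
Qed.

Variables (E F K : VC -> VC).
Hypotheses (F_lin : linear F) (E_lin : linear E) (K_lin : linear K).
Variables (kappa a c : C) (y : VC).
Hypotheses (kappa0 : kappa != 0) (a0 : a != 0) (y0 : y != 0).
Hypothesis FE : forall z, F (E z) = E (F z) + kappa *: K z.
Hypothesis KE : forall z, K (E z) = E (K z) + a *: E z.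
Hypotheses (Fy : F y = 0) (Ky : K y = c *: y).

Let EZ k z : E (k *: z) = k *: E z.
Proof.
have E0 : E 0 = 0 by have := E_lin (-1) 0 0; rewrite scaler0 addr0 scaleN1r addNr.
by have := E_lin k z 0; rewrite !addr0 E0 addr0.
Qed.

Let u k := iter k E y.

Let Ku k : K (u k) = (c + a *+ k) *: u k.
Proof.
elim: k => [|k IH]; first by rewrite /u /= Ky mulr0n addr0.
by rewrite /u /= KE IH EZ -scalerDl mulrSr addrA.
Qed.

Let T k := (\sum_(i < k.+1) i)%N.
Let TS k : T k.+1 = (T k + k.+1)%N.
Proof. by rewrite /T big_ord_recr. Qed.

(** Moving [F] past the [k + 1] copies of [E] collects [kappa] times the sum of the [K]-eigenvalues
    [c + a j] for [j <= k]; [T k] is the triangular number. *)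
Let Fu k : F (u k.+1) = (kappa * (c *+ k.+1 + a *+ T k)) *: u k.
Proof.
elim: k => [|k IH].
  rewrite /u /= FE Fy; have := EZ 0 0; rewrite !scale0r => ->.
  by rewrite add0r Ky scalerA /T big_ord1 addr0.
have uS j : u j.+1 = E (u j) by [].
rewrite (uS k.+1) FE IH EZ -(uS k) Ku scalerA -scalerDl -mulrDr.
by congr ((_ * _) *: _); rewrite TS mulrnDr [c *+ k.+2]mulrSr addrACA.
Qed.

(* Iterating the raising operator on the lowest weight vector must stop. *)
Lemma lowest_weight : exists l : nat, c *+ 2 = - (a *+ l).
Proof.
have [k uk] : exists k, u k = 0.
  apply: (@distinct_eigenvalues K K_lin (fun k => c + a *+ k)) => //.
  move=> i j /addrI/eqP; rewrite -(mulr_natr a i) -(mulr_natr a j).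
  by move/eqP/(mulfI a0)/eqP; rewrite eqr_nat => /eqP.
have /ex_minnP[m /eqP um mmin] : exists k, u k == 0 by exists k; apply/eqP.
case: m um mmin => [/eqP|m um mmin]; first by rewrite /u /= (negPf y0).
exists m; have := Fu m; rewrite um.
have := F_lin (-1) 0 0; rewrite scaler0 addr0 scaleN1r addNr => ->.
move=> /esym/eqP; rewrite scaler_eq0 mulf_eq0 (negPf kappa0) /=.
have -> /= : (u m == 0) = false by apply/negP => /mmin; rewrite ltnn.
rewrite orbF => /eqP H.
(* At the first vanishing vector the coefficient in [Fu] is zero; since [2 T m = m (m + 1)], its
   double factors as [(m + 1) (2 c + a m)]. *)
have : (c *+ m.+1 + a *+ T m) *+ 2 = (c *+ 2 + a *+ m) *+ m.+1.
  have Tm : (T m * 2 = m * m.+1)%N.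
    by elim: (m) => [|j IH]; [rewrite /T big_ord1 | rewrite TS mulnDl IH; lia].
  rewrite mulrnDl [RHS]mulrnDl -(mulrnA a (T m) 2) Tm mulrnA; congr (_ + _).
  exact: mulrnAC.
rewrite H mul0rn => /esym/eqP; rewrite mulrn_eq0 /= addr_eq0 => /eqP ->.
by [].
Qed.

End Sl2.

(** A duplicate-free list of elements of [P] of maximal length contains all of them, so the maximum
    is taken over a finite list. *)
Lemma exists_maximum (T : eqType) (R : realType) (P : T -> Prop) (N : nat) (f : T -> R) :
  (exists v, P v) ->
  (forall s, uniq s -> (forall v, v \in s -> P v) -> (size s <= N)%N) ->
  exists v, P v /\ forall w, P w -> f w <= f v.
Proof.
move=> [v0 Pv0] Pfin.
pose Q k := `[< exists s, [/\ uniq s, (forall v, v \in s -> P v) & size s = k] >].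
have Q1 : exists k, Q k.
  exists 0%N; apply/asboolP; by exists [::].
have QN k : Q k -> (k <= N)%N.
  by move=> /asboolP[s [us Ps <-]]; exact: Pfin.
case: (ex_maxnP Q1 QN) => k /asboolP[s [us Ps sk]] kmax.
have all_s w : P w -> w \in s.
  move=> Pw; apply/negPn/negP => ws.
  have /kmax : Q k.+1.
    apply/asboolP; exists (w :: s); split => //=; first by rewrite ws.
      by move=> v; rewrite inE => /predU1P[->//|]; exact: Ps.
    by rewrite sk.
  by rewrite ltnn.
have max_s (s' : seq T) : s' != [::] -> exists2 v, v \in s' & forall w, w \in s' -> f w <= f v.
  elim: s' => // a [|b s'] IH _.
    by exists a; rewrite ?inE// => w; rewrite inE => /eqP ->.
  have [v vs vmax] := IH isT.
  have [av|va] := leP (f a) (f v).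
    exists v; first by rewrite inE vs orbT.
    by move=> w; rewrite inE => /predU1P[->//|]; exact: vmax.
  exists a; first by rewrite inE eqxx.
  move=> w; rewrite inE => /predU1P[->//|ws]; apply: le_trans (ltW va); exact: vmax.
have [|v vs vmax] := max_s s.
  by apply/eqP => s0; have := all_s _ Pv0; rewrite s0.
by exists v; split; [exact: Ps | move=> w Pw; apply: vmax; exact: all_s].
Qed.

(** * Weights of a self-centralizing abelian subalgebra *)

Section Roots.
Context {R : realType} {n : nat}.
Local Notation C := R[i].
Local Notation V := 'rV[R]_n.
Local Notation VC := 'rV[C]_n.
Variable br : V -> V -> V.
Hypothesis br_linl : forall y, linear (br^~ y).
Hypothesis br_linr : forall x, linear (br x).
Hypothesis brC : forall x y, br x y = - br y x.
Hypothesis brJ : forall u x y, br u (br x y) = br (br u x) y + br x (br u y).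
Variable B : V -> V -> R.
Hypothesis BDl : forall x y u, B (x + y) u = B x u + B y u.
Hypothesis BZl : forall k x u, B (k *: x) u = k * B x u.
Hypothesis Bsym : forall x y, B x y = B y x.
Hypothesis Bpos : forall x, x != 0 -> 0 < B x x.
Hypothesis Binv : forall X Y Z, B (br X Y) Z + B Y (br X Z) = 0.
Variable t : {vspace V}.
Hypothesis t_ab : {in t &, forall X Y, br X Y = 0}.
Hypothesis t_self : forall x, (forall X, X \in t -> br X x = 0) -> x \in t.

Local Notation "[[ z , w ]]" := (bracketC br z w).
Local Notation BC := (formC B).

Lemma formDr x y u : B x (y + u) = B x y + B x u.
Proof. by rewrite Bsym BDl !(Bsym x). Qed.
Lemma formZr k x u : B x (k *: u) = k * B x u.
Proof. by rewrite Bsym BZl (Bsym x). Qed.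
Lemma formNl x u : B (- x) u = - B x u.
Proof. by rewrite -scaleN1r BZl mulN1r. Qed.
Lemma formNr x u : B x (- u) = - B x u.
Proof. by rewrite Bsym formNl Bsym. Qed.
Lemma formBl x y u : B (x - y) u = B x u - B y u.
Proof. by rewrite BDl formNl. Qed.
Lemma form_ge0 x : 0 <= B x x.
Proof.
have [->|/Bpos/ltW//] := eqVneq x 0.
by have := BZl 0 0 0; rewrite scale0r mul0r => ->.
Qed.
Lemma form_eq0 x : B x x = 0 -> x = 0.
Proof. by move=> H; apply/eqP/contraT => /Bpos; rewrite H ltxx. Qed.

Let br1D x y u : br (x + y) u = br x u + br y u.
Proof. by have := br_linl u 1 x y; rewrite !scale1r. Qed.
Let br2D x y u : br x (y + u) = br x y + br x u.
Proof. by have := br_linr x 1 y u; rewrite !scale1r. Qed.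
Let br20 x : br x 0 = 0.
Proof. by have := br_linr x (-1) 0 0; rewrite scaler0 addr0 scaleN1r addNr. Qed.
Let br2Z k x y : br x (k *: y) = k *: br x y.
Proof. by have := br_linr x k y 0; rewrite !addr0 br20 addr0. Qed.
Let br2N x y : br x (- y) = - br x y.
Proof. by rewrite -scaleN1r br2Z scaleN1r. Qed.
Let br1N x y : br (- x) y = - br x y.
Proof. by rewrite brC br2N -brC. Qed.
Let brr x : br x x = 0.
Proof.
have /eqP : (2 : R) *: br x x = 0 by rewrite scaler_nat mulr2n {1}brC addNr.
by rewrite scaler_eq0 pnatr_eq0 /= => /eqP.
Qed.

Lemma cartan_eq u v : u \in t -> v \in t -> (forall X, X \in t -> B X u = B X v) -> u = v.
Proof.
move=> ut vt H; apply/eqP; rewrite -subr_eq0; apply/eqP/form_eq0.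
by rewrite formDr formNr H ?subrr// rpredB.
Qed.

(** A weight is encoded by the vector of [t] representing it through [B]. The operators [br X] are
    skew for [B], so their eigenvalues are imaginary and this vector is real. *)
Definition weight (v : V) (z : VC) := v \in t /\
  forall X, X \in t -> [[cx X, z]] = Complex 0 (B X v) *: z.

Lemma weight_re v z X : weight v z -> X \in t -> br X (reV z) = - (B X v *: imV z).
Proof.
move=> [_ wz] Xt; have := congr1 (@reV R n) (wz X Xt).
by rewrite bracketC_cx// reV_pair reVZ /= scale0r add0r.
Qed.

Lemma weight_im v z X : weight v z -> X \in t -> br X (imV z) = B X v *: reV z.
Proof.
move=> [_ wz] Xt; have := congr1 (@imV R n) (wz X Xt).
by rewrite bracketC_cx// imV_pair imVZ /= scale0r add0r.
Qed.

Lemma weightP v z : v \in t -> (forall X, X \in t -> br X (reV z) = - (B X v *: imV z)) ->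
  (forall X, X \in t -> br X (imV z) = B X v *: reV z) -> weight v z.
Proof.
move=> vt h1 h2; split => // X Xt; rewrite bracketC_cx//.
by apply: eqVC; rewrite ?(reV_pair, imV_pair, reVZ, imVZ) /= scale0r add0r ?h1 ?h2.
Qed.

Lemma weight_conj v z : weight v z -> weight (- v) (conjV z).
Proof.
move=> wz; apply: weightP; first by rewrite rpredN; case: wz.
  by move=> X Xt; rewrite !(reV_pair, imV_pair) (weight_re wz)// formNr scaleNr scalerN opprK.
by move=> X Xt; rewrite !(reV_pair, imV_pair) br2N (weight_im wz)// formNr scaleNr.
Qed.

Lemma weight_bracket v w z y : weight v z -> weight w y -> weight (v + w) [[z, y]].
Proof.
move=> [vt wz] [wt wy]; split; first exact: rpredD.
move=> X Xt; rewrite bracketC_jacobi// wz// wy//.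
rewrite bracketC_Zl// bracketC_Zr//.
rewrite -scalerDl; congr (_ *: _); apply/eqP; rewrite eq_complex /=.
by rewrite addr0 formDr !eqxx.
Qed.

Lemma weight_lin v z z' a : weight v z -> weight v z' -> weight v (a *: z + z').
Proof.
move=> [vt wz] [_ wz']; split => // X Xt.
by rewrite bracketC_linr// wz// wz'// scalerDr !scalerA [a * _]mulrC.
Qed.

(** The bracket has weight zero, hence lies in the complexification of [t] by self-centralization;
    pairing it with [t] and using the invariance of [B] identifies it. The scalar is [-i] times the
    Hermitian product [formC B e' (conjV e)]. *)
Lemma weight_bracket_conj v e e' : weight v e -> weight v e' ->
  [[conjV e, e']] = Complex (B (imV e') (reV e) - B (reV e') (imV e))
     (- (B (imV e') (imV e) + B (reV e') (reV e))) *: cx v.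
Proof.
move=> we we'; have vt := we.1.
have w0 := weight_bracket (weight_conj we) we'; rewrite addNr in w0.
have B0 X : B X 0 = 0 by have := formZr 0 X 0; rewrite scale0r mul0r.
have ret : reV [[conjV e, e']] \in t.
  by apply: t_self => X Xt; rewrite (weight_re w0)// B0 scale0r oppr0.
have imt : imV [[conjV e, e']] \in t.
  by apply: t_self => X Xt; rewrite (weight_im w0)// B0 scale0r.
have Bbr x y X : B X (br x y) = B (br X x) y.
  by have := Binv x y X; rewrite (Bsym X) (brC X) formNl (Bsym y) => /eqP; rewrite addr_eq0 => /eqP.
apply: eqVC.
  rewrite reVZ reV_cx imV_cx scaler0 subr0 /=; apply: cartan_eq => //; first exact: rpredZ.
  move=> X Xt; rewrite /bracketC /conjV !(reV_pair, imV_pair) formDr formNr !br1N formNr opprK !Bbr.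
  rewrite (weight_re we)// (weight_im we)// formNl !BZl formZr.
  by rewrite (Bsym (imV e)) (Bsym (reV e)); ring.
rewrite imVZ reV_cx imV_cx scaler0 add0r /=; apply: cartan_eq => //; first exact: rpredZ.
move=> X Xt; rewrite /bracketC /conjV !(reV_pair, imV_pair) formDr !br1N formNr !Bbr.
rewrite (weight_re we)// (weight_im we)// formNl !BZl formZr.
by rewrite (Bsym (imV e)) (Bsym (reV e)); ring.
Qed.

Section Sl2Triple.
Variables (v : V) (e : VC).
Hypotheses (we : weight v e) (v0 : v != 0) (e0 : e != 0).
Let N : R := B (imV e) (imV e) + B (reV e) (reV e).

Let N0 : 0 < N.
Proof.
rewrite lt_neqAle addr_ge0 ?form_ge0// andbT eq_sym; apply/eqP => H.
case/eqP: e0; apply: eqVC; rewrite ?reV0 ?imV0; apply: form_eq0.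
  by have := form_ge0 (imV e); have := form_ge0 (reV e); move: H; rewrite /N; lra.
by have := form_ge0 (imV e); have := form_ge0 (reV e); move: H; rewrite /N; lra.
Qed.

Let vt : v \in t := we.1.

Let root_bracket z : [[ [[conjV e, e]], z]] = Complex 0 (- N) *: [[cx v, z]].
Proof.
rewrite (weight_bracket_conj we we) (Bsym (reV e)) subrr.
by rewrite bracketC_Zl.
Qed.

(** Up to scalars, [e], [conjV e] and [cx v] form an sl2-triple with raising operator [e]: in
    [lowest_weight], [kappa = - i N], [a = i |v|^2] and [c = i <v, w>]. A vector killed by [conjV e]
    has lowest weight. *)
Lemma lowest_root w y : weight w y -> y != 0 -> [[conjV e, y]] = 0 ->
  exists l : nat, 2 * B w v = - l%:R * B v v.
Proof.
move=> wy y0 fy.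
have ne0 (x : R) : x != 0 -> Complex 0 x != 0 :> C.
  by move=> x0; rewrite eq_complex /= negb_and x0 orbT.
have k0 : Complex 0 (- N) != 0 :> C by apply: ne0; rewrite oppr_eq0 gt_eqF.
have a0 : Complex 0 (B v v) != 0 :> C by apply: ne0; rewrite gt_eqF// Bpos.
have FE z : [[conjV e, [[e, z]]]] = [[e, [[conjV e, z]]]] + Complex 0 (- N) *: [[cx v, z]].
  by rewrite bracketC_jacobi// root_bracket addrC.
have KE z : [[cx v, [[e, z]]]] = [[e, [[cx v, z]]]] + Complex 0 (B v v) *: [[e, z]].
  by rewrite bracketC_jacobi// (we.2 v vt) addrC bracketC_Zl.
have Ky := wy.2 v vt.
have [l] : exists l : nat, (Complex 0 (B v w) : C) *+ 2 = - ((Complex 0 (B v v) : C) *+ l).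
  by apply: lowest_weight FE KE fy Ky => //; exact: bracketC_linr.
have ImD (a b : C) : complex.Im (a + b) = complex.Im a + complex.Im b.
  by case: a; case: b.
have ImMn (a : C) k : complex.Im (a *+ k) = complex.Im a *+ k.
  by elim: k => [|k IH]; rewrite ?mulr0n// !mulrS ImD IH.
have ImN (a : C) : complex.Im (- a) = - complex.Im a by case: a.
move/(congr1 (@complex.Im R)); rewrite ImN !ImMn /= => H; exists l.
by rewrite Bsym mulr_natl H mulNr mulr_natl.
Qed.

(** A lowest weight vector would have a nonpositive Cartan number. The bracket is then a nonzero
    vector of weight [w - v]. *)
Lemma root_pairing w y : weight w y -> y != 0 -> 0 < B w v ->
  [[conjV e, y]] != 0.
Proof.
move=> wy y0 Bwv; apply/eqP => /(lowest_root wy y0)[l H].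
have : 0 < 2 * B w v by rewrite mulr_gt0.
by rewrite H mulNr oppr_gt0 ltNge mulr_ge0// form_ge0.
Qed.

(** Lowering [y] until it vanishes ends at a lowest weight vector of weight [w - m v], whose Cartan
    number is [- l]; hence that of [w] is [2 m - l]. *)
Lemma root_integrality w y : weight w y -> y != 0 ->
  exists k : int, 2 * B w v = k%:~R * B v v.
Proof.
move=> wy y0; pose u k := iter k (bracketC br (conjV e)) y.
have wu k : weight (w - k%:R *: v) (u k).
  elim: k => [|k IH]; first by rewrite scale0r subr0.
  have -> : w - k.+1%:R *: v = - v + (w - k%:R *: v).
    by apply/rowP => j; rewrite !mxE -natr1; ring.
  exact: weight_bracket (weight_conj we) IH.
have Bvv := Bpos v0.
have [k uk] : exists k, u k = 0.
  apply: (@distinct_eigenvalues C n (bracketC br (cx v)) _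
    (fun k => Complex 0 (B v (w - k%:R *: v)))).
  - exact: bracketC_linr.
  - move=> i j /(congr1 (@complex.Im R)) /=.
    rewrite !formDr !formNr !formZr => /addrI/oppr_inj/mulIf.
    by rewrite gt_eqF// => /(_ isT)/eqP; rewrite eqr_nat => /eqP.
  - by move=> k; exact: (wu k).2.
have /ex_minnP[m /eqP um mmin] : exists k, u k == 0 by exists k; apply/eqP.
case: m um mmin => [/eqP|m um mmin]; first by rewrite /u /= (negPf y0).
have um0 : u m != 0 by apply/negP => /mmin; rewrite ltnn.
have [l] := lowest_root (wu m) um0 um.
rewrite formBl BZl => H; exists (2 * m%:Z - l%:Z).
rewrite rmorphB rmorphM /= mulrBl -!pmulrn.
by move: H; rewrite mulrBr mulrA mulNr; lra.
Qed.

(** Subtracting a multiple of [e] from [e'] makes the result killed by [conjV e]. If it were nonzero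
    it would be a lowest weight vector of weight [v], although the Cartan number of [v] with itself
    is positive. *)
Lemma root_multiplicity e' : weight v e' -> exists a : C, e' = a *: e.
Proof.
move=> we'; have wee := weight_bracket_conj we we; have wee' := weight_bracket_conj we we'.
move: wee wee'; set ka : C := Complex _ _; set la : C := Complex _ _ => wee wee'.
have ka0 : ka != 0 by apply/eqP => /(congr1 (@complex.Im R)) /= /eqP; rewrite oppr_eq0 gt_eqF//; exact: N0.
exists (la / ka).
have we'' : weight v (- (la / ka) *: e + e') by exact: weight_lin.
have f0 : [[conjV e, - (la / ka) *: e + e']] = 0.
  by rewrite bracketC_linr// wee wee' scalerA -scalerDl mulNr divfK// addNr scale0r.
have [/eqP|ne0] := eqVneq (- (la / ka) *: e + e') 0.
  by rewrite scaleNr addrC subr_eq0 => /eqP.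
have [l H] := lowest_root we'' ne0 f0.
have : 0 < 2 * B v v by rewrite mulr_gt0// Bpos.
by rewrite H mulNr oppr_gt0 ltNge mulr_ge0// form_ge0.
Qed.

End Sl2Triple.

Lemma formC_invariant u z w : BC [[u, z]] w = - BC z [[u, w]].
Proof.
have I X Y Z : B (br X Y) Z = - B Y (br X Z).
  by apply/eqP; rewrite -addr_eq0 Binv.
apply/eqP; rewrite eq_complex /formC /bracketC !(reV_pair, imV_pair) /=.
rewrite !BDl !formNl !formDr !formNr !I; apply/andP; split; apply/eqP; ring.
Qed.

Lemma weight_orthogonal v w z y : weight v z -> weight w y -> v <> w ->
  BC z (conjV y) = 0.
Proof.
move=> wz wy vw; have wy' := weight_conj wy.
have vt := wz.1; have wt := wy.1.
(* At this [X] the two eigenvalues differ by [i |v - w|^2]. *)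
pose X := v - w; have Xt : X \in t by exact: rpredB.
have := formC_invariant (cx X) z (conjV y).
rewrite wz.2// wy'.2// formCZl// [X in _ = - X]formC_sym// formCZl//.
rewrite (formC_sym Bsym (conjV y)) -mulNr => /eqP; rewrite -subr_eq0 -mulrBl mulf_eq0.
case/orP => [|/eqP//]; rewrite eq_complex /= => /andP[_ /eqP].
rewrite formNr opprK -formNr -formDr => /form_eq0/eqP.
by rewrite subr_eq0 => /eqP.
Qed.

Lemma weight_nondeg z : BC z (conjV z) = 0 -> z = 0.
Proof.
rewrite formC_conj// => /(congr1 (@complex.Re R)) /= H.
have h1 := form_ge0 (reV z); have h2 := form_ge0 (imV z).
by apply: eqVC; rewrite ?reV0 ?imV0; apply: form_eq0; lra.
Qed.

(** Vectors of distinct weights are orthogonal for a definite Hermitian form, hence independent. *)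
Lemma finite_weights (s : seq V) : uniq s ->
  (forall v, v \in s -> exists2 z, weight v z & z != 0) -> (size s <= n)%N.
Proof.
move=> us ws; rewrite leqNgt; apply/negP => sn.
have /choice[z zP] : forall i : 'I_(size s), exists z, weight s`_i z /\ z != 0.
  by move=> i; have [|z ? ?] := ws s`_i; [exact: mem_nth | exists z].
pose Z := \matrix_(i < size s) z i.
have : kermx Z != 0.
  rewrite kermx_eq0 /row_free; apply/eqP => rZ.
  by have := rank_leq_col Z; rewrite rZ leqNgt sn.
case/rowV0Pn => a /sub_kermxP aZ /eqP; apply; apply/rowP => j; rewrite mxE.
have : \sum_i a 0 i *: z i = 0.
  apply: etrans aZ; rewrite mulmx_sum_row.
  by apply: eq_bigr => i _; rewrite rowK.
move/(congr1 (fun x => BC x (conjV (z j)))).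
have BC0 w : BC 0 w = 0.
  have : BC (0 *: (0 : VC)) w = 0 by rewrite formCZl// mul0r.
  by rewrite scale0r.
have BCsum (u : 'I_(size s) -> VC) w : BC (\sum_i u i) w = \sum_i BC (u i) w.
  by elim/big_rec2: _ => [|i y1 y2 _ <-]; rewrite ?BC0// formCDl.
rewrite BCsum (bigD1 j)//= big1 => [|i ij].
  rewrite addr0 formCZl// BC0; move/eqP; rewrite mulf_eq0 => /orP[/eqP//|/eqP/weight_nondeg zj].
  by have [_] := zP j; rewrite zj eqxx.
rewrite formCZl// (weight_orthogonal (zP i).1 (zP j).1) ?mulr0//.
by move/eqP; rewrite nth_uniq// => /eqP/val_inj/eqP; rewrite (negPf ij).
Qed.

End Roots.

(** * Commuting skew-symmetric matrices *)

Section CommonEigenvector.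
Context {R : realType} {n : nat}.
Local Notation C := R[i].
Local Notation mapC := (map_mx (real_complex R)).

Lemma stable_common_eigenvector (F : numClosedFieldType) (U : 'M[F]_n) (As : seq 'M[F]_n) :
  U != 0 -> {in As, forall A, stablemx U A} -> {in As &, forall A A', comm_mx A A'} ->
  exists2 z : 'rV_n, z != 0 /\ (z <= U)%MS & {in As, forall A, exists a, z *m A = a *: z}.
Proof.
move=> U0 stU cA.
have [|A' A''|v v0 /allP vP] := @common_eigenvector _ (\rank U) [seq restrictmx U A | A <- As].
- by rewrite lt0n mxrank_eq0.
- move=> /mapP[A hA ->] /mapP[A1 hA1 ->].
  by rewrite /comm_mx -!conjmxM ?inE ?stablemx_row_base ?stU// cA.
exists (v *m row_base U).
  rewrite mulmx_free_eq0 ?row_base_free//; split => //.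
  by rewrite (submx_trans (submxMl _ _))// eq_row_base.
move=> A hA; apply/sub_rVP.
rewrite -stablemx_restrict ?stU//.
by apply: vP; apply/mapP; exists A.
Qed.

Lemma cx_map k (x : 'rV[R]_k) : cx x = mapC x.
Proof. by apply/rowP => j; rewrite !mxE. Qed.

Lemma complex_split k (z : 'rV[C]_k) : z = cx (reV z) + Complex 0 1 *: cx (imV z).
Proof.
apply: eqVC; rewrite !(reVD, imVD, reVZ, imVZ, reV_pair, imV_pair) /=.
  by rewrite scaler0 scale0r subr0 addr0.
by rewrite scaler0 scale1r !add0r.
Qed.

Lemma mul_mapC k m (z : 'rV[C]_k) (M : 'M[R]_(k, m)) :
  reV (z *m mapC M) = reV z *m M /\ imV (z *m mapC M) = imV z *m M.
Proof.
have cx_mul (x : 'rV[R]_k) : cx x *m mapC M = cx (x *m M).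
  by rewrite !cx_map map_mxM.
rewrite {1 3}(complex_split z) mulmxDl -scalemxAl !cx_mul.
rewrite !(reVD, imVD, reVZ, imVZ, reV_pair, imV_pair) /=.
by rewrite !scaler0 !scale0r scale1r subr0 !addr0 !add0r.
Qed.

Section Skew.
Variable B : 'rV[R]_n -> 'rV[R]_n -> R.
Hypothesis BDl : forall x y u, B (x + y) u = B x u + B y u.
Hypothesis BZl : forall k x u, B (k *: x) u = k * B x u.
Hypothesis Bsym : forall x y, B x y = B y x.
Hypothesis Bpos : forall x, x != 0 -> 0 < B x x.

(** [x] and [y] are the real and imaginary parts of a complex common eigenvector. Skewness kills the
    real part [p] of each eigenvalue, as [p (|x|^2 + |y|^2) = 0]. If all eigenvalues vanish, [x] and
    [y] may be dependent or one of them zero. *)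
Lemma skew_plane (U : 'M[R]_n) (As : seq 'M[R]_n) :
  U != 0 -> {in As, forall A, stablemx U A} -> {in As &, forall A A', comm_mx A A'} ->
  {in As, forall A x, B (x *m A) x = 0} ->
  exists x y : 'rV[R]_n, [/\ (x != 0) || (y != 0), (x <= U)%MS, (y <= U)%MS &
    {in As, forall A, exists b, x *m A = - (b *: y) /\ y *m A = b *: x}].
Proof.
move=> U0 stU cA skA.
have [|A0|A0 A1|z [z0 zU] zA] := @stable_common_eigenvector C (mapC U) [seq mapC A | A <- As].
- by rewrite map_mx_eq0.
- by move=> /mapP[A hA ->]; rewrite -map_mxM map_submx; exact: stU.
- by move=> /mapP[A hA ->] /mapP[A' hA' ->]; rewrite /comm_mx -!map_mxM cA.
have [D zE] := submxP zU.
exists (reV z), (imV z); split.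
- apply: contraR z0; rewrite negb_or !negbK => /andP[/eqP h1 /eqP h2].
  by apply/eqP; apply: eqVC; rewrite ?reV0 ?imV0.
- by rewrite zE (mul_mapC D U).1 submxMl.
- by rewrite zE (mul_mapC D U).2 submxMl.
move=> A hA; have [|a zAa] := zA (mapC A); first by apply/mapP; exists A.
have [hre him] := mul_mapC z A; rewrite zAa reVZ imVZ in hre him.
set x := reV z in hre him *; set y := imV z in hre him *.
set p := complex.Re a in hre him *; set q := complex.Im a in hre him *.
have Bge x' : 0 <= B x' x'.
  have [->|/Bpos/ltW//] := eqVneq x' 0.
  by have := BZl 0 0 0; rewrite scale0r mul0r => ->.
have N1 x' u : B (- x') u = - B x' u by rewrite -scaleN1r BZl mulN1r.
have e1 : p * B x x - q * B y x = 0 by rewrite -BZl -BZl -N1 -BDl hre skA.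
have e2 : p * B y y + q * B x y = 0 by rewrite -BZl -BZl -BDl him skA.
have p0 : p = 0.
  have : p * (B x x + B y y) = 0 by move: e1 e2; rewrite (Bsym y x); lra.
  move/eqP; rewrite mulf_eq0 => /orP[/eqP//|/eqP H].
  case/eqP: z0; apply: eqVC; rewrite ?reV0 ?imV0; apply/eqP/contraT => /Bpos.
    by have := Bge y; rewrite -/x; move: H; lra.
  by have := Bge x; rewrite -/y; move: H; lra.
by exists q; rewrite -hre -him p0 !scale0r !add0r.
Qed.

End Skew.

End CommonEigenvector.

Section BlockDiagonal.
Context {R : realType} {r : nat}.
Local Notation V := 'rV[R]_r.

Definition dotv (x y : V) : R := (x *m y^T) 0 0.

Lemma dotvDl x y u : dotv (x + y) u = dotv x u + dotv y u.
Proof. by rewrite /dotv mulmxDl mxE. Qed.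
Lemma dotvZl k x u : dotv (k *: x) u = k * dotv x u.
Proof. by rewrite /dotv -scalemxAl mxE. Qed.
Lemma dotvC x y : dotv x y = dotv y x.
Proof. by rewrite /dotv -[x *m y^T]trmxK trmx_mul trmxK mxE. Qed.
Lemma dotv_gt0 x : x != 0 -> 0 < dotv x x.
Proof.
move=> x0; rewrite /dotv mxE; under eq_bigr do rewrite mxE -expr2.
rewrite lt_neqAle sumr_ge0 ?andbT => [|i _]; last exact: sqr_ge0.
apply: contraNneq x0 => /esym/eqP; rewrite psumr_eq0 => [/allP H|i _]; last exact: sqr_ge0.
apply/eqP/rowP => j; rewrite mxE; apply/eqP.
by have := H j (mem_index_enum j); rewrite sqrf_eq0.
Qed.
Lemma dotvDr x y u : dotv u (x + y) = dotv u x + dotv u y.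
Proof. by rewrite dotvC dotvDl !(dotvC u). Qed.
Lemma dotvZr k x u : dotv u (k *: x) = k * dotv u x.
Proof. by rewrite dotvC dotvZl (dotvC u). Qed.
Lemma dotvNl x u : dotv (- x) u = - dotv x u.
Proof. by rewrite -scaleN1r dotvZl mulN1r. Qed.
Lemma dotvNr x u : dotv u (- x) = - dotv u x.
Proof. by rewrite -scaleN1r dotvZr mulN1r. Qed.
Lemma dotv0l u : dotv 0 u = 0.
Proof. by have := dotvZl 0 0 u; rewrite scale0r mul0r. Qed.
Lemma dotv_skew (A : 'M[R]_r) x y : A^T = - A -> dotv (x *m A) y = - dotv x (y *m A).
Proof. by move=> sA; rewrite /dotv trmx_mul sA mulNmx mulmxN mulmxA [X in _ = - X]mxE opprK. Qed.
Lemma dotv_skew0 (A : 'M[R]_r) x : A^T = - A -> dotv (x *m A) x = 0.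
Proof.
move=> sA; have := dotv_skew x x sA; rewrite (dotvC x).
by move=> H; lra.
Qed.

(* The basis is grouped in consecutive pairs spanning the invariant planes. *)
Definition partner (i : nat) : nat := if odd i then i.-1 else i.+1.

Definition orthonormal_seq (o : seq V) :=
  forall i j, (i < size o)%N -> (j < size o)%N -> dotv o`_i o`_j = (i == j)%:R.

(** [nth] returns 0 past the end of [o]: a vector without partner has to be killed by all the
    matrices. *)
Definition block_seq (As : seq 'M[R]_r) (o : seq V) :=
  forall A, A \in As -> forall i, (i < size o)%N -> exists c, o`_i *m A = c *: o`_(partner i).

Lemma size_orthonormal o : orthonormal_seq o -> (size o <= r)%N.
Proof.
move=> oo; pose M := \matrix_(i < size o) o`_i.
have MM : M *m M^T = 1%:M.
  apply/matrixP => i j; rewrite -[LHS]/((M *m M^T) i j) !mxE.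
  rewrite -(oo i j (ltn_ord i) (ltn_ord j)) /dotv mxE.
  by apply: eq_bigr => k _; rewrite !mxE.
have := mxrankM_maxl M M^T; rewrite MM mxrank1 => h.
exact: leq_trans h (rank_leq_col M).
Qed.

Lemma normalize (x : V) : x != 0 -> exists2 k : R, 0 < k & dotv (k *: x) (k *: x) = 1.
Proof.
move=> /dotv_gt0 x0; exists (Num.sqrt (dotv x x))^-1; first by rewrite invr_gt0 sqrtr_gt0.
rewrite dotvZl dotvZr mulrA -invfM -expr2 sqr_sqrtr ?ltW// mulVf// gt_eqF//.
Qed.

(** The orthogonal complement of [o] is stable by skewness and contains a common plane. A genuine
    plane is put in front, which shifts indices by two and keeps partners together. If all matrices
    vanish on it, one of its vectors is appended at the end; the coefficient 0 then serves for it
    and for a former last vector without partner. *)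
Lemma block_step (As : seq 'M[R]_r) o :
  {in As, forall A : 'M[R]_r, A^T = - A} -> {in As &, forall A A', comm_mx A A'} ->
  orthonormal_seq o -> block_seq As o -> (size o < r)%N ->
  exists o', [/\ orthonormal_seq o', block_seq As o' & (size o < size o')%N].
Proof.
move=> skA cA oo bo so.
pose M := \matrix_(i < size o) o`_i.
pose U := kermx M^T.
have UP (x : V) : (x <= U)%MS -> forall i, (i < size o)%N -> dotv x o`_i = 0.
  move=> /sub_kermxP xM i si.
  have h : (x *m M^T) 0 (Ordinal si) = 0 by rewrite xM mxE.
  by apply: etrans h; rewrite /dotv !mxE; apply: eq_bigr => k _; rewrite !mxE.
have U0 : U != 0.
  rewrite kermx_eq0 /row_free mxrank_tr; apply/eqP => rM.
  by have := rank_leq_row M; rewrite rM leqNgt so.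
have stU : {in As, forall A, stablemx U A}.
  move=> A hA; apply/row_subP => i; rewrite row_mul.
  have xU : (row i U <= U)%MS by exact: row_sub.
  move: (row i U) xU => x xU; apply/sub_kermxP/rowP => j; rewrite [RHS]mxE.
  have -> : (x *m A *m M^T) 0 j = dotv (x *m A) o`_j.
    by rewrite /dotv !mxE; apply: eq_bigr => k _; rewrite !mxE.
  rewrite dotv_skew ?skA//; have [c ->] := bo A hA j (ltn_ord j).
  rewrite dotvZr; have [ps|ps] := ltnP (partner j) (size o).
    by rewrite UP// mulr0 oppr0.
  by rewrite nth_default// dotvC dotv0l mulr0 oppr0.
have [x [y [xy0 xU yU xyA]]] := skew_plane dotvDl dotvZl dotvC dotv_gt0 U0 stU cA
  (fun A hA x => dotv_skew0 x (skA A hA)).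
have [all0|] := boolP [forall i : 'I_(size As), (x *m As`_i == 0) && (y *m As`_i == 0)].
  have [u [u0 uU uA]] : exists u : V, [/\ u != 0, (u <= U)%MS & {in As, forall A, u *m A = 0}].
    have H A : A \in As -> x *m A = 0 /\ y *m A = 0.
      move=> hA; have hi : (index A As < size As)%N by rewrite index_mem.
      by have /forallP/(_ (Ordinal hi)) /= := all0; rewrite nth_index// => /andP[/eqP ? /eqP ?].
    by case/orP: xy0 => h; [exists x | exists y]; split => // A /H[].
  have [k k0 ku] := normalize u0.
  exists (rcons o (k *: u)); split; last by rewrite size_rcons.
    move=> i j; rewrite size_rcons !ltnS !nth_rcons.
    have su v : (v < size o)%N -> dotv (k *: u) o`_v = 0 by move=> ?; rewrite dotvZl UP// mulr0.
    case: (ltngtP i (size o)) => // hi _; case: (ltngtP j (size o)) => // hj _.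
    - exact: oo.
    - by rewrite dotvC su// hj ltn_eqF.
    - by rewrite su// hi eq_sym ltn_eqF.
    - by rewrite ku hi hj eqxx.
  move=> A hA i; rewrite size_rcons ltnS !nth_rcons.
  case: (ltngtP i (size o)) => // hi _.
    have [c hc] := bo A hA i hi.
    case: (ltngtP (partner i) (size o)) => hp; first by exists c.
      by exists 0; rewrite hc nth_default ?(ltnW hp)// scaler0 scale0r.
    by exists 0; rewrite hc nth_default ?hp// scaler0 scale0r.
  by exists 0; rewrite -scalemxAl uA// scaler0 scale0r.
rewrite negb_forall => /existsP[i0 hi0].
have hA0 : As`_i0 \in As by exact: mem_nth.
have [b [xA yA]] := xyA _ hA0.
have b0 : b != 0.
  by apply: contraNneq hi0 => b0; rewrite xA yA b0 !scale0r oppr0 eqxx.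
have x0 : x != 0.
  apply: contraL xy0 => /eqP x0; rewrite negb_or !negbK x0 eqxx /=.
  by move: xA; rewrite x0 mul0mx => /esym/eqP; rewrite oppr_eq0 scaler_eq0 (negPf b0).
(* A nonzero eigenvalue makes [x] and [y] orthogonal and of equal length, so that one scaling
   normalizes both. *)
have xx : dotv x x = dotv y y.
  have := dotv_skew x y (skA _ hA0); rewrite xA yA dotvNl dotvZl dotvZr.
  by move/oppr_inj/(mulfI b0).
have xy : dotv x y = 0.
  have := dotv_skew0 x (skA _ hA0); rewrite xA dotvNl dotvZl dotvC => /eqP.
  by rewrite oppr_eq0 mulf_eq0 (negPf b0) => /eqP.
have [k k0 kx] := normalize x0.
have ky : dotv (k *: y) (k *: y) = 1 by rewrite -kx !dotvZl !dotvZr xx.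
have kxy : dotv (k *: x) (k *: y) = 0 by rewrite dotvZl dotvZr xy !mulr0.
exists [:: k *: x, k *: y & o]; split => //.
  have ox i : (i < size o)%N -> dotv (k *: x) o`_i = 0 by move=> ?; rewrite dotvZl UP// mulr0.
  have oy i : (i < size o)%N -> dotv (k *: y) o`_i = 0 by move=> ?; rewrite dotvZl UP// mulr0.
  move=> [|[|i]] [|[|j]] //= hi hj; rewrite ?kx ?ky ?kxy ?ox ?oy//.
  - by rewrite dotvC.
  - by rewrite dotvC ox.
  - by rewrite dotvC oy.
  - exact: oo.
move=> A hA [|[|i]] /= hi.
- by have [b' [h _]] := xyA A hA; exists (- b'); rewrite -scalemxAl h scaleNr scalerN !scalerA mulrC.
- by have [b' [_ h]] := xyA A hA; exists b'; rewrite -scalemxAl h !scalerA mulrC.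
- have [c hc] := bo A hA i hi; exists c.
  by rewrite hc /partner /= negbK; case: i {hi hc} => [|i]//=; case: ifP.
Qed.

Lemma block_diagonalization (As : seq 'M[R]_r) :
  {in As, forall A : 'M[R]_r, A^T = - A} -> {in As &, forall A A', comm_mx A A'} ->
  exists o, [/\ orthonormal_seq o, block_seq As o & size o = r].
Proof.
move=> skA cA.
have H k : exists o, [/\ orthonormal_seq o, block_seq As o & (minn k r <= size o)%N].
  elim: k => [|k [ o [oo bo so]]]; first by exists [::]; split => //; rewrite min0n.
  have [sr|sr] := ltnP (size o) r.
    have [ o' [oo' bo' so']] := block_step skA cA oo bo sr.
    by exists o'; split => //; move: so so' sr; lia.
  by exists o; split => //; move: so sr; lia.
have [ o [oo bo so]] := H r; exists o; split => //; apply/eqP.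
by rewrite eqn_leq size_orthonormal//=; rewrite minnn in so.
Qed.

End BlockDiagonal.

Section Riesz.
Context {R : realType} {n : nat}.
Local Notation V := 'rV[R]_n.
Variable B : V -> V -> R.
Hypothesis BDl : forall x y u, B (x + y) u = B x u + B y u.
Hypothesis BZl : forall k x u, B (k *: x) u = k * B x u.
Hypothesis Bsym : forall x y, B x y = B y x.
Hypothesis Bpos : forall x, x != 0 -> 0 < B x x.
Variable t : {vspace V}.

Let Bsum (I : finType) (f : I -> V) u : B (\sum_i f i) u = \sum_i B (f i) u.
Proof.
have B0 : B 0 u = 0 by have := BZl 0 0 u; rewrite scale0r mul0r.
by elim/big_rec2: _ => // i a b _ <-.
Qed.

(** The Gram matrix of a basis of [t] is invertible because [B] is definite. This turns eigenvalues
    given on a basis into weight vectors. *)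
Lemma riesz_basis (f : 'I_(\dim t) -> R) :
  exists2 v, v \in t & forall i : 'I_(\dim t), B (vbasis t)`_i v = f i.
Proof.
pose b := vbasis t.
pose M : 'M[R]_(\dim t) := \matrix_(i, j) B b`_i b`_j.
have comb (a : 'rV_(\dim t)) j : (a *m M) 0 j = B (\sum_i a 0 i *: b`_i) b`_j.
  by rewrite mxE Bsum; apply: eq_bigr => i _; rewrite BZl mxE.
have uM : M \in unitmx.
  rewrite -row_free_unit -kermx_eq0; apply/rowV0P => a /sub_kermxP aM.
  have v0 : \sum_i a 0 i *: b`_i = 0.
    apply/eqP/contraT => /Bpos; rewrite Bsum big1 ?ltxx// => i _.
    by rewrite BZl Bsym -comb aM mxE mulr0.
  have := vbasisP t => /basis_free /freeP fr.
  by apply/rowP => i; rewrite mxE; exact: fr v0 i.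
pose a := (\row_i f i) *m invmx M.
exists (\sum_i a 0 i *: b`_i).
  by apply: rpred_sum => i _; apply: rpredZ; apply: vbasis_mem; rewrite mem_nth// size_tuple.
by move=> i; rewrite Bsym -comb /a mulmxKV// mxE.
Qed.

End Riesz.

(** * Operators of the even Clifford algebra *)

Section Anticommute.
Context {A : pzRingType}.
Implicit Types a b c d : A.

Lemma anti_pairs_commute a b c d : a * c = - (c * a) -> a * d = - (d * a) ->
  b * c = - (c * b) -> b * d = - (d * b) -> (a * b) * (c * d) = (c * d) * (a * b).
Proof.
move=> ac ad bc bd.
rewrite mulrA -(mulrA a b c) bc mulrN mulNr mulrA ac mulNr mulNr opprK.
by rewrite -!mulrA bd !mulrN (mulrA a d b) ad mulNr !mulrN opprK !mulrA.
Qed.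

Lemma anti_pairs_anticommute a b c : a * b = - (b * a) -> a * c = - (c * a) ->
  b * c = - (c * b) -> (a * b) * (a * c) = - ((a * c) * (a * b)).
Proof.
move=> ab ac bc.
have ca : c * a = - (a * c) by rewrite ac opprK.
have ba : b * a = - (a * b) by rewrite ab opprK.
rewrite -(mulrA a b) (mulrA b) ba mulNr mulrN -(mulrA a c) (mulrA c) ca mulNr mulrN opprK.
by rewrite -(mulrA a b) bc mulrN mulrN opprK !mulrA.
Qed.

End Anticommute.

Section EvenClifford.
Context {R : realType} {r : nat}.
Local Notation Cl := (clifford R r).
Local Notation even := (@even_clifford R r).

Lemma odd_card_symdiff (S T : {set 'I_r}) :
  odd #|symdiff S T| = odd #|S| (+) odd #|T|.
Proof.
have -> : #|symdiff S T| = (#|S :\: T| + #|T :\: S|)%N.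
  rewrite /symdiff cardsU; have -> : ((S :\: T) :&: (T :\: S) = finset.set0)%SET.
    by apply/setP => i; rewrite !inE; case: (i \in S); case: (i \in T).
  by rewrite cards0 subn0.
rewrite -(cardsID T S) -(cardsID S T) finset.setIC !oddD.
by case: (odd #|_ :&: _|); case: (odd _); case: (odd _).
Qed.

Lemma evenP (x : Cl) : reflect (forall S : {set 'I_r}, odd #|S| -> x S = 0) (x \in even).
Proof.
apply: (iffP forallP) => H S; first by move=> oS; have := H S; rewrite oS => /eqP.
by apply/implyP => /H ->.
Qed.

Lemma even_lin a (x y : Cl) : x \in even -> y \in even -> a *: x + y \in even.
Proof.
move=> /evenP hx /evenP hy; apply/evenP => S oS.
by rewrite !ffunE hx// hy// scaler0 addr0.
Qed.

Lemma even0 : 0 \in even.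
Proof. by apply/evenP => S _; rewrite ffunE. Qed.

Lemma evenZ a (x : Cl) : x \in even -> a *: x \in even.
Proof. by move=> hx; rewrite -[_ *: _]addr0 even_lin// even0. Qed.

Lemma evenD (x y : Cl) : x \in even -> y \in even -> x + y \in even.
Proof. by move=> hx hy; rewrite -[x]scale1r even_lin. Qed.

Lemma evenN (x : Cl) : x \in even -> - x \in even.
Proof. by move=> hx; rewrite -scaleN1r evenZ. Qed.

Lemma evenB (x y : Cl) : x \in even -> y \in even -> x - y \in even.
Proof. by move=> hx hy; rewrite evenD// evenN. Qed.

Lemma even_sum (I : finType) (f : I -> Cl) :
  (forall i, f i \in even) -> \sum_i f i \in even.
Proof.
by move=> hf; elim/big_rec: _ => [|i x _ hx]; [exact: even0 | rewrite evenD].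
Qed.

Lemma evenM (x y : Cl) : x \in even -> y \in even -> x * y \in even.
Proof.
move=> /evenP hx /evenP hy; apply/evenP => U oU; rewrite ffunE big1 // => S _.
have [oS|oS] := boolP (odd #|S|); first by rewrite hx// mulr0 mul0r.
by rewrite [y _]hy ?mulr0// odd_card_symdiff oU (negPf oS).
Qed.

Lemma even_basis (S : {set 'I_r}) : ~~ odd #|S| -> cbasis S \in even.
Proof.
move=> oS; apply/evenP => T oT; rewrite ffunE.
by case: eqP => // E; rewrite -E oT in oS.
Qed.

Lemma even1 : 1 \in even.
Proof. by apply: even_basis; rewrite cards0. Qed.

Lemma even_cvec2 (u w : 'rV[R]_r) : cvec u * cvec w \in even.
Proof.
rewrite /cvec mulr_suml; apply: even_sum => i; rewrite mulr_sumr.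
apply: even_sum => j; rewrite -scalerAl -scalerAr cbasisM; do 3 apply: evenZ.
by apply: even_basis; rewrite odd_card_symdiff !cards1.
Qed.

Lemma cvecD (u w : 'rV[R]_r) : cvec (u + w) = cvec u + cvec w.
Proof.
by rewrite /cvec -big_split; apply: eq_bigr => i _; rewrite mxE scalerDl.
Qed.

Lemma cvecZ a (u : 'rV[R]_r) : cvec (a *: u) = a *: cvec u.
Proof.
by rewrite /cvec scaler_sumr; apply: eq_bigr => i _; rewrite mxE scalerA.
Qed.

Lemma cvecN (u : 'rV[R]_r) : cvec (- u) = - cvec u.
Proof. by rewrite -scaleN1r cvecZ scaleN1r. Qed.

Lemma cvec_anticommute (u w : 'rV[R]_r) :
  cvec u * cvec w + cvec w * cvec u = (- (2 * dotv u w))%:A.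
Proof.
have := cvec_sqr (u + w); rewrite cvecD mulrDl !mulrDr !cvec_sqr.
rewrite -![(_ *m _) 0 0]/(dotv _ _) dotvDl !dotvDr (dotvC w u) => H.
have sub4 (a p q b s : Cl) : a + p + (q + b) = s -> p + q = s - a - b.
  by move=> <-; rewrite -(addrA a p) (addrC a) addrK addrA addrK.
by rewrite (sub4 _ _ _ _ _ H) -!scalerBl; congr (_ *: _); ring.
Qed.

Lemma spin_comm (A : 'M[R]_r) (u : 'rV[R]_r) : A^T = - A ->
  spin A * cvec u = cvec u * spin A - cvec (u *m A).
Proof.
move=> sA; have := spin_cvec u sA; rewrite sA mulmxN cvecN => H.
by rewrite -H addrC subrK.
Qed.

(* Normalized so that [spin (wedge u w) = cvec u * cvec w] for orthogonal [u]
   and [w]. *)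
Definition wedge (u w : 'rV[R]_r) : 'M[R]_r :=
  \matrix_(i, j) (2 * (u 0 j * w 0 i - u 0 i * w 0 j)).

Lemma wedge_so (u w : 'rV[R]_r) : wedge u w \in so R r.
Proof. by rewrite inE; apply/eqP/matrixP => i j; rewrite !mxE; ring. Qed.

Lemma spin_wedge (u w : 'rV[R]_r) : dotv u w = 0 -> spin (wedge u w) = cvec u * cvec w.
Proof.
move=> uw.
have cE (a b : 'rV[R]_r) : cvec a * cvec b = \sum_i \sum_j (b 0 i * a 0 j) *: (cgen j * cgen i).
  rewrite /cvec mulr_suml exchange_big /=; apply: eq_bigr => j _.
  rewrite mulr_sumr; apply: eq_bigr => i _.
  by rewrite -scalerAl -scalerAr scalerA mulrC.
have -> : spin (wedge u w) = 2^-1 *: (cvec u * cvec w - cvec w * cvec u).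
  rewrite !cE -sumrB scaler_sumr; apply: eq_bigr => i _.
  rewrite -sumrB scaler_sumr; apply: eq_bigr => j _.
  rewrite mxE; set X := cgen j * cgen i.
  transitivity ((2^-1 * (w 0 i * u 0 j - u 0 i * w 0 j)) *: X).
    by congr (_ *: X); field.
  by rewrite -scalerBl scalerA.
have := cvec_anticommute u w; rewrite uw mulr0 oppr0 scale0r => /eqP.
rewrite addrC addr_eq0 => /eqP ->; rewrite opprK.
have half (Y : Cl) : 2^-1 *: (Y + Y) = Y.
  rewrite -{1 2}[Y]scale1r -scalerDl scalerA.
  have -> : 2^-1 * (1 + 1) = 1 :> R by field.
  exact: scale1r.
exact: half.
Qed.

End EvenClifford.

Section OrthonormalGenerators.
Context {R : realType} {r : nat}.
Variable o : seq 'rV[R]_r.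
Hypotheses (oo : orthonormal_seq o) (so : size o = r).

(** For an index past the end of [o] the generator is zero; this is how the unpaired vector of an
    odd rank fits the general formulas. *)
Definition gen (i : nat) : clifford R r := cvec o`_i.

Lemma gen_sqr i : (i < r)%N -> gen i * gen i = -1.
Proof.
move=> ir; have := oo; rewrite /orthonormal_seq so => /(_ i i ir ir).
by rewrite eqxx => h; rewrite /gen cvec_sqr -[(_ *m _) 0 0]/(dotv _ _) h scaleN1r.
Qed.

Lemma gen_anti i j : (i < r)%N -> (j < r)%N -> i != j -> gen i * gen j = - (gen j * gen i).
Proof.
move=> ir jr ij; have := oo; rewrite /orthonormal_seq so => /(_ i j ir jr).
rewrite (negPf ij) => h; apply/eqP; rewrite -addr_eq0 /gen cvec_anticommute h.
by rewrite mulr0 oppr0 scale0r.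
Qed.

Definition gen2 i j := gen i * gen j.

Lemma gen2_even i j : gen2 i j \in even_clifford.
Proof. exact: even_cvec2. Qed.

Lemma gen2_sqr i j : (i < r)%N -> (j < r)%N -> i != j -> gen2 i j * gen2 i j = -1.
Proof.
move=> ir jr ij; rewrite /gen2 {1}gen_anti// mulNr -mulrA [gen i * (_ * _)]mulrA.
by rewrite gen_sqr// mulN1r mulrN opprK gen_sqr.
Qed.

Lemma gen2C i j k l : (i < r)%N -> (j < r)%N -> (k < r)%N -> (l < r)%N ->
  i != k -> i != l -> j != k -> j != l -> gen2 i j * gen2 k l = gen2 k l * gen2 i j.
Proof. by move=> *; apply: anti_pairs_commute; apply: gen_anti. Qed.

Lemma gen2_anti i j k : (i < r)%N -> (j < r)%N -> (k < r)%N ->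
  i != j -> i != k -> j != k -> gen2 i j * gen2 i k = - (gen2 i k * gen2 i j).
Proof. by move=> *; apply: anti_pairs_anticommute; apply: gen_anti. Qed.

Lemma gen2_swap i j : (i < r)%N -> (j < r)%N -> i != j -> gen2 i j = - gen2 j i.
Proof. by move=> *; apply: gen_anti. Qed.

End OrthonormalGenerators.

Section CliffordAction.
Context {R : realType} {n r : nat}.
Local Notation V := 'rV[R]_n.
Local Notation Cl := (clifford R r).
Local Notation even := (@even_clifford R r).
Variable br : V -> V -> V.
Hypothesis br_linl : forall y, linear (br^~ y).
Hypothesis br_linr : forall x, linear (br x).
Hypothesis brC : forall x y, br x y = - br y x.
Hypothesis brJ : forall u x y, br u (br x y) = br (br u x) y + br x (br u y).
Variables m hh : {vspace V}.
Hypothesis hh_m : forall X Y, X \in hh -> Y \in m -> br X Y \in m.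
Variable op : Cl -> V -> V.
Hypothesis op_linr : forall x, linear (op x).
Hypothesis op_m : forall x z, op x z \in m.
Hypothesis op1 : forall z, z \in m -> op 1 z = z.
Hypothesis opM : forall x y z, x \in even -> y \in even -> op (x * y) z = op x (op y z).
Hypothesis opP : forall a x y z, x \in even -> y \in even ->
  op (a *: x + y) z = a *: op x z + op y z.

Lemma opD x y z : x \in even -> y \in even -> op (x + y) z = op x z + op y z.
Proof. by move=> hx hy; have := opP 1 z hx hy; rewrite !scale1r. Qed.
Lemma op0 z : op 0 z = 0.
Proof.
by have := opP (-1) z even0 even0; rewrite scaler0 addr0 scaleN1r addNr.
Qed.
Lemma opZ a x z : x \in even -> op (a *: x) z = a *: op x z.
Proof. by move=> hx; have := opP a z hx even0; rewrite !addr0 op0 addr0. Qed.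
Lemma opN x z : x \in even -> op (- x) z = - op x z.
Proof. by move=> hx; rewrite -scaleN1r opZ// scaleN1r. Qed.
Lemma opB x y z : x \in even -> y \in even -> op (x - y) z = op x z - op y z.
Proof. by move=> hx hy; rewrite opD ?evenN// opN. Qed.
Lemma opDr x z z' : op x (z + z') = op x z + op x z'.
Proof. by have := op_linr x 1 z z'; rewrite !scale1r. Qed.
Lemma opZr a x z : op x (a *: z) = a *: op x z.
Proof.
have := op_linr x (-1) 0 0; rewrite scaler0 addr0 scaleN1r addNr => o0.
by have := op_linr x a z 0; rewrite !addr0 o0 addr0.
Qed.

Let br2D x y u : br x (y + u) = br x y + br x u.
Proof. by have := br_linr x 1 y u; rewrite !scale1r. Qed.
Let br2Z k x y : br x (k *: y) = k *: br x y.
Proof.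
have := br_linr x (-1) 0 0; rewrite scaler0 addr0 scaleN1r addNr => b0.
by have := br_linr x k y 0; rewrite !addr0 b0 addr0.
Qed.

Definition acts_by (A : 'M[R]_r) (X : V) (x : Cl) := forall z, z \in m ->
  br X (op x z) = op (spin A * x - x * spin A) z + op x (br X z).

Section ActsBy.
Variables (A : 'M[R]_r) (X : V).
Hypotheses (sA : A^T = - A) (Xh : X \in hh).

Let eA : spin A \in even := spin_even sA.
Let eC x : x \in even -> spin A * x - x * spin A \in even.
Proof. by move=> hx; apply: evenB; apply: evenM. Qed.

(** Commutation with [X] and commutation with [spin A] are both derivations, so the relation passes
    to products. *)
Lemma acts_by_mul x y : x \in even -> y \in even ->
  acts_by A X x -> acts_by A X y -> acts_by A X (x * y).
Proof.
move=> hx hy ax ay z zm; rewrite opM// ax// ay// opDr -!opM ?eC//.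
rewrite addrA -opD ?evenM ?eC//; congr (op _ z + _).
by rewrite mulrBl mulrBr !mulrA addrA subrK.
Qed.

Lemma acts_by_lin a x y : x \in even -> y \in even ->
  acts_by A X x -> acts_by A X y -> acts_by A X (a *: x + y).
Proof.
move=> hx hy ax ay z zm; rewrite !opP// br2D br2Z ax// ay//.
have -> : spin A * (a *: x + y) - (a *: x + y) * spin A =
   a *: (spin A * x - x * spin A) + (spin A * y - y * spin A).
  by rewrite mulrDr mulrDl -scalerAr -scalerAl scalerBr opprD addrACA.
rewrite opP ?eC// scalerDr; exact: addrACA.
Qed.

Lemma acts_by_scalar a : acts_by A X (a *: 1).
Proof.
move=> z zm; have e1 := @even1 R r.
rewrite -scalerAr -scalerAl mulr1 mul1r subrr op0 add0r !opZ// br2Z !op1//.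
exact: hh_m.
Qed.

End ActsBy.

(** For orthogonal [u] and [w] the product [cvec u * cvec w] is the image of an element of so(r),
    which is where the equivariance of [phi] speaks. *)
Definition infinitesimal_action (X : V) (A : 'M[R]_r) := A^T = - A /\
  forall u w, dotv u w = 0 -> acts_by A X (cvec u * cvec w).

(** The component of [w] along [u] contributes only a scalar to the product. *)
Lemma acts_by_cvec2 X A u w : X \in hh -> infinitesimal_action X A ->
  acts_by A X (cvec u * cvec w).
Proof.
move=> Xh [sA iA]; have [->|u0] := eqVneq u 0.
  have -> : cvec 0 * cvec w = 0 *: 1 :> Cl.
    have := cvecZ 0 (0 : 'rV[R]_r); rewrite !scale0r => ->; exact: mul0r.
  exact: acts_by_scalar.
pose k := dotv u w / dotv u u.
have uw' : dotv u (w - k *: u) = 0.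
  by rewrite dotvDr dotvNr dotvZr /k divfK ?subrr// gt_eqF// dotv_gt0.
have -> : cvec u * cvec w = k *: (cvec u * cvec u) + cvec u * cvec (w - k *: u).
  by rewrite scalerAr -mulrDr -cvecZ -cvecD addrC subrK.
apply: acts_by_lin => //; try exact: even_cvec2; last exact: iA.
by rewrite cvec_sqr; exact: acts_by_scalar.
Qed.

(** The derivation of the Clifford algebra extending [u |-> u *m A], evaluated on a product of two
    vectors. With row vectors it is the opposite of the commutator with [spin A]. *)
Definition delta2 (A : 'M[R]_r) (u w : 'rV[R]_r) : Cl :=
  cvec (u *m A) * cvec w + cvec u * cvec (w *m A).

Lemma delta2_even A u w : delta2 A u w \in even.
Proof. by rewrite evenD// even_cvec2. Qed.

Lemma spin_comm2 (A : 'M[R]_r) u w : A^T = - A ->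
  spin A * (cvec u * cvec w) - cvec u * cvec w * spin A = - delta2 A u w.
Proof.
move=> sA; rewrite mulrA spin_comm// mulrBl -!mulrA spin_comm// mulrBr.
by rewrite addrC addrA addrA addNr add0r opprD addrC.
Qed.

Lemma acts_cvec2 X A u w z : X \in hh -> infinitesimal_action X A -> z \in m ->
  br X (op (cvec u * cvec w) z) = - op (delta2 A u w) z + op (cvec u * cvec w) (br X z).
Proof.
move=> Xh hA zm; rewrite (acts_by_cvec2 u w Xh hA)//.
by rewrite spin_comm2 ?hA.1// opN// delta2_even.
Qed.

(** When [br X] and [br Y] are applied in turn to [op (cvec u * cvec w) z], the terms of first order
    are symmetric in [X] and [Y]. The terms of second order differ by the derivation of the
    commutator of [A] and [A'], while [br X] and [br Y] commute. *)
Lemma commutator_acts_trivially X Y A A' u w z :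
  X \in hh -> Y \in hh -> br X Y = 0 -> infinitesimal_action X A ->
  infinitesimal_action Y A' -> z \in m -> op (delta2 (A' *m A - A *m A') u w) z = 0.
Proof.
move=> Xh Yh XY hA hA' zm.
have brXY v : br X (br Y v) = br Y (br X v).
  rewrite brJ XY; have := br_linl v (-1) 0 0.
  by rewrite scaler0 addr0 scaleN1r addNr => ->; rewrite add0r.
have two X1 Y1 A1 A2 : X1 \in hh -> Y1 \in hh -> infinitesimal_action X1 A1 ->
    infinitesimal_action Y1 A2 -> br X1 (br Y1 (op (cvec u * cvec w) z)) =
    op (delta2 A1 (u *m A2) w + delta2 A1 u (w *m A2)) z - op (delta2 A2 u w) (br X1 z)
     - op (delta2 A1 u w) (br Y1 z) + op (cvec u * cvec w) (br X1 (br Y1 z)).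
  move=> X1h Y1h h1 h2.
  rewrite (acts_cvec2 u w Y1h h2 zm) br2D (acts_cvec2 u w X1h h1 (hh_m Y1h zm)).
  have -> : br X1 (- op (delta2 A2 u w) z) = - br X1 (op (delta2 A2 u w) z).
    by rewrite -scaleN1r br2Z scaleN1r.
  have E v : op (delta2 A2 u w) v =
      op (cvec (u *m A2) * cvec w) v + op (cvec u * cvec (w *m A2)) v.
    by rewrite opD ?even_cvec2.
  rewrite !E br2D (acts_cvec2 _ _ X1h h1 zm) (acts_cvec2 u _ X1h h1 zm).
  rewrite opD ?delta2_even//.
  by apply/rowP => j; rewrite !mxE; ring.
have := two X Y A A' Xh Yh hA hA'; rewrite brXY (two Y X A' A Yh Xh hA' hA) brXY => H.
have : op (delta2 A (u *m A') w + delta2 A u (w *m A')) z -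
       op (delta2 A' (u *m A) w + delta2 A' u (w *m A)) z = 0.
  apply/rowP => j; have := congr1 (fun v : V => v 0 j) H; rewrite !mxE; lra.
rewrite -opB; try exact: evenD (delta2_even _ _ _) (delta2_even _ _ _).
move=> <-; congr (op _ z).
rewrite /delta2 !mulmxBr !cvecD !cvecN !mulmxA.
rewrite mulrBl mulrBr.
move: (cvec (u *m A' *m A) * cvec w) (cvec (u *m A *m A') * cvec w)
  (cvec u * cvec (w *m A' *m A)) (cvec u * cvec (w *m A *m A'))
  (cvec (u *m A') * cvec (w *m A)) (cvec (u *m A) * cvec (w *m A')) => a b c d e f.
by apply/ffunP => U; rewrite !ffunE; ring.
Qed.

(** In a block basis, [o_i D = c o_p] and the hypothesis reads [c o_p o_j + c_j o_i o_j' = 0] on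
    [m], where [j'] is the partner of [j]. For a fifth index [l], [o_i o_l] commutes with the first
    product and anticommutes with the second, so each term vanishes; but [o_p o_j] is invertible,
    whence [c = 0]. *)
Lemma delta2_faithful (D : 'M[R]_r) z : D^T = - D -> (5 <= r)%N -> z \in m -> z != 0 ->
  (forall u w z, z \in m -> op (delta2 D u w) z = 0) -> D = 0.
Proof.
move=> sD r5 zm z0 HD.
have [| | o [oo bo so]] := @block_diagonalization R r [:: D].
- by move=> A; rewrite inE => /eqP ->.
- by move=> A A'; rewrite !inE => /eqP -> /eqP ->.
have oD i : (i < r)%N -> exists c, o`_i *m D = c *: o`_(partner i).
  by move=> ir; apply: bo; rewrite ?inE ?so.
suff all0 i : (i < r)%N -> o`_i *m D = 0.
  pose O := \matrix_(i < r) o`_i.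
  have OO : O *m O^T = 1%:M.
    apply/matrixP => i j; rewrite !mxE.
    have := oo; rewrite /orthonormal_seq so => /(_ i j (ltn_ord i) (ltn_ord j)) <-.
    by rewrite /dotv mxE; apply: eq_bigr => k _; rewrite !mxE.
  have uO : O \in unitmx by case: (mulmx1_unit OO).
  have OD : O *m D = 0.
    by apply/row_matrixP => i; rewrite row_mul rowK row0 all0.
  by rewrite -(mulKmx uO D) OD mulmx0.
move=> ir; have [c hc] := oD i ir.
have [pr|pr] := ltnP (partner i) r; last first.
  by rewrite hc nth_default ?so// scaler0.
pose p := partner i.
have [c0|c0] := eqVneq c 0; first by rewrite hc c0 scale0r.
case/eqP: z0.
(* Of the pairs {0, 1} and {2, 3} and the index 4, two avoid the block of [i]; [j] must come from a
   full pair, and [l] may be 4, whose partner need not exist. *)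
have [j [l [[jr pjr lr] [ji jp pji pjp] [li lp lj lpj]] pp]] : exists j l,
    [/\ [/\ (j < r)%N, (partner j < r)%N & (l < r)%N],
     [/\ j != i, j != p, partner j != i & partner j != p],
     [/\ l != i, l != p, l != j & l != partner j] & p != i].
  have ppi : p != i by rewrite /p /partner; case: (i) => [|k]//=; case: ifP => _; lia.
  have [i2|i2] := ltnP i 2.
    have p2 : (p < 2)%N by rewrite /p; case: (i) i2 => [|[|k]].
    exists 2%N, 4%N; move: i2 p2 ppi r5; rewrite /partner /=; clearbody p; move=> *.
    by split=> //; split; lia.
  have p2 : (2 <= p)%N by rewrite /p /partner; case: (i) i2 => [|[|[|k]]]//= _; case: ifP.
  have [i4|i4] := ltnP i 4.
    have p4 : (p < 4)%N by rewrite /p; case: (i) i4 => [|[|[|[|k]]]].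
    exists 0%N, 4%N; move: i2 p2 i4 p4 ppi r5; rewrite /partner /=; clearbody p; move=> *.
    by split=> //; split; lia.
  have p4 : (4 <= p)%N by rewrite /p /partner; case: (i) i4 => [|[|[|[|[|k]]]]]//= _; case: ifP.
  exists 0%N, 2%N; move: i2 p2 i4 p4 ppi r5; rewrite /partner /=; clearbody p; move=> *.
  by split=> //; split; lia.
have [cj hcj] := oD j jr.
have g2e a b : gen2 o a b \in even by exact: gen2_even.
have rel v : v \in m -> c *: op (gen2 o p j) v + cj *: op (gen2 o i (partner j)) v = 0.
  move=> vm; rewrite -(HD o`_i o`_j v vm) /delta2 hc hcj !cvecZ -scalerAl -scalerAr.
  by rewrite opD ?evenZ ?even_cvec2// !opZ ?even_cvec2.
have PL : gen2 o p j * gen2 o i l = gen2 o i l * gen2 o p j.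
  by apply: gen2C => //; rewrite eq_sym.
have QL : gen2 o i (partner j) * gen2 o i l = - (gen2 o i l * gen2 o i (partner j)).
  by apply: gen2_anti => //; rewrite eq_sym.
(* The relation at [o_i o_l z], and [o_i o_l] applied to the relation at [z]: the two differ by the
   sign of the second term. *)
have r1 := rel _ (op_m (gen2 o i l) z).
have r2 : op (gen2 o i l) (c *: op (gen2 o p j) z + cj *: op (gen2 o i (partner j)) z) = 0.
  rewrite (rel z zm); have := opZr 0 (gen2 o i l) 0; by rewrite !scale0r.
rewrite -!opM// PL QL in r1. rewrite opN in r1; last exact: evenM (g2e _ _) (g2e _ _). rewrite scalerN in r1.
rewrite opDr !opZr -!opM// in r2.
have LP0 : op (gen2 o i l * gen2 o p j) z = 0.
  have h : (2 * c) *: op (gen2 o i l * gen2 o p j) z = 0.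
    by apply/rowP => k; have := congr1 (fun v : V => v 0 k) r1;
      have := congr1 (fun v : V => v 0 k) r2; rewrite !mxE; lra.
  move/eqP: h; rewrite scaler_eq0 mulf_eq0 pnatr_eq0 (negPf c0) /=.
  by move/eqP.
have sq a b v : (a < r)%N -> (b < r)%N -> a != b -> v \in m ->
    op (gen2 o a b) (op (gen2 o a b) v) = - v.
  move=> ar b_r ab vm; rewrite -opM// gen2_sqr// opN ?op1//; exact: even1.
have LP1 : op (gen2 o i l) (op (gen2 o p j) z) = 0 by rewrite -opM.
have o0 x : op x 0 = 0 by have := opZr 0 x 0; rewrite !scale0r.
have P0 : op (gen2 o p j) z = 0.
  apply/eqP; rewrite -oppr_eq0 -(sq i l)//; first by rewrite LP1 o0.
  by rewrite eq_sym.
have z0 : - z = 0 by rewrite -(sq p j)// ?P0 ?o0// eq_sym.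
by apply/eqP; rewrite -oppr_eq0 z0.
Qed.

End CliffordAction.

(** * Longest weights *)

Lemma sum_setU (V : nmodType) (T : finType) (S S' : {set T}) (F : T -> V) :
  [disjoint S & S'] ->
  \sum_(k in S :|: S') F k = \sum_(k in S) F k + \sum_(k in S') F k.
Proof. by move=> d; rewrite -bigU//; apply: eq_bigl => k; rewrite !inE. Qed.

(* The eight numbers can be grouped in any way into four pairs, each of sum at
   least 1; hence every pair has sum 1. *)
Lemma eight_halves (R : realFieldType) (q : nat) (x : 'I_q -> R) (x8 : R) : q = 7%N ->
  (forall i j, i != j -> 1 <= x i + x j) -> (forall i, 1 <= x i + x8) ->
  \sum_i x i + x8 = 4 -> forall i, 2 * x i = 1.
Proof.
move=> q7; move: x; rewrite q7 => x xx xx8; rewrite !big_ord_recr big_ord0 /=.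
set a0 := x _; set a1 := x _; set a2 := x _; set a3 := x _; set a4 := x _; set a5 := x _.
set a6 := x _ => s4.
have e0 := xx8 _ : 1 <= a0 + x8; have e1 := xx8 _ : 1 <= a1 + x8.
have e2 := xx8 _ : 1 <= a2 + x8; have e3 := xx8 _ : 1 <= a3 + x8.
have e4 := xx8 _ : 1 <= a4 + x8; have e5 := xx8 _ : 1 <= a5 + x8.
have e6 := xx8 _ : 1 <= a6 + x8.
have h01 : 1 <= a0 + a1 by exact: xx. have h23 : 1 <= a2 + a3 by exact: xx.
have h45 : 1 <= a4 + a5 by exact: xx. have h12 : 1 <= a1 + a2 by exact: xx.
have h34 : 1 <= a3 + a4 by exact: xx. have h56 : 1 <= a5 + a6 by exact: xx.
have h02 : 1 <= a0 + a2 by exact: xx. have h13 : 1 <= a1 + a3 by exact: xx.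
have h46 : 1 <= a4 + a6 by exact: xx. have h60 : 1 <= a6 + a0 by exact: xx.
have h : [/\ 2 * a0 = 1, 2 * a1 = 1, 2 * a2 = 1, 2 * a3 = 1 & [/\ 2 * a4 = 1, 2 * a5 = 1 & 2 * a6 = 1] ].
  by repeat split; lra.
case: h => k0 k1 k2 k3 [k4 k5 k6] [i ilt].
have xE (i' j' : 'I_7) : nat_of_ord i' = j' -> x i' = x j' by move=> /val_inj ->.
by case: i ilt => [|[|[|[|[|[|[|//] ] ] ] ] ] ] ilt; [move: k0|move: k1|move: k2|move: k3
  |move: k4|move: k5|move: k6]; apply: etrans; congr (_ * _); apply: xE.
Qed.

(** * Combinatorics of abstract weights with signatures *)

Section SignedWeights.
Context {R : realType} {n q : nat}.
Local Notation V := 'rV[R]_n.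
Variable B : V -> V -> R.
Hypothesis BDl : forall x y u, B (x + y) u = B x u + B y u.
Hypothesis BZl : forall k x u, B (k *: x) u = k * B x u.
Hypothesis Bsym : forall x y, B x y = B y x.
Hypothesis Bpos : forall x, x != 0 -> 0 < B x x.
(** [flips a] means that [a] signs can be changed at once: any number in odd rank, an even number in
    even rank. [W v N] means that [v] is a weight whose negative signs are those in [N], and [bet k]
    is the weight attached to the plane [k]. *)
Variable flips : nat -> bool.
Hypothesis flipsD : forall a b, flips a -> flips b -> flips (a + b)%N.
Variable bet : 'I_q -> V.
Variable W : V -> {set 'I_q} -> Prop.
Hypothesis W_fun : forall v N N', W v N -> W v N' -> N = N'.
Hypothesis W_neg : forall v N, W v N -> W (- v) (~: N)%SET.
Hypothesis W_neq0 : forall v N, W v N -> v != 0.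
Hypothesis W_int : forall v N w N', W v N -> W w N' ->
  exists k : int, 2 * B w v = k%:~R * B v v.
Hypothesis W_flip : forall v N (S : {set 'I_q}), flips #|S| -> W v N ->
  W (v + \sum_(k in S) (if k \in N then -1 else 1) *: bet k) (symdiff N S).
Variables (v : V) (N : {set 'I_q}).
Hypothesis vW : W v N.
Hypothesis v_max : forall w N', W w N' -> B w w <= B v v.

Let Bv0 : 0 < B v v := Bpos (W_neq0 vW).
Let BDr x y u : B x (y + u) = B x y + B x u := formDr BDl Bsym x y u.
Let BZr k x u : B x (k *: u) = k * B x u := formZr BZl Bsym k x u.
Let BNl x u : B (- x) u = - B x u := formNl BZl x u.
Let BNr x u : B x (- u) = - B x u := formNr BZl Bsym x u.
Let BE := (BDl, BDr, BZl, BZr, BNl, BNr).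

(** Since [w] differs from [v] and is not longer, [2 <v, w> < 2 |v|^2]; the Cartan number is an
    integer below 2, hence at most 1. *)
Lemma weight_le w N' : W w N' -> N' != N -> 2 * B v w <= B v v.
Proof.
move=> wW NN'; have wv : v - w != 0.
  rewrite subr_eq0; apply: contraNneq NN' => vw; rewrite -vw in wW.
  exact/eqP/(W_fun wW vW).
have := Bpos wv; rewrite !BE (Bsym w v) => d0.
have [k kE] := W_int vW wW; rewrite Bsym in kE.
have k1 : (k%:~R : R) < 2.
  by rewrite -(ltr_pM2r Bv0) -kE; have := v_max wW; move: d0; lra.
rewrite (_ : 2 = 2%:~R) // ltr_int in k1.
have k2 : (k%:~R : R) <= 1%:~R by rewrite ler_int; move: k1; lia.
have := ler_wpM2r (ltW Bv0) k2; lra.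
Qed.

(** The equality case of Cauchy-Schwarz, [w] being no longer than [v]. *)
Lemma weight_eq w N' : W w N' -> B v v <= B v w -> w = v.
Proof.
move=> wW vw; apply/eqP; rewrite -subr_eq0; apply/contraT => /Bpos.
by rewrite !BE (Bsym w v); have := v_max wW; move: vw; lra.
Qed.

(* Locked, because [rewrite] would unfold [flipv k] to match it with [- _]. *)
Definition flipv (k : 'I_q) : V := locked (- ((if k \in N then -1 else 1) *: bet k)).

Lemma flipvE k : flipv k = - ((if k \in N then -1 else 1) *: bet k).
Proof. by rewrite /flipv -lock. Qed.

Lemma flip_weight (S : {set 'I_q}) : flips #|S| -> W (v - \sum_(k in S) flipv k) (symdiff N S).
Proof.
by move=> hS; have := W_flip hS vW; rewrite -sumrN; under [X in _ -> W (_ + X) _]eq_bigr do rewrite flipvE opprK.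
Qed.

Lemma symdiff_eql (M T : {set 'I_q}) : symdiff M T = M -> T = finset.set0.
Proof.
move=> E; apply/setP => k; have := congr1 (fun X : {set 'I_q} => k \in X) E.
by rewrite /= in_symdiff inE; case: (k \in M); case: (k \in T).
Qed.

Lemma flip_le (S : {set 'I_q}) : flips #|S| -> S != finset.set0 ->
  B v v <= 2 * B v (\sum_(k in S) flipv k).
Proof.
move=> hS S0; have := weight_le (flip_weight hS).
have NS : symdiff N S != N by apply: contraNneq S0 => /symdiff_eql ->.
by move=> /(_ NS); rewrite !BE; lra.
Qed.

(** The five instances of [weight_le] add up to [5 |v|^2 <= 4 |v|^2]. At the index [k0], which no
    flip touches, the opposite of the joint flip has the other sign than [v], so its signature is
    not [N]. *)
Lemma four_flips (S1 S2 S3 S4 : {set 'I_q}) k0 :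
  [disjoint S1 & S2] -> [disjoint S1 :|: S2 & S3]%SET ->
  [disjoint S1 :|: S2 :|: S3 & S4]%SET ->
  k0 \notin (S1 :|: S2 :|: S3 :|: S4)%SET ->
  [&& S1 != finset.set0, S2 != finset.set0, S3 != finset.set0 & S4 != finset.set0] ->
  [&& flips #|S1|, flips #|S2|, flips #|S3| & flips #|S4| ] -> False.
Proof.
move=> d1 d2 d3 k0S /and4P[n1 n2 n3 n4] /and4P[f1 f2 f3 f4].
have flipsU (S S' : {set 'I_q}) : [disjoint S & S'] -> flips #|S| -> flips #|S'| ->
    flips #|(S :|: S')%SET|.
  by move=> d h h'; have := (leq_card_setU S S').2; rewrite d => /eqP ->; exact: flipsD.
have f5 := flipsU _ _ d3 (flipsU _ _ d2 (flipsU _ _ d1 f1 f2) f3) f4.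
have := weight_le (W_neg (flip_weight f5)).
have NU : (~: symdiff N (S1 :|: S2 :|: S3 :|: S4))%SET != N.
  apply/eqP => /setP /(_ k0); rewrite inE in_symdiff (negPf k0S) addbF.
  by case: (k0 \in N).
move=> /(_ NU); rewrite !sum_setU//.
rewrite !BE.
have := flip_le f1 n1; have := flip_le f2 n2; have := flip_le f3 n3; have := flip_le f4 n4.
by move: Bv0; lra.
Qed.

(** Four singletons and one index left out. *)
Lemma single_flips_bound : flips 1 -> (q < 5)%N.
Proof.
move=> f1; rewrite ltnNge; apply/negP => q5.
pose k i : 'I_q := insubd (Ordinal (leq_trans (isT : (0 < 5)%N) q5)) i.
have kE i : (i < 5)%N -> val (k i) = i.
  by move=> i5; rewrite val_insubd (leq_trans i5 q5).
apply: (@four_flips [set k 0%N]%SET [set k 1%N]%SET [set k 2%N]%SET [set k 3%N]%SET (k 4%N)).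
- by rewrite disjoints1 inE -val_eqE /= !kE.
- by rewrite disjoint_sym disjoints1 !inE -!val_eqE /= !kE.
- by rewrite disjoint_sym disjoints1 !inE -!val_eqE /= !kE.
- by rewrite !inE -!val_eqE /= !kE.
- by rewrite -!card_gt0 !cards1.
- by rewrite !cards1 f1.
Qed.

(** Four disjoint pairs and one index left out. *)
Lemma pair_flips_bound : flips 2 -> (q < 9)%N.
Proof.
move=> f2; rewrite ltnNge; apply/negP => q9.
pose k i : 'I_q := insubd (Ordinal (leq_trans (isT : (0 < 9)%N) q9)) i.
have kE i : (i < 9)%N -> val (k i) = i.
  by move=> i9; rewrite val_insubd (leq_trans i9 q9).
have kk i j : (i < 9)%N -> (j < 9)%N -> (k i == k j) = (i == j).
  by move=> i9 j9; rewrite -val_eqE /= !kE.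
apply: (@four_flips [set k 0%N; k 1%N]%SET [set k 2%N; k 3%N]%SET [set k 4%N; k 5%N]%SET
   [set k 6%N; k 7%N]%SET (k 8%N)).
- by rewrite disjoint_sym finset.disjoints_subset; apply/fintype.subsetP => x; rewrite !inE => /orP[] /eqP ->; rewrite !kk.
- by rewrite disjoint_sym finset.disjoints_subset; apply/fintype.subsetP => x; rewrite !inE => /orP[] /eqP ->; rewrite !kk.
- by rewrite disjoint_sym finset.disjoints_subset; apply/fintype.subsetP => x; rewrite !inE => /orP[] /eqP ->; rewrite !kk.
- by rewrite !inE !kk.
- by rewrite -!card_gt0 !cards2.
- by rewrite !cards2 !kk//= f2.
Qed.

Section RankFourteen.
Hypothesis q7 : q = 7%N.
Hypothesis flips_even : forall a, ~~ odd a -> flips a.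
Hypothesis W_sub : forall w M w' M', W w M -> W w' M' -> 0 < B w w' ->
  odd #|M| != odd #|M'| -> exists M'', W (w - w') M''.

Local Notation f := flipv.
(** An eighth flip on a par with the other seven: the eight vectors add up to [2 v], and
    [v - f i - f8] is the opposite of the flip of [v] along the six indices other than [i]. *)
Definition flipv_last : V := locked (2 *: v - \sum_k f k).
Local Notation f8 := flipv_last.
Local Notation b := (B v v).

Lemma sum_flipvC (S : {set 'I_q}) :
  \sum_(k in ~: S) f k = 2 *: v - f8 - \sum_(k in S) f k.
Proof.
rewrite /flipv_last -lock opprB addrCA subrr addr0 (bigID (mem S) xpredT) /= addrAC subrr add0r.
by apply: eq_bigl => k; rewrite inE.
Qed.

Lemma pair_weight i j : i != j -> W (v - f i - f j) (symdiff N [set i; j]%SET).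
Proof.
move=> ij; have := @flip_weight [set i; j]%SET.
rewrite cards2 ij flips_even// => /(_ isT).
by rewrite big_setU1 ?inE//= big_set1 opprD addrA.
Qed.

Lemma pair_last_weight i : W (v - f i - f8) (symdiff N [set i]%SET).
Proof.
have c6 : #|(~: [set i])%SET| = 6%N by rewrite cardsC1 card_ord q7.
have := @flip_weight (~: [set i])%SET.
rewrite c6 flips_even// => /(_ isT) /W_neg.
rewrite sum_flipvC big_set1.
have -> : (~: symdiff N (~: [set i]))%SET = symdiff N [set i]%SET.
  by apply/setP => k; rewrite inE !in_symdiff !inE; case: (k \in N); case: (k == i).
have -> : - (v - (2 *: v - f8 - f i)) = v - f i - f8.
  by apply/rowP => j; rewrite !mxE; ring.
by [].
Qed.

(** The numbers [2 <v, f_k> / |v|^2] for the eight flips add up to 4. The sum of any two flips is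
    [v - w] for a weight [w] of another signature, so any two of the numbers add up to at least
    1. *)
Lemma flipv_half i : 4 * B v (f i) = b.
Proof.
have B0 : B v 0 = 0 by have := BZr 0 v 0; rewrite scale0r mul0r.
have Bsum : B v (\sum_k f k) = \sum_k B v (f k).
  by rewrite (big_morph (B v) (fun x y => BDr v x y) B0).
have b0 := gt_eqF Bv0.
pose x k := 2 * B v (f k) / b; pose x8 := 2 * B v f8 / b.
have h := @eight_halves R q x x8 q7.
have : 2 * x i = 1.
  apply: h => [j k jk|j|].
  - have jk0 : [set j; k]%SET != finset.set0 by rewrite -card_gt0 cards2.
    have := flip_le _ jk0; rewrite cards2 jk flips_even// => /(_ isT).
    rewrite big_setU1 ?inE//= big_set1 !BE /x -mulrDl ler_pdivlMr//; lra.
  - have := weight_le (pair_last_weight j).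
    have NS : symdiff N [set j]%SET != N.
      apply/eqP => /symdiff_eql /setP /(_ j); by rewrite !inE eqxx.
    by move=> /(_ NS); rewrite !BE /x /x8 -mulrDl ler_pdivlMr//; lra.
  - rewrite /x /x8 -mulr_suml -mulr_sumr -mulrDl /flipv_last -lock !BE Bsum.
    by rewrite -mulrDr addrC subrK; field; rewrite b0.
move/(congr1 (fun y => y * b)); rewrite /x mul1r => <-.
by field; rewrite b0.
Qed.

Lemma flipv_last_half : 4 * B v f8 = b.
Proof.
have B0 : B v 0 = 0 by have := BZr 0 v 0; rewrite scale0r mul0r.
rewrite /flipv_last -lock !BE (big_morph (B v) (fun x y => BDr v x y) B0).
have -> : \sum_k B v (f k) = \sum_(k < q) b / 4.
  by apply: eq_bigr => k _; rewrite -(flipv_half k); field.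
by rewrite sumr_const card_ord q7 -mulr_natl; field.
Qed.

(** Equal flips would give the weight [v - f i - f8] two signatures. *)
Lemma flipv_inj : injective f.
Proof.
move=> i j fij; have := pair_last_weight j; rewrite -fij => /(W_fun (pair_last_weight i)).
move=> /setP /(_ i); rewrite !in_symdiff !inE eqxx.
by case: (i \in N) => /= /esym /eqP //; case: eqP.
Qed.

(* [f i + f8] is a weight; flipping a pair of signs, or six of them, sends it
   to [v] or [- v]. *)
Lemma flipv_addD i : (exists j k, j != k /\ f i + f8 = v - f j - f k) \/
  exists j, f i + f8 = v - f j - f8.
Proof.
have fi := flipv_half i; have f8h := flipv_last_half.
have [M gW] : exists M, W (f i + f8) M.
  have [||M] := W_sub vW (pair_last_weight i).
  - by rewrite !BE; move: Bv0; lra.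
  - by rewrite odd_card_symdiff cards1 /=; case: (odd _).
  by exists M; have -> : f i + f8 = v - (v - f i - f8) by apply/rowP => l; rewrite !mxE; ring.
(* The signs in which [f i + f8] differs from [v]: flipping a sign in [T] adds [f k], flipping one
   outside [T] subtracts it. Every flip pairs with [v] to a quarter of [|v|^2], so [weight_eq]
   recognizes [v]. *)
pose T := symdiff N M; have ME : M = symdiff N T by rewrite symdiffK.
have flipT (S : {set 'I_q}) : ~~ odd #|S| ->
    W (f i + f8 + \sum_(k in S) (if k \in T then 1 else -1) *: f k) (symdiff M S).
  move=> eS; have := W_flip (flips_even eS) gW; congr (W (_ + _) _).
  apply: eq_bigr => k _; rewrite flipvE /T in_symdiff.
  by case: (k \in N); case: (k \in M); rewrite /= ?scale1r ?scaleN1r ?opprK.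
have six j : [disjoint T & (~: [set j])%SET] ->
    [/\ f i + f8 = v - f j - f8 & N = (~: (symdiff M (~: [set j])))%SET].
  move=> Tj; have c6 : #|(~: [set j])%SET| = 6%N by rewrite cardsC1 card_ord q7.
  have := flipT (~: [set j])%SET; rewrite c6 => /(_ isT).
  have -> : \sum_(k in ~: [set j]) (if k \in T then 1 else -1) *: f k = - (2 *: v - f8 - f j).
    have := sum_flipvC [set j]%SET; rewrite big_set1 => <-; rewrite -sumrN; apply: eq_bigr => k kj.
    by rewrite (disjointFl Tj kj) scaleN1r.
  move=> /W_neg wW; have fj := flipv_half j.
  have E : - (f i + f8 + - (2 *: v - f8 - f j)) = v.
    by apply: (weight_eq wW); rewrite !BE; lra.
  split; last by rewrite E in wW; exact: W_fun vW wW.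
  by apply/rowP => l; have := congr1 (fun u : V => u 0 l) E; rewrite !mxE; lra.
have [T0|[j jT] ] := set_0Vmem T.
  have [|_ NE] := six i; first by rewrite T0 -setI_eq0 finset.set0I.
  have := congr1 (fun X : {set 'I_q} => i \in X) NE.
  have MN : M = N by rewrite ME T0 symdiffC symdiff0.
  by rewrite /= inE in_symdiff MN !inE eqxx; case: (i \in N).
have [Tj|[k] ] := set_0Vmem (T :\ j)%SET.
  right; exists j; have [|] := six j => //.
  rewrite -setI_eq0; apply/eqP; rewrite -[RHS]Tj; apply/setP => l.
  by rewrite !inE andbC.
rewrite in_setD1 => /andP[kj kT]; left; exists j, k; split; first by rewrite eq_sym.
have := flipT [set j; k]%SET; rewrite cards2 eq_sym kj => /(_ isT).
have jk : j \notin [set k]%SET by rewrite inE eq_sym.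
rewrite (big_setU1 _ jk)/= big_set1 jT kT !scale1r => wW.
have fj := flipv_half j; have fk := flipv_half k.
have <- : f i + f8 + (f j + f k) = v by apply: (weight_eq wW); rewrite !BE; lra.
by apply/rowP => l; rewrite !mxE; ring.
Qed.

Definition typeA : {set 'I_q} := [set i | [exists k, (k != i) && (v == 2 *: f i + f k + f8)] ]%SET.

(** [flipv_addD] leaves the forms [v = f_i + f_j + f_k + f_8] and [v = f_i + f_j + 2 f_8]. In the
    first, distinct [i, j, k] would make [v] the sum of the other four flips, and flipping these
    four signs would give the weight 0; so [i] is [j] or [k], which is type A. The second with
    [i = j] holds for at most one [i], by injectivity; with [i] and [j] distinct it determines the
    weight [v - f_i - f_j], hence the pair {i, j}. Thus at least [7 - 1 - 2] indices have type A. *)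
Lemma card_typeA : (4 <= #|typeA|)%N.
Proof.
pose D := [set i | [exists j, (j != i) && (v == f i + f j + 2 *: f8)] ]%SET.
pose D' := [set i | v == 2 *: f i + 2 *: f8]%SET.
have split3 i : i \in (typeA :|: (D :|: D'))%SET.
  rewrite !inE; case: (flipv_addD i) => [[j [k [jk E] ] ]|[j E] ].
    apply/orP; left; apply/existsP.
    have [ij|ij] := eqVneq i j.
      exists k; rewrite ij eq_sym jk; apply/eqP; rewrite -ij.
      by apply/rowP => l; have := congr1 (fun u : V => u 0 l) E; rewrite -ij !mxE; lra.
    have [ik|ik] := eqVneq i k.
      exists j; rewrite ik jk; apply/eqP; rewrite -ik.
      by apply/rowP => l; have := congr1 (fun u : V => u 0 l) E; rewrite -ik !mxE; lra.
    pose S := (i |: [set j; k])%SET.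
    have cS : #|S| = 3%N by rewrite cardsU1 !inE negb_or ij ik cards2 jk.
    have eS : ~~ odd #|(~: S)%SET|.
      by rewrite (_ : #|_| = 4%N)//; move: q7 (cardsC S); rewrite cS card_ord; lia.
    have /W_neq0/eqP[] := flip_weight (flips_even eS).
    rewrite sum_flipvC /S big_setU1 ?inE ?negb_or ?ij//= big_setU1 ?inE//= big_set1.
    by apply/rowP => l; have := congr1 (fun u : V => u 0 l) E; rewrite !mxE; lra.
  apply/orP; right; apply/orP; have [ij|ij] := eqVneq i j.
    right; apply/eqP/rowP => l; have := congr1 (fun u : V => u 0 l) E.
    by rewrite -ij !mxE; lra.
  left; apply/existsP; exists j; rewrite eq_sym ij; apply/eqP/rowP => l.
  by have := congr1 (fun u : V => u 0 l) E; rewrite !mxE; lra.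
have cD' : (#|D'| <= 1)%N.
  apply/card_le1_eqP => i j; rewrite !inE => /eqP Ei /eqP Ej; apply: flipv_inj.
  apply/rowP => l; have := congr1 (fun u : V => u 0 l) Ei.
  by have := congr1 (fun u : V => u 0 l) Ej; rewrite !mxE; lra.
have cD : (#|D| <= 2)%N.
  have [->|[i iD] ] := set_0Vmem D; first by rewrite cards0.
  have := iD; rewrite inE => /existsP[j /andP[ji /eqP Ei] ].
  apply: leq_trans (subset_leq_card (_ : D \subset [set i; j]%SET)) _; last first.
    by rewrite cards2; case: (_ != _).
  apply/fintype.subsetP => i'; rewrite inE => /existsP[j' /andP[ji' /eqP Ei'] ].
  rewrite eq_sym in ji; rewrite eq_sym in ji'.
  have w' := pair_weight ji'.
  have E : v - f i - f j = v - f i' - f j'.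
    apply/rowP => l; have := congr1 (fun u : V => u 0 l) Ei.
    by have := congr1 (fun u : V => u 0 l) Ei'; rewrite !mxE; lra.
  rewrite -E in w'; have /setP/(_ i') := W_fun w' (pair_weight ji).
  rewrite !in_symdiff !inE eqxx /=; case: (i' \in N) => //=.
  by move/esym/negbFE.
have := (leq_card_setU typeA (D :|: D')%SET).1; have := (leq_card_setU D D').1.
have -> : (typeA :|: (D :|: D'))%SET = [set: 'I_q]%SET.
  by apply/setP => i; rewrite split3 inE.
rewrite cardsT card_ord => cU cA; rewrite -(leq_add2r 3) -[(4 + 3)%N]q7.
by rewrite (leq_trans cA)// leq_add2l (leq_trans cU)// (leq_add cD cD').
Qed.

(** The weight is [v - f_k - f_8]. It makes Cartan numbers relative to [f i] available, although
    [f i] itself is not known to be a weight, and bounds [4 |f i|^2] by [|v|^2]. *)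
Lemma typeA_double i : i \in typeA -> exists M, W (2 *: f i) M.
Proof.
rewrite inE => /existsP[k /andP[ki /eqP E] ]; exists (symdiff N [set k]%SET).
have -> : 2 *: f i = v - f k - f8.
  by apply/rowP => l; have := congr1 (fun u : V => u 0 l) E; rewrite !mxE; lra.
exact: pair_last_weight.
Qed.

Lemma flipv_gt0 i : 0 < B (f i) (f i).
Proof.
apply: Bpos; apply/eqP => f0; have := flipv_half i.
by have := BZr 0 v 0; rewrite scale0r mul0r f0 => ->; move: Bv0; lra.
Qed.

(** The Cartan numbers of [v] and of [v - f a - f i] relative to the weight [2 f i] are integers;
    their difference contains the product sought and one [|f i|^2]. *)
Lemma typeA_integral i a : i \in typeA -> a != i ->
  exists k : int, B (f a) (f i) = k%:~R * B (f i) (f i).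
Proof.
move=> /typeA_double[M iW] ai.
have [k1 E1] := W_int iW vW; have [k2 E2] := W_int iW (pair_weight ai).
exists (k1 - k2 - 1); rewrite !BE in E1 E2.
by rewrite !rmorphB /=; lra.
Qed.

(** The product is an integer multiple of both squared lengths. If it is nonzero, its absolute value
    is at least each of them, so [f a] is [f i] or its opposite; injectivity excludes the former,
    the positive product with [v] the latter. *)
Lemma typeA_orthogonal i a : i \in typeA -> a \in typeA -> a != i -> B (f a) (f i) = 0.
Proof.
move=> iA aA ai; have [k kE] := typeA_integral iA ai.
have ia : i != a by rewrite eq_sym.
have [l lE] := typeA_integral aA ia; rewrite Bsym in lE.
have pi := flipv_gt0 i; have pa := flipv_gt0 a.
have bound (m : int) (p c : R) : 0 < p -> c = m%:~R * p -> (0 < c -> p <= c) /\ (c < 0 -> c <= - p).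
  move=> p0 ->; rewrite pmulr_lgt0// pmulr_llt0// ltr0z ltrz0; split => m0.
    have m1 : (1%:~R : R) <= m%:~R by rewrite ler_int; move: m0; lia.
    by have := ler_wpM2r (ltW p0) m1; rewrite mul1r.
  have m1 : (m%:~R : R) <= (-1)%:~R by rewrite ler_int; move: m0; lia.
  by have := ler_wpM2r (ltW p0) m1; rewrite rmorphN1 mulN1r.
have [h1 h2] := bound _ _ _ pi kE; have [h3 h4] := bound _ _ _ pa lE.
have [c0|c0|//] := ltgtP (B (f a) (f i)) 0.
  have E : f a + f i = 0.
    apply: (form_eq0 Bpos); apply/eqP; rewrite eq_le (form_ge0 BZl Bpos) andbT.
    by rewrite !BE (Bsym (f i)); move: (h2 c0) (h4 c0); lra.
  have := BZr 0 v 0; rewrite scale0r mul0r -E BE.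
  by move: (flipv_half a) (flipv_half i) Bv0; lra.
have E : f a - f i = 0.
  apply: (form_eq0 Bpos); apply/eqP; rewrite eq_le (form_ge0 BZl Bpos) andbT.
  by rewrite !BE (Bsym (f i)); move: (h1 c0) (h3 c0); lra.
by move/eqP: E; rewrite subr_eq0 (inj_eq flipv_inj) (negPf ai).
Qed.

Lemma rank_fourteen : False.
Proof.
have /choice[k kE] : forall i, exists k, i \in typeA -> k != i /\ v = 2 *: f i + f k + f8.
  move=> i; have [|iA] := boolP (i \in typeA); last by exists i.
  by rewrite inE => /existsP[k /andP[ki /eqP E] ]; exists k.
have kinj : {in typeA &, injective k}.
  move=> i j /kE[_ Ei] /kE[_ Ej] kij; apply: flipv_inj; rewrite kij in Ei.
  apply/rowP => l; have := congr1 (fun u : V => u 0 l) Ei.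
  by have := congr1 (fun u : V => u 0 l) Ej; rewrite !mxE; lra.
(* Pigeonhole: [typeA] and its image under the injective [k] have at least four elements each among
   seven indices. *)
have [i iA kA] : exists2 i, i \in typeA & k i \in typeA.
  have : ~~ [disjoint typeA & [set k i | i in typeA]%SET].
    apply/negP => d; have := (leq_card_setU typeA [set k i | i in typeA]%SET).2.
    rewrite d card_in_imset// => /eqP cU.
    have := max_card [in (typeA :|: [set k i | i in typeA])%SET].
    by rewrite cU card_ord; move: q7 card_typeA; lia.
  rewrite -setI_eq0 => /set0Pn[j]; rewrite !inE => /andP[jA /imsetP[i iA jE] ].
  by exists i => //; rewrite -jE inE.
have [ki vE] := kE i iA.
pose S := (typeA :\ i :\ k i)%SET.
have cS : (2 <= #|S|)%N.
  have := cardsD1 i typeA; have := cardsD1 (k i) (typeA :\ i)%SET; have := card_typeA.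
  by rewrite !in_setD1 iA kA ki /S /=; lia.
have [i1 [i2 [i1S i2S i12] ] ] : exists i1 i2, [/\ i1 \in S, i2 \in S & i1 != i2].
  by move/card_gt1P: cS => [i1 [i2 [? ? ?] ] ]; exists i1, i2.
have Bf8 j : j \in S -> 4 * B f8 (f j) = b.
  rewrite !in_setD1 => /and3P[jk ji jA]; rewrite -(flipv_half j).
  have -> : B v (f j) = B (2 *: f i + f (k i) + f8) (f j) by rewrite -vE.
  rewrite eq_sym in jk; rewrite eq_sym in ji.
  by rewrite !BE (typeA_orthogonal jA iA ji) (typeA_orthogonal jA kA jk) mulr0 !add0r.
have inA j : j \in S -> j \in typeA by rewrite !in_setD1 => /and3P[].
have short j : j \in S -> 4 * B (f j) (f j) <= b.
  by move=> /inA/typeA_double[M /v_max]; rewrite !BE; lra.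
(* By orthogonality this says [|f8|^2 + |f_i1|^2 + |f_i2|^2 >= |v|^2], whereas [last1] says
   [|f8|^2 + |f_i1|^2 <= |v|^2 / 2]. Then [|f_i2|^2 >= |v|^2 / 2], twice what [short] allows. *)
have := form_ge0 BZl Bpos (f8 - f i1 - f i2).
have last1 : B (f i1 + f8) (f i1 + f8) <= b.
  by case: (flipv_addD i1) => [[j [l [jl ->] ] ]|[j ->] ];
    [exact: v_max (pair_weight jl)|exact: v_max (pair_last_weight j)].
rewrite !BE (Bsym (f i1) f8) in last1 *.
rewrite (Bsym (f i2) f8) (Bsym (f i2) (f i1)) (typeA_orthogonal (inA _ i2S) (inA _ i1S) i12).
by move: (Bf8 _ i1S) (Bf8 _ i2S) (short _ i1S) (short _ i2S) last1 Bv0; lra.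
Qed.

End RankFourteen.

End SignedWeights.

(** * Signatures of the weights *)

Section CliffordWeights.
Context {R : realType} {n r : nat}.
Local Notation C := R[i].
Local Notation V := 'rV[R]_n.
Local Notation VC := 'rV[C]_n.
Local Notation Cl := (clifford R r).
Local Notation even := (@even_clifford R r).
Variable br : V -> V -> V.
Hypothesis br_linl : forall y, linear (br^~ y).
Hypothesis br_linr : forall x, linear (br x).
Hypothesis brC : forall x y, br x y = - br y x.
Hypothesis brJ : forall u x y, br u (br x y) = br (br u x) y + br x (br u y).
Variable B : V -> V -> R.
Hypothesis BDl : forall x y u, B (x + y) u = B x u + B y u.
Hypothesis BZl : forall k x u, B (k *: x) u = k * B x u.
Hypothesis Bsym : forall x y, B x y = B y x.
Hypothesis Bpos : forall x, x != 0 -> 0 < B x x.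
Hypothesis Binv : forall X Y Z, B (br X Y) Z + B Y (br X Z) = 0.
Variables t m hh : {vspace V}.
Hypothesis t_ab : {in t &, forall X Y, br X Y = 0}.
Hypothesis t_self : forall x, (forall X, X \in t -> br X x = 0) -> x \in t.
Hypothesis t_hh : forall X, X \in t -> X \in hh.
Hypothesis mP : forall x, x \in m <-> (forall Y, Y \in hh -> B x Y = 0).
Hypothesis hh_m : forall X Y, X \in hh -> Y \in m -> br X Y \in m.
Variable op : Cl -> V -> V.
Hypothesis op_linr : forall x, linear (op x).
Hypothesis op_m : forall x z, op x z \in m.
Hypothesis op1 : forall z, z \in m -> op 1 z = z.
Hypothesis opM : forall x y z, x \in even -> y \in even -> op (x * y) z = op x (op y z).
Hypothesis opP : forall a x y z, x \in even -> y \in even ->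
  op (a *: x + y) z = a *: op x z + op y z.
Hypothesis op_skew : forall u w, dotv u w = 0 -> forall z z', z \in m -> z' \in m ->
  B (op (cvec u * cvec w) z) z' = - B z (op (cvec u * cvec w) z').
Hypothesis inf : forall X, X \in hh -> exists A, infinitesimal_action br m op X A.
Hypothesis m_nontrivial : exists2 z, z \in m & z != 0.
Hypothesis r5 : (5 <= r)%N.

Let br1D x y u : br (x + y) u = br x u + br y u.
Proof. by have := br_linl u 1 x y; rewrite !scale1r. Qed.
Let br10 u : br 0 u = 0.
Proof. by have := br_linl u (-1) 0 0; rewrite scaler0 addr0 scaleN1r addNr. Qed.
Let br1Z k x u : br (k *: x) u = k *: br x u.
Proof. by have := br_linl u k x 0; rewrite !addr0 br10 addr0. Qed.

(** The matrices [A] chosen for a basis of [t] commute, since the derivation of their commutator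
    acts trivially on [m]. In a common block basis [o], [beta i] represents the linear form giving
    the block entry of [o_i]; skewness gives partners opposite forms. *)
Lemma torus_basis : exists (o : seq 'rV[R]_r) (beta : nat -> V),
  [/\ orthonormal_seq o, size o = r, (forall i, beta i \in t),
   (forall i j X z, (i < r)%N -> (j < r)%N -> X \in t -> z \in m ->
     br X (op (gen2 o i j) z) = op (gen2 o i j) (br X z)
       - B X (beta i) *: op (gen2 o (partner i) j) z
       - B X (beta j) *: op (gen2 o i (partner j)) z) &
   (forall i, (i < r)%N -> (partner i < r)%N -> beta (partner i) = - beta i)].
Proof.
have [z0 z0m z00] := m_nontrivial.
have bt k : (k < \dim t)%N -> (vbasis t)`_k \in t.
  by move=> kt; apply: vbasis_mem; rewrite mem_nth// size_tuple.
have /choice[A hA] : forall k : 'I_(\dim t), exists A, infinitesimal_action br m op (vbasis t)`_k A.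
  by move=> k; apply: inf; apply: t_hh; exact: bt.
have [| | o [oo bo so]] := @block_diagonalization R r [seq A k | k <- enum 'I_(\dim t)].
- by move=> _ /mapP[k _ ->]; exact: (hA k).1.
- move=> _ _ /mapP[k _ ->] /mapP[l _ ->]; rewrite /comm_mx.
  apply/eqP; rewrite -subr_eq0; apply/eqP.
  apply: (delta2_faithful op_linr op_m op1 opM opP _ r5 z0m z00).
    by rewrite linearB /= !trmx_mul (hA k).1 (hA l).1 !mulNmx !mulmxN !opprK opprB.
  move=> u w z zm.
  apply: (commutator_acts_trivially br_linl br_linr brJ hh_m op1 opP u w
    (t_hh (bt _ (ltn_ord l))) (t_hh (bt _ (ltn_ord k))) _ (hA l) (hA k)) => //.
  by apply: t_ab; exact: bt.
have oA i k : (i < r)%N -> o`_i *m A k = dotv (o`_i *m A k) o`_(partner i) *: o`_(partner i).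
  move=> ir; have Ak : A k \in [seq A k | k <- enum 'I_(\dim t)].
    by apply/mapP; exists k; rewrite ?mem_enum.
  have [|c hc] := bo _ Ak i; first by rewrite so.
  rewrite hc; have [pr|pr] := ltnP (partner i) r; last by rewrite nth_default ?so// !scaler0.
  have := oo; rewrite /orthonormal_seq so => /(_ _ _ pr pr); rewrite eqxx => h.
  by rewrite dotvZl h mulr1.
have /choice[beta hbeta] : forall i, exists b, b \in t /\ forall k : 'I_(\dim t),
    B (vbasis t)`_k b = dotv (o`_i *m A k) o`_(partner i).
  move=> i; have [b bt' hb] := riesz_basis BDl BZl Bsym Bpos (fun k : 'I_(\dim t) => dotv (o`_i *m A k) o`_(partner i)).
  by exists b.
exists o, beta; split => //; first by move=> i; exact: (hbeta i).1.
  move=> i j X z ir jr Xt zm; rewrite (coord_vbasis Xt).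
  have brsum (I : finType) (f : I -> V) u : br (\sum_i f i) u = \sum_i br (f i) u.
    by elim/big_rec2: _ => // k a b _ <-.
  have opsum (I : finType) x (f : I -> V) : op x (\sum_i f i) = \sum_i op x (f i).
    elim/big_rec2: _ => [|k a b _ <-]; last exact: (opDr op_linr).
    by have := opZr op_linr 0 x 0; rewrite !scale0r.
  have Bsum (I : finType) (f : I -> V) u : B (\sum_i f i) u = \sum_i B (f i) u.
    have B0 : B 0 u = 0 by have := BZl 0 0 u; rewrite scale0r mul0r.
    by elim/big_rec2: _ => // k a b _ <-.
  rewrite !brsum !Bsum opsum !scaler_suml -!sumrB; apply: eq_bigr => k _.
  rewrite !br1Z !BZl (opZr op_linr) -!scalerA -!scalerBr; congr (_ *: _).
  rewrite (acts_cvec2 br_linr hh_m op1 opP _ _ (t_hh (bt _ (ltn_ord k))) (hA k) zm).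
  rewrite /delta2 (oA i k ir) (oA j k jr) -(hbeta i).2 -(hbeta j).2 !cvecZ.
  rewrite -scalerAl -scalerAr (opD opP) ?evenZ ?even_cvec2//.
  rewrite !(opZ opP) ?even_cvec2//.
  by rewrite opprD addrC addrA.
move=> i ir pr; apply: (cartan_eq BDl BZl Bsym Bpos (t := t)).
- exact: (hbeta _).1.
- by rewrite rpredN (hbeta _).1.
have ppi : partner (partner i) = i.
  by rewrite {2}/partner; case: ifPn => oi; rewrite /partner; case: i oi {ir pr} => //= k; case: (odd k).
move=> X Xt; rewrite (coord_vbasis Xt).
have Bsum (I : finType) (f : I -> V) u : B (\sum_i f i) u = \sum_i B (f i) u.
  have B0 : B 0 u = 0 by have := BZl 0 0 u; rewrite scale0r mul0r.
  by elim/big_rec2: _ => // k a b _ <-.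
rewrite !Bsum; apply: eq_bigr => k _; rewrite !BZl; congr (_ * _).
rewrite (formNr BZl Bsym) (hbeta _).2 (hbeta _).2 ppi dotv_skew ?(hA k).1//.
by rewrite dotvC.
Qed.

Section Torus.
Variables (o : seq 'rV[R]_r) (beta : nat -> V).
Hypotheses (oo : orthonormal_seq o) (so : size o = r).
Hypothesis beta_t : forall i, beta i \in t.
Hypothesis torus_action : forall i j X z, (i < r)%N -> (j < r)%N -> X \in t -> z \in m ->
     br X (op (gen2 o i j) z) = op (gen2 o i j) (br X z)
       - B X (beta i) *: op (gen2 o (partner i) j) z
       - B X (beta j) *: op (gen2 o i (partner j)) z.
Hypothesis beta_partner :
  forall i, (i < r)%N -> (partner i < r)%N -> beta (partner i) = - beta i.

Local Notation "[[ z , w ]]" := (bracketC br z w).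
Local Notation wt := (weight br B t).
Local Notation g2 := (gen2 o).

Definition opC x (z : VC) : VC := endC (op x) z.
Definition inmC (z : VC) := reV z \in m /\ imV z \in m.

Lemma opCZ x a z : opC x (a *: z) = a *: opC x z.
Proof. exact: endCZ. Qed.

Lemma opC_inm x z : inmC (opC x z).
Proof. by rewrite /inmC /opC !endC_parts. Qed.

Lemma opCM x y z : x \in even -> y \in even -> opC (x * y) z = opC x (opC y z).
Proof.
by move=> hx hy; apply: eqVC; rewrite /opC !endC_parts opM.
Qed.

Lemma opCN x z : x \in even -> opC (- x) z = - opC x z.
Proof.
by move=> hx; apply: eqVC; rewrite /opC ?reVN ?imVN !endC_parts (opN opP).
Qed.

Lemma opCNM x y z : x \in even -> y \in even -> opC (- (x * y)) z = - opC x (opC y z).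
Proof. by move=> hx hy; rewrite opCN ?opCM//; exact: evenM. Qed.

Lemma opC1 z : inmC z -> opC 1 z = z.
Proof.
by move=> [h1 h2]; apply: eqVC; rewrite /opC !endC_parts op1.
Qed.

Lemma opC_conj x z : opC x (conjV z) = conjV (opC x z).
Proof. exact: endC_conj. Qed.

Lemma opC0 x : opC x 0 = 0.
Proof. by have := opCZ x 0 0; rewrite !scale0r. Qed.

Lemma opC_sqr i j z : (i < r)%N -> (j < r)%N -> i != j -> inmC z ->
  opC (g2 i j) (opC (g2 i j) z) = - z.
Proof.
move=> ir jr ij zm; rewrite -opCM ?gen2_even// gen2_sqr// opCN ?opC1//.
exact: even1.
Qed.

Lemma opC_neq0 i j z : (i < r)%N -> (j < r)%N -> i != j -> inmC z -> z != 0 ->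
  opC (g2 i j) z != 0.
Proof.
move=> ir jr ij zm; apply: contraNneq => E.
by have := opC_sqr ir jr ij zm; rewrite E opC0 => /eqP; rewrite eq_sym oppr_eq0.
Qed.

Lemma inmC_conj z : inmC z -> inmC (conjV z).
Proof. by move=> [h1 h2]; rewrite /inmC reV_pair imV_pair rpredN. Qed.

Lemma torus_actionC i j X z : (i < r)%N -> (j < r)%N -> X \in t -> inmC z ->
  [[cx X, opC (g2 i j) z]] = opC (g2 i j) [[cx X, z]]
    - Complex (B X (beta i)) 0 *: opC (g2 (partner i) j) z
    - Complex (B X (beta j)) 0 *: opC (g2 i (partner j)) z.
Proof.
move=> ir jr Xt [h1 h2]; rewrite !bracketC_cx// /opC.
have re_comb (a b c : VC) (p q : R) : reV (a - Complex p 0 *: b - Complex q 0 *: c) =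
    reV a - p *: reV b - q *: reV c.
  by rewrite !reVD !reVN !reVZ /= !scale0r !subr0.
have im_comb (a b c : VC) (p q : R) : imV (a - Complex p 0 *: b - Complex q 0 *: c) =
    imV a - p *: imV b - q *: imV c.
  by rewrite !imVD !imVN !imVZ /= !scale0r !addr0.
apply: eqVC.
  by rewrite re_comb !endC_parts torus_action.
by rewrite im_comb !endC_parts torus_action.
Qed.

Local Notation q := (r./2).
Definition tor (k : nat) := g2 k.*2 k.*2.+1.

Lemma tor_even k : tor k \in even.
Proof. exact: gen2_even. Qed.

Lemma tor_lt (k : 'I_q) : (k.*2 < r)%N /\ (k.*2.+1 < r)%N.
Proof.
by have := ltn_ord k; have := odd_double_half r; case: (odd r) => /=; split; lia.
Qed.

Lemma partner_even k : partner k.*2 = k.*2.+1.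
Proof. by rewrite /partner odd_double. Qed.
Lemma partner_odd k : partner k.*2.+1 = k.*2.
Proof. by rewrite /partner /= odd_double. Qed.

Lemma tor_sqr (k : 'I_q) z : inmC z -> opC (tor k) (opC (tor k) z) = - z.
Proof.
by have [h1 h2] := tor_lt k; move=> zm; apply: opC_sqr => //; rewrite neq_ltn ltnSn.
Qed.

(** The two correction terms are scalars, both generators having square -1, and cancel because
    [beta] takes opposite values on partners. *)
Lemma tor_commutes (k : 'I_q) X z : X \in t -> inmC z ->
  [[cx X, opC (tor k) z]] = opC (tor k) [[cx X, z]].
Proof.
move=> Xt zm; have [h1 h2] := tor_lt k.
rewrite torus_actionC// partner_even partner_odd.
have -> : g2 k.*2.+1 k.*2.+1 = -1 by exact: gen_sqr.
have -> : g2 k.*2 k.*2 = -1 by exact: gen_sqr.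
have := beta_partner h1; rewrite partner_even => /(_ h2) ->.
rewrite (formNr BZl Bsym) -addrA -opprD -scalerDl.
have -> : (Complex (B X (beta k.*2)) 0 + Complex (- B X (beta k.*2)) 0 : C) = 0.
  by apply/eqP; rewrite eq_complex /= subrr addr0 eqxx.
by rewrite scale0r subr0.
Qed.

Definition sgn (N : {set 'I_q}) (k : 'I_q) : R := if k \in N then -1 else 1.

Definition signed_weight (v : V) (N : {set 'I_q}) := exists z,
  [/\ z != 0, inmC z, wt v z &
     forall k : 'I_q, opC (tor k) z = Complex 0 (sgn N k) *: z].

Lemma t_m_disjoint x : x \in t -> x \in m -> x = 0.
Proof.
move=> xt /mP xm; apply: (form_eq0 Bpos); exact: xm (t_hh xt).
Qed.

(** A vector of weight zero is centralized by [t], hence lies in [t], which meets [m] only in 0. *)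
Lemma weight_neq0 v z : inmC z -> z != 0 -> wt v z -> v != 0.
Proof.
move=> [h1 h2] z0 wz; apply: contraNneq z0 => v0.
have B0 X : B X 0 = 0 by have := formZr BZl Bsym 0 X 0; rewrite scale0r mul0r.
rewrite v0 in wz; apply/eqP; apply: eqVC; rewrite ?reV0 ?imV0; apply: t_m_disjoint => //.
  by apply: t_self => X Xt; rewrite (weight_re br_linr brC wz Xt) B0 scale0r oppr0.
by apply: t_self => X Xt; rewrite (weight_im br_linr brC wz Xt) B0 scale0r.
Qed.

Lemma signed_weight_of v z : z != 0 -> inmC z -> wt v z -> exists N, signed_weight v N.
Proof.
move=> z0 zm wz; have v0 := weight_neq0 zm z0 wz.
have ev (k : 'I_q) : exists b : bool, opC (tor k) z = Complex 0 (if b then -1 else 1) *: z.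
  have wT : wt v (opC (tor k) z).
    split; first exact: wz.1.
    by move=> X Xt; rewrite tor_commutes// wz.2// opCZ.
  have [a Ta] := root_multiplicity br_linl br_linr brC brJ BDl BZl Bsym Bpos Binv t_self wz v0 z0 wT.
  have : (a * a + 1) *: z = 0.
    by have := tor_sqr k zm; rewrite Ta opCZ Ta scalerA scalerDl scale1r => ->; rewrite addNr.
  move/eqP; rewrite scaler_eq0 (negPf z0) orbF.
  have -> : a * a + 1 = (a - Complex 0 1) * (a + Complex 0 1).
    by case: a {Ta} => x y; apply/eqP; rewrite eq_complex /=; apply/andP; split; apply/eqP; ring.
  rewrite mulf_eq0 subr_eq0 addr_eq0 => /orP[/eqP aE|/eqP aE].
    by exists false; rewrite Ta aE.
  by exists true; rewrite Ta aE; congr (_ *: _); apply/eqP; rewrite eq_complex /= oppr0 !eqxx.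
have /choice[b hb] := ev.
exists [set k | b k]%SET, z; split => // k.
by rewrite hb /sgn inE.
Qed.

Lemma signed_weight_fun v N N' : signed_weight v N -> signed_weight v N' -> N = N'.
Proof.
move=> [z [z0 zm wz hz] ] [y [y0 ym wy hy] ].
have v0 := weight_neq0 zm z0 wz.
have [a za] := root_multiplicity br_linl br_linr brC brJ BDl BZl Bsym Bpos Binv t_self wz v0 z0 wy.
apply/setP => k; have := hy k; rewrite za opCZ hz scalerA mulrC -scalerA -za.
move/eqP; rewrite -subr_eq0 -scalerBl scaler_eq0 (negPf y0) orbF subr_eq0 eq_complex /= eqxx /=.
rewrite /sgn; case: (k \in N); case: (k \in N') => //= /eqP h; exfalso; move: h; lra.
Qed.

Lemma signed_weight_neg v N : signed_weight v N -> signed_weight (- v) (~: N)%SET.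
Proof.
move=> [z [z0 zm wz hz] ]; exists (conjV z); split.
- by rewrite conjV_eq0.
- exact: inmC_conj.
- exact: weight_conj.
- move=> k; rewrite opC_conj hz conjVZ; congr (_ *: _).
  by rewrite /sgn inE; case: (k \in N); apply/eqP; rewrite eq_complex /= ?opprK !eqxx.
Qed.

Lemma signed_weight_neq0 v N : signed_weight v N -> v != 0.
Proof. by move=> [z [z0 zm wz _] ]; exact: weight_neq0 wz. Qed.

Lemma signed_weight_integrality v N w N' : signed_weight v N -> signed_weight w N' ->
  exists k : int, 2 * B w v = k%:~R * B v v.
Proof.
move=> sv [y [y0 ym wy _] ]; have v0 := signed_weight_neq0 sv.
have [z [z0 zm wz _] ] := sv.
exact: (root_integrality br_linl br_linr brC brJ BDl BZl Bsym Bpos Binv t_self wz v0 z0 wy y0).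
Qed.

Local Notation bet k := (beta (nat_of_ord k).*2).

Lemma scale_combination (p a b d c x : C) (y : VC) :
  p + a * b + d * c = x -> p *: y - a *: - (b *: y) - d *: - (c *: y) = x *: y.
Proof. by move=> <-; rewrite !scalerN !opprK !scalerDl !scalerA. Qed.

(** Serves both kinds of flips: [l = j.*2] with [c = sgn N j], and the unpaired last generator with
    [c = 0]. The first correction term is computed from [o_(2k+1) o_l = - o_2k o_l (o_2k
    o_(2k+1))]. *)
Lemma weight_flip v N (k : 'I_q) l c z : (l < r)%N -> l != k.*2 -> l != k.*2.+1 ->
  inmC z -> wt v z -> opC (tor k) z = Complex 0 (sgn N k) *: z ->
  opC (g2 k.*2 (partner l)) z = - (Complex 0 c *: opC (g2 k.*2 l) z) ->
  wt (v + sgn N k *: bet k + c *: beta l) (opC (g2 k.*2 l) z).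
Proof.
move=> lr lk lk1 zm wz Tz Fl; have [h1 h2] := tor_lt k.
split; first by rewrite !rpredD ?rpredZ//; exact: wz.1.
move=> X Xt; rewrite torus_actionC// partner_even wz.2// opCZ Fl.
have -> : g2 k.*2.+1 l = - (g2 k.*2 l * tor k).
  rewrite /gen2 /tor /gen2 -mulrA [gen o l * _]mulrA (gen_anti oo so lr h1 lk).
  rewrite mulNr mulrN opprK -mulrA mulrA (gen_sqr oo so h1) mulN1r.
  by rewrite -(gen_anti oo so h2 lr)// eq_sym.
rewrite (opCNM _ (gen2_even _ _ _) (tor_even _)) Tz opCZ.
set y := opC _ z; clearbody y; clear Fl.
apply: scale_combination.
apply/eqP; rewrite eq_complex /= !(formDr BDl Bsym) !(formZr BZl Bsym).
by apply/andP; split; apply/eqP; ring.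
Qed.

Lemma tor_gen_anti (k : 'I_q) l : (l < r)%N -> l != k.*2 -> l != k.*2.+1 ->
  tor k * g2 k.*2 l = - (g2 k.*2 l * tor k).
Proof.
move=> lr lk lk1; have [h1 h2] := tor_lt k.
by apply: gen2_anti => //; rewrite ?neq_ltn ?ltnSn// -neq_ltn eq_sym.
Qed.

Lemma double_ord_neq (k j : 'I_q) : k != j -> [/\ k.*2 != j.*2, k.*2 != j.*2.+1,
  k.*2.+1 != j.*2 & k.*2.+1 != j.*2.+1].
Proof. by move=> /eqP kj; split; apply/eqP => E; apply: kj; apply: val_inj => /=; lia. Qed.

Lemma sgn_symdiff N (S : {set 'I_q}) (k : 'I_q) :
  sgn (symdiff N S) k = (if k \in S then -1 else 1) * sgn N k.
Proof.
by rewrite /sgn in_symdiff; case: (k \in N); case: (k \in S) => /=; rewrite ?mulrNN ?mulr1 ?mul1r.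
Qed.

Lemma tor_after_flip N (S : {set 'I_q}) x z (k : 'I_q) : x \in even ->
  opC (tor k) z = Complex 0 (sgn N k) *: z ->
  tor k * x = (if k \in S then - (x * tor k) else x * tor k) ->
  opC (tor k) (opC x z) = Complex 0 (sgn (symdiff N S) k) *: opC x z.
Proof.
move=> hx Tz; have ek := tor_even k; rewrite sgn_symdiff -opCM// => ->.
case: ifP => _; last by rewrite opCM// Tz opCZ mul1r.
rewrite opCNM// Tz opCZ -scaleNr; congr (_ *: _).
by apply/eqP; rewrite eq_complex /= mulN1r oppr0 !eqxx.
Qed.

Lemma signed_weight_flip2 v N (k j : 'I_q) : k != j -> signed_weight v N ->
  signed_weight (v + sgn N k *: bet k + sgn N j *: bet j) (symdiff N [set k; j]%SET).
Proof.
move=> kj [z [z0 zm wz hz] ].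
have [h1 h2] := tor_lt k; have [h3 h4] := tor_lt j.
have [n1 n2 n3 n4] := double_ord_neq kj.
have n1' : j.*2 != k.*2 by rewrite eq_sym.
have n3' : j.*2 != k.*2.+1 by rewrite eq_sym.
have n2' : j.*2.+1 != k.*2 by rewrite eq_sym.
have n4' : j.*2.+1 != k.*2.+1 by rewrite eq_sym.
exists (opC (g2 k.*2 j.*2) z); split.
- exact: opC_neq0.
- exact: opC_inm.
- apply: weight_flip => //; rewrite partner_even.
  have -> : g2 k.*2 j.*2.+1 = - (g2 k.*2 j.*2 * tor j).
    rewrite /gen2 /tor /gen2 -mulrA [gen o j.*2 * _]mulrA (gen_sqr oo so h3).
    by rewrite mulN1r mulrN opprK.
  by rewrite (opCNM _ (gen2_even _ _ _) (tor_even _)) hz opCZ.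
- move=> l; apply: tor_after_flip => //; first exact: gen2_even.
  rewrite !inE; have [->|lk] := eqVneq l k; first exact: tor_gen_anti.
  have [->|lj] := eqVneq l j.
    rewrite /= (gen2_swap oo so h1 h3 n1) mulrN mulNr opprK.
    by rewrite tor_gen_anti// opprK.
  rewrite /=; have [h5 h6] := tor_lt l.
  have [m1 m2 m3 m4] := double_ord_neq lk; have [m5 m6 m7 m8] := double_ord_neq lj.
  by apply: gen2C.
Qed.

Lemma signed_weight_flip1 v N (k : 'I_q) : odd r -> signed_weight v N ->
  signed_weight (v + sgn N k *: bet k) (symdiff N [set k]%SET).
Proof.
move=> oddr [z [z0 zm wz hz] ].
have [h1 h2] := tor_lt k.
have rE : r = r.-1.+1 by case: (r) oddr.
have lr : (r.-1 < r)%N by rewrite {2}rE.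
have olr : odd r.-1 = false by move: oddr; rewrite {1}rE /= => /negbTE.
have lE : r.-1 = q.*2 by have := odd_double_half r; rewrite oddr; lia.
have kq := ltn_ord k.
have n1 (l : 'I_q) : r.-1 != l.*2 by rewrite lE; have := ltn_ord l; lia.
have n2 (l : 'I_q) : r.-1 != l.*2.+1.
  by rewrite lE; apply/eqP => /(congr1 odd) /=; rewrite !odd_double.
exists (opC (g2 k.*2 r.-1) z); split.
- by apply: opC_neq0; rewrite // eq_sym.
- exact: opC_inm.
- have -> : v + sgn N k *: bet k = v + sgn N k *: bet k + 0 *: beta r.-1.
    by rewrite scale0r addr0.
  apply: weight_flip => //.
  (* The partner of the last index is [r], past the end of [o], where [nth] returns 0. *)
  have -> : g2 k.*2 (partner r.-1) = 0.
    rewrite /gen2 [X in _ * X]/gen nth_default; last by rewrite so /partner olr -rE.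
    by have := cvecZ 0 (0 : 'rV[R]_r); rewrite !scale0r => ->; rewrite mulr0.
  have c0 : Complex 0 0 = 0 :> C by [].
  rewrite c0 scale0r oppr0; apply: eqVC; rewrite /opC !endC_parts ?reV0 ?imV0.
    exact: (op0 opP).
  exact: (op0 opP).
- move=> l; apply: tor_after_flip => //; first exact: gen2_even.
  rewrite !inE; have [->|lk] := eqVneq l k; first exact: tor_gen_anti.
  have [h5 h6] := tor_lt l; have [m1 m2 m3 m4] := double_ord_neq lk.
  by apply: gen2C => //; rewrite eq_sym.
Qed.

Lemma signed_weight_flip v N (S : {set 'I_q}) : odd r || ~~ odd #|S| ->
  signed_weight v N ->
  signed_weight (v + \sum_(k in S) sgn N k *: bet k) (symdiff N S).
Proof.
have [p] := ubnP #|S|; elim: p S v => // p IH S v Sp oS sv.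
have [S0|[k kS] ] := set_0Vmem S.
  by rewrite S0 big_set0 addr0 symdiffC symdiff0.
have cS := cardsD1 k S; rewrite kS in cS.
have [oddr|evr] := boolP (odd r).
  have h : signed_weight (v + \sum_(i in S :\ k) sgn N i *: bet i) (symdiff N (S :\ k)%SET).
    by apply: IH => //; rewrite ?oddr//; move: cS Sp; lia.
  have := signed_weight_flip1 k oddr h.
  rewrite sgn_symdiff !inE eqxx /= mul1r.
  have -> : symdiff (symdiff N (S :\ k)%SET) [set k]%SET = symdiff N S.
    apply/setP => l; rewrite !in_symdiff !inE.
    by case: (eqVneq l k) => [->|_]; rewrite ?kS ?addbF//= addbC.
  by rewrite (big_setD1 k kS) /= [sgn N k *: _ + _]addrC addrA.
rewrite (negPf evr) /= in oS.
have [j jS] : exists j, j \in (S :\ k)%SET.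
  apply/set0Pn; apply: contraNneq oS => E.
  by rewrite cS E cards0.
have cS' := cardsD1 j (S :\ k)%SET; rewrite jS in cS'.
have kj : k != j by move: jS; rewrite !inE eq_sym => /andP[].
pose S' := ((S :\ k) :\ j)%SET.
have h : signed_weight (v + \sum_(i in S') sgn N i *: bet i) (symdiff N S').
  apply: IH => //; first by move: cS cS' Sp; rewrite /S'; lia.
  by apply/orP; right; move: oS; rewrite cS cS' /S' /= negbK.
have := signed_weight_flip2 kj h.
rewrite (big_setD1 k kS)/= (big_setD1 j jS)/= !sgn_symdiff !inE !eqxx /= andbF /= !mul1r.
have -> : symdiff (symdiff N S') [set k; j]%SET = symdiff N S.
  apply/setP => l; rewrite !in_symdiff !inE; move: jS; rewrite !inE => /andP[_ jS].
  case: (eqVneq l k) => [->|_]; first by rewrite kS (negPf kj) addbF addbT.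
  by case: (eqVneq l j) => [->|_]; rewrite ?jS ?addbF//= addbF addbT.
have -> : v + \sum_(i in S') sgn N i *: bet i + sgn N k *: bet k + sgn N j *: bet j =
  v + (sgn N k *: bet k + (sgn N j *: bet j + \sum_(i in S') sgn N i *: bet i)).
  by apply/rowP => i; rewrite !mxE; ring.
by [].
Qed.

(** [nth] pads the basis with zero rows to a square matrix, the form in which [skew_plane] takes a
    stable subspace. *)
Lemma mem_vbasis_mx (U : {vspace V}) (x : V) :
  (x <= \matrix_(i < n) (vbasis U)`_i)%MS = (x \in U).
Proof.
apply/idP/idP => [/submxP[D ->]|xU].
  rewrite mulmx_sum_row rpred_sum// => i _; rewrite rpredZ// rowK.
  have [iU|iU] := ltnP i (\dim U); last by rewrite nth_default ?size_tuple// mem0v.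
  by apply: vbasis_mem; rewrite mem_nth// size_tuple.
have dU : (\dim U <= n)%N.
  by have := dimvS (subvf U); rewrite dimvf /dim /= mul1n.
rewrite (coord_vbasis xU) summx_sub// => i _; rewrite scalemx_sub//.
by rewrite -[_`_i](rowK (fun i : 'I_n => (vbasis U)`_i) (widen_ord dU i)) row_sub.
Qed.

(** [skew_plane] applied on [m] to the operators [br X], for [X] in a basis of [t], gives a common
    eigenvector [x + i y]; [riesz_basis] turns its eigenvalues into a weight. *)
Lemma signed_weight_exists : exists v N, signed_weight v N.
Proof.
have [z0 z0m z00] := m_nontrivial.
have bt (k : 'I_(\dim t)) : (vbasis t)`_k \in t.
  by apply: vbasis_mem; rewrite mem_nth// size_tuple.
pose ad X : 'M[R]_n := \matrix_i br X (delta_mx 0 i).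
have br2D X x y : br X (x + y) = br X x + br X y.
  by have := br_linr X 1 x y; rewrite !scale1r.
have br20 X : br X 0 = 0.
  by have := br_linr X (-1) 0 0; rewrite scaler0 addr0 scaleN1r addNr.
have br2Z X a x : br X (a *: x) = a *: br X x.
  by have := br_linr X a x 0; rewrite !addr0 br20 addr0.
have adE X x : x *m ad X = br X x.
  rewrite {2}(row_sum_delta x) mulmx_sum_row.
  rewrite (big_morph (br X) (br2D X) (br20 X)); apply: eq_bigr => i _.
  by rewrite rowK br2Z.
pose U : 'M[R]_n := \matrix_(i < n) (vbasis m)`_i.
have [|_ /mapP[k _ ->]|_ _ /mapP[k _ ->] /mapP[l _ ->]|_ /mapP[k _ ->] x|x [y [xy xU yU hxy] ] ] :=
    @skew_plane R n B BDl BZl Bsym Bpos U [seq ad (vbasis t)`_(nat_of_ord k) | k <- enum 'I_(\dim t)].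
- apply/eqP => U0; move: z0m; rewrite -mem_vbasis_mx -/U U0 submx0.
  by rewrite (negPf z00).
- apply/row_subP => i; rewrite row_mul adE mem_vbasis_mx.
  apply: hh_m; first by apply: t_hh; exact: bt.
  by rewrite -mem_vbasis_mx row_sub.
- rewrite /comm_mx; apply/row_matrixP => i; rewrite !row_mul !rowE !adE.
  by rewrite (brJ (vbasis t)`_l) (t_ab (bt l) (bt k)) br10 add0r.
- by rewrite adE; have := Binv (vbasis t)`_k x x; rewrite (Bsym x) ; lra.
have /choice[b hb] : forall k : 'I_(\dim t), exists b,
    br (vbasis t)`_k x = - (b *: y) /\ br (vbasis t)`_k y = b *: x.
  move=> k; have [|b] := hxy (ad (vbasis t)`_k).
    by apply/mapP; exists k; rewrite ?mem_enum.
  by rewrite !adE; exists b.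
have [v vt hv] := riesz_basis BDl BZl Bsym Bpos b.
have B0 u : B 0 u = 0 by have := BZl 0 0 u; rewrite scale0r mul0r.
exists v; apply: (@signed_weight_of v (cpair x y)).
- apply: contraL xy => /eqP E; rewrite negb_or !negbK.
  by rewrite -(reV_pair x y) -{2}(imV_pair x y) E reV0 imV0 eqxx.
- by split; rewrite ?reV_pair ?imV_pair -mem_vbasis_mx.
apply: (weightP br_linr brC) => // X Xt; rewrite reV_pair imV_pair (coord_vbasis Xt).
  rewrite (big_morph (fun X => br X x) (fun X Y => br1D X Y x) (br10 x)).
  rewrite (big_morph (fun X => B X v) (fun X Y => BDl X Y v) (B0 v)).
  rewrite scaler_suml -sumrN; apply: eq_bigr => k _.
  by rewrite br1Z BZl (hb k).1 hv scalerN scalerA.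
rewrite (big_morph (fun X => br X y) (fun X Y => br1D X Y y) (br10 y)).
rewrite (big_morph (fun X => B X v) (fun X Y => BDl X Y v) (B0 v)).
rewrite scaler_suml; apply: eq_bigr => k _.
by rewrite br1Z BZl (hb k).2 hv scalerA.
Qed.

Lemma longest_signed_weight : exists v N, signed_weight v N /\
  forall w N', signed_weight w N' -> B w w <= B v v.
Proof.
have [v0 [N0 h0] ] := signed_weight_exists.
have [|s us ws|v [ [N vN] vmax] ] :=
  @exists_maximum V R (fun v => exists N, signed_weight v N) n (fun v => B v v).
- by exists v0, N0.
- apply: (finite_weights br_linr brC BDl BZl Bsym Bpos Binv us) => v /ws[N [z [z0 _ wz _] ] ].
  exact: (ex_intro2 _ _ z wz z0).
by exists v, N; split => // w N' wN'; apply: vmax; exists N'.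
Qed.

Definition tors (s : seq 'I_q) : Cl := \prod_(k <- s) tor k.

Lemma tors_even (s : seq 'I_q) : tors s \in even.
Proof.
elim: s => [|k s IH]; rewrite /tors ?big_nil ?big_cons; first exact: even1.
exact: evenM (tor_even k) IH.
Qed.

Lemma tors_eigenvalue (a : 'I_q -> C) z (s : seq 'I_q) : inmC z ->
  (forall k : 'I_q, opC (tor k) z = a k *: z) -> opC (tors s) z = (\prod_(k <- s) a k) *: z.
Proof.
move=> zm hz; elim: s => [|k s IH].
  by rewrite /tors !big_nil opC1// scale1r.
rewrite /tors !big_cons (opCM _ (tor_even k) (tors_even s)) IH opCZ hz scalerA.
by rewrite mulrC.
Qed.

(** Each [tor k] is skew for the form, and its sign change compensates that of the eigenvalue on
    [y]. *)
Lemma formC_tors (a : 'I_q -> C) z y (s : seq 'I_q) : inmC z -> inmC y ->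
  (forall k : 'I_q, opC (tor k) y = - a k *: y) ->
  formC B y (opC (tors s) z) = (\prod_(k <- s) a k) * formC B y z.
Proof.
move=> zm ym hy; elim: s => [|k s IH].
  by rewrite /tors !big_nil opC1// mul1r.
have skew z1 z2 : inmC z1 -> inmC z2 -> formC B z1 (opC (tor k) z2) = - formC B (opC (tor k) z1) z2.
  move=> [h1 h2] [h3 h4]; have [k1 k2] := tor_lt k.
  have d0 : dotv o`_k.*2 o`_k.*2.+1 = 0.
    by have := oo; rewrite /orthonormal_seq so => /(_ _ _ k1 k2) ->; rewrite eqn_leq ltnn andbF.
  have sk x x' : x \in m -> x' \in m -> B x (op (tor k) x') = - B (op (tor k) x) x'.
    by move=> xm xm'; rewrite (op_skew d0 xm xm') opprK.
  rewrite /formC /opC !endC_parts !sk//.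
  by apply/eqP; rewrite eq_complex /=; apply/andP; split; apply/eqP; ring.
rewrite /tors !big_cons (opCM _ (tor_even k) (tors_even s)) skew//; last exact: opC_inm.
by rewrite hy formCZl// IH mulNr opprK mulrA.
Qed.

Lemma gen_span (u : 'rV[R]_r) : u = \sum_(i < r) dotv u o`_i *: o`_i.
Proof.
pose O := \matrix_(i < r) o`_i.
have OO : O *m O^T = 1%:M.
  apply/matrixP => i j; rewrite !mxE.
  have := oo; rewrite /orthonormal_seq so => /(_ i j (ltn_ord i) (ltn_ord j)) <-.
  by rewrite /dotv mxE; apply: eq_bigr => k _; rewrite !mxE.
rewrite -{1}[u]mulmx1 -(mulmx1C OO) mulmxA mulmx_sum_row; apply: eq_bigr => i _.
rewrite rowK; congr (_ *: _); rewrite /dotv !mxE.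
by apply: eq_bigr => k _; rewrite !mxE.
Qed.

(** In even rank this is the product of all generators. Grouping it by planes makes the weight
    vectors its eigenvectors. *)
Definition vol := tors (index_enum 'I_q).

Lemma anticommuting_product (g x y : Cl) a b : g * x = (-1) ^+ a * (x * g) ->
  g * y = (-1) ^+ b * (y * g) -> g * (x * y) = (-1) ^+ (a + b) * (x * y * g).
Proof.
move=> gx gy; have xb : x * (-1) ^+ b = (-1) ^+ b * x by exact: commr_sign.
rewrite mulrA gx exprD -!mulrA; congr (_ * _).
by rewrite gy (mulrA x ((-1) ^+ b)) xb -!mulrA.
Qed.

(** A generator of index [i] anticommutes with the factor of its own plane [i./2] and commutes with
    all others; in even rank every generator has such a plane. *)
Lemma vol_anticommute (u : 'rV[R]_r) : ~~ odd r -> cvec u * vol = - (vol * cvec u).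
Proof.
move=> evr; have rE : r = q.*2.
  by have := odd_double_half r; rewrite (negPf evr).
have gen_tors i (s : seq 'I_q) : (i < r)%N -> gen o i * tors s =
    (-1) ^+ (count (fun k : 'I_q => nat_of_ord k == i./2) s) * (tors s * gen o i).
  move=> ir; elim: s => [|k s IH].
    by rewrite /tors big_nil !mul1r mulr1.
  have [h1 h2] := tor_lt k.
  have E : gen o i * tor k = (-1) ^+ (nat_of_ord k == i./2) * (tor k * gen o i).
    have [ki|ki] := eqVneq (nat_of_ord k) i./2.
      rewrite expr1 mulN1r; have := odd_double_half i; rewrite -ki.
      case: (odd i) => /= <-; rewrite /tor /gen2.
        rewrite mulrA (gen_anti oo so h2 h1) ?mulNr -?mulrA//.
        by apply/eqP; lia.
      rewrite -mulrA (gen_anti oo so h2 h1) ?mulrN ?opprK//.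
      by apply/eqP; lia.
    have n1 : i != k.*2 by apply/eqP => iE; move: ki; rewrite iE doubleK eqxx.
    have n2 : i != k.*2.+1.
      by apply/eqP => iE; move: ki; rewrite iE /= uphalf_double eqxx.
    rewrite expr0 mul1r /tor /gen2 mulrA (gen_anti oo so ir h1 n1) mulNr.
    rewrite -[gen o k.*2 * gen o i * _]mulrA.
    by rewrite (gen_anti oo so ir h2 n2) mulrN opprK mulrA.
  by rewrite /tors !big_cons; exact: anticommuting_product E IH.
have count1 i : (i < r)%N -> count (fun k : 'I_q => nat_of_ord k == i./2) (index_enum 'I_q) = 1%N.
  move=> ir; have iq : (i./2 < q)%N by move: ir; lia.
  rewrite -(@eq_count _ (pred1 (Ordinal iq))) //.
  by rewrite count_uniq_mem ?index_enum_uniq// mem_index_enum.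
have cvec0 : cvec 0 = 0 :> Cl by have := cvecZ 0 (0 : 'rV[R]_r); rewrite !scale0r.
rewrite (gen_span u) (big_morph (@cvec R r) (@cvecD R r) cvec0).
rewrite mulr_suml mulr_sumr -sumrN; apply: eq_bigr => i _.
by rewrite cvecZ -scalerAl -scalerAr -[cvec _]/(gen o i) gen_tors// count1// expr1 mulN1r scalerN.
Qed.

(** [X] acts on [vol] through the commutator with [spin A], which is zero: [spin A] is a combination
    of products of two vectors, and [vol] anticommutes with each vector. *)
Lemma vol_bracket X z : ~~ odd r -> X \in hh -> z \in m -> br X (op vol z) = op vol (br X z).
Proof.
move=> evr Xh zm; have [A iA] := inf Xh.
have ats (s : seq 'I_q) : acts_by br m op A X (tors s).
  elim: s => [|k s IH].
    rewrite /tors big_nil -[1]scale1r.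
    exact: (acts_by_scalar br_linr hh_m op1 opP _ Xh).
  rewrite /tors big_cons.
  apply: (acts_by_mul op_linr op_m opM opP iA.1 (tor_even k) (tors_even s)) => //.
  exact: (acts_by_cvec2 br_linr hh_m op1 opP _ _ Xh iA).
rewrite ats//.
have cgenE i : cgen i = cvec (delta_mx 0 i) :> Cl.
  rewrite /cvec (bigD1 i)//= big1 ?addr0 ?mxE ?eqxx ?scale1r// => j ji.
  by rewrite mxE (negPf ji) andbF scale0r.
have -> : spin A * vol = vol * spin A.
  rewrite /spin mulr_suml mulr_sumr; apply: eq_bigr => i _.
  rewrite mulr_suml mulr_sumr; apply: eq_bigr => j _.
  rewrite -scalerAl -scalerAr; congr (_ *: _).
  rewrite !cgenE -mulrA vol_anticommute// mulrN mulrA vol_anticommute// mulNr opprK.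
  by rewrite mulrA.
by rewrite subrr (op0 opP) add0r.
Qed.

(** Together with [tors_eigenvalue]: the scalar by which [vol] acts on a weight vector depends only
    on the parity of its signature. *)
Lemma prod_sgn N : \prod_k Complex 0 (sgn N k) = \prod_(k : 'I_q) Complex 0 1 * (-1) ^+ odd #|N| :> C.
Proof.
have -> : \prod_k Complex 0 (sgn N k) = \prod_(k : 'I_q) (Complex 0 1 * (if k \in N then -1 else 1)) :> C.
  apply: eq_bigr => k _; rewrite /sgn; case: ifP => _; rewrite ?mulr1// mulrN1.
  by apply/eqP; rewrite eq_complex /= oppr0 !eqxx.
by rewrite big_split /=; congr (_ * _); rewrite -big_mkcond prodr_const signr_odd.
Qed.

(* The volume element commutes with the isotropy action and acts on the two
   weight vectors by different scalars, so that their bracket is orthogonal to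
   the isotropy algebra. *)
Lemma signed_weight_sub v N w N' : ~~ odd r -> signed_weight v N -> signed_weight w N' ->
  0 < B v w -> odd #|N| != odd #|N'| -> exists N'', signed_weight (v - w) N''.
Proof.
move=> evr [z [z0 zm wz hz] ] [y [y0 ym wy hy] ] Bvw NN'.
apply: (@signed_weight_of _ [[conjV y, z]]).
- apply: (root_pairing br_linl br_linr brC brJ BDl BZl Bsym Bpos Binv t_self wy _ y0 wz z0 Bvw); exact: weight_neq0 wy.
- have orth X : X \in hh -> formC B [[conjV y, z]] (cx X) = 0.
    move=> Xh; rewrite bracketC_asym// -scaleN1r formCZl// mulN1r formC_invariant// opprK.
    rewrite bracketC_asym// formC_sym// -scaleN1r formCZl// mulN1r formC_sym//.
    have xm : inmC [[cx X, z]].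
      by rewrite bracketC_cx// /inmC !endC_parts; split; apply: hh_m => //; case: zm.
    have Ez : opC vol [[cx X, z]] = (\prod_k Complex 0 (sgn N k)) *: [[cx X, z]].
      rewrite -bracketC_Zr// -(tors_eigenvalue _ zm hz) !bracketC_cx//.
      by apply: eqVC; rewrite /opC !endC_parts vol_bracket//; case: zm.
    have Ey (k : 'I_q) : opC (tor k) (conjV y) = - Complex 0 (sgn N' k) *: conjV y.
      rewrite opC_conj hy conjVZ; congr (_ *: _).
      by apply/eqP; rewrite eq_complex /= oppr0 !eqxx.
    have := formC_tors (index_enum 'I_q) xm (inmC_conj ym) Ey.
    rewrite -/vol Ez formC_sym// formCZl// (formC_sym Bsym _ (conjV y)) !prod_sgn.
    move=> /eqP; rewrite -subr_eq0 -mulrBl -mulrBr !mulf_eq0.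
    move=> /orP[/orP[]|/eqP->]; last by rewrite oppr0.
      rewrite prodf_seq_eq0 => /hasP[k _] /=.
      by rewrite eq_complex /= oner_eq0 andbF.
    move: NN'; case: (odd _); case: (odd _) => //= _.
      by rewrite -opprD oppr_eq0 -mulr2n pnatr_eq0.
    by rewrite opprK -mulr2n pnatr_eq0.
  split; apply/mP => X Xh; have := orth X Xh; rewrite /formC reV_cx imV_cx.
    by have B0 := formZr BZl Bsym 0 (imV [[conjV y, z]]) 0; rewrite scale0r mul0r in B0;
      rewrite B0 subr0 => /(congr1 (@complex.Re R)).
  by have B0 := formZr BZl Bsym 0 (reV [[conjV y, z]]) 0; rewrite scale0r mul0r in B0;
    rewrite B0 add0r => /(congr1 (@complex.Im R)).
by rewrite addrC; apply: weight_bracket => //; exact: weight_conj.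
Qed.

Lemma rank_restrictions_torus :
  [/\ odd r -> (r < 11)%N, ~~ odd r -> (r < 18)%N & r <> 14%N].
Proof.
have [v [N [vW v_max] ] ] := longest_signed_weight.
pose flips a := odd r || ~~ odd a.
have flipsD a b : flips a -> flips b -> flips (a + b)%N.
  by rewrite /flips oddD; case: (odd r) => //=; case: (odd a); case: (odd b).
split=> [oddr|evr|r14].
- have := single_flips_bound BDl BZl Bsym Bpos flipsD signed_weight_fun signed_weight_neg
    signed_weight_neq0 signed_weight_integrality signed_weight_flip vW v_max.
  rewrite /flips oddr => /(_ isT); have := odd_double_half r; rewrite oddr; lia.
- have := pair_flips_bound BDl BZl Bsym Bpos flipsD signed_weight_fun signed_weight_neg
    signed_weight_neq0 signed_weight_integrality signed_weight_flip vW v_max.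
  rewrite /flips orbT => /(_ isT); have := odd_double_half r; rewrite (negPf evr); lia.
have evr : ~~ odd r by rewrite r14.
apply: (rank_fourteen (flips := flips) BDl BZl Bsym Bpos signed_weight_fun signed_weight_neg
    signed_weight_neq0 signed_weight_integrality signed_weight_flip vW v_max).
- by rewrite r14.
- by move=> a ea; apply/orP; right.
- by move=> w M w' M'; exact: signed_weight_sub.
Qed.

End Torus.

Lemma rank_restrictions :
  [/\ odd r -> (r < 11)%N, ~~ odd r -> (r < 18)%N & r <> 14%N].
Proof.
have [ o [beta [oo so beta_t torus_action beta_partner] ] ] := torus_basis.
exact: rank_restrictions_torus torus_action beta_partner.
Qed.

End CliffordWeights.

Import numFieldNormedType.Exports.
Local Open Scope classical_set_scope.
Local Open Scope ring_scope.

(** * Differential calculus *)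

Section Calculus.
Context {R : realType}.
Implicit Types U V W : normedModType R.

Lemma near_eq_littleo U V (f g : U -> V) (x : U) :
  (\near x, f x = g x) -> differentiable f x ->
  g \o shift x = cst (g x) + 'd f x +o_ 0 id.
Proof.
move=> fg /diff_locallyP[_ /eqaddoP dfx].
apply/eqaddoP => e e0; have := dfx e e0.
have := fg; rewrite [in X in X -> _](near_shift 0) subr0 => fg0.
apply: filterS2 fg0 => h /= fgh.
have fgx := nbhs_singleton fg.
by rewrite !fctE /= /shift /= -fgh fgx.
Qed.

Lemma near_eq_diff U V (f g : U -> V) (x : U) :
  (\near x, f x = g x) -> differentiable f x -> 'd g x = 'd f x :> (U -> V).
Proof.
move=> fg df; apply: diff_unique; first exact: diff_continuous.
exact: near_eq_littleo.
Qed.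

Lemma near_eq_differentiable U V (f g : U -> V) (x : U) :
  (\near x, f x = g x) -> differentiable f x -> differentiable g x.
Proof.
move=> fg df; apply/diff_locallyP; rewrite (near_eq_diff fg df).
split; first exact: diff_continuous.
exact: near_eq_littleo.
Qed.

Lemma is_derive_comp_diff U V (g : U -> V) (h : R -> U) (t : R) (dh : U) :
  is_derive t 1 h dh -> differentiable g (h t) ->
  is_derive t 1 (g \o h) ('d g (h t) dh).
Proof.
move=> [dh1 dhE] dg.
have dht : differentiable h t by apply/derivable1_diffP.
have dgh : differentiable (g \o h) t by exact: differentiable_comp.
apply: DeriveDef; first exact: diff_derivable.
by rewrite deriveE// diff_comp//= -dhE deriveE.
Qed.

Lemma diff_line U (p v : U) (t : R) : is_derive t 1 (fun s : R => p + s *: v) v.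
Proof.
have : is_derive t 1 (cst p + (fun s : R => s *: v)) (0 + 1 *: v).
  apply: is_deriveD.
  have dv : is_diff t (fun s : R => s *: v) (fun s : R => s *: v) by exact: is_diff_scalel.
  apply: DeriveDef; first by apply: diff_derivable.
  by rewrite deriveE// diff_val.
by rewrite add0r scale1r.
Qed.

Lemma diff_chain U V W (f : U -> V) (g : V -> W) x y v :
  differentiable f x -> f x = y -> differentiable g y ->
  'd (fun z => g (f z)) x v = 'd g y ('d f x v).
Proof. by move=> df <- dg; rewrite -[fun z => g (f z)]/(g \o f) diff_comp. Qed.

Lemma differentiable_chain U V W (f : U -> V) (g : V -> W) x y :
  differentiable f x -> f x = y -> differentiable g y ->
  differentiable (fun z => g (f z)) x.
Proof. by move=> df <- dg; exact: differentiable_comp. Qed.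

Definition pairl U (v : U) : U * U := (v, 0).
Definition pairr U (v : U) : U * U := (0, v).

Fact pairl_linear U : linear (@pairl U).
Proof.
by move=> a x y; rewrite /pairl -[RHS]/(a *: x + y, a *: 0 + 0) scaler0 addr0.
Qed.
Fact pairr_linear U : linear (@pairr U).
Proof.
by move=> a x y; rewrite /pairr -[RHS]/(a *: 0 + 0, a *: x + y) scaler0 addr0.
Qed.
HB.instance Definition _ U :=
  GRing.isLinear.Build R U (U * U)%type _ (@pairl U) (@pairl_linear U).
HB.instance Definition _ U :=
  GRing.isLinear.Build R U (U * U)%type _ (@pairr U) (@pairr_linear U).

Lemma is_diff_pair_cstr U (a x : U) : is_diff x (fun w => (w, a)) (@pairl U).
Proof.
by have := is_diff_pair (is_diff_id x) (is_diff_cst a x).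
Qed.

Lemma is_diff_pair_cstl U (a x : U) : is_diff x (fun w => (a, w)) (@pairr U).
Proof.
by have := is_diff_pair (is_diff_cst a x) (is_diff_id x).
Qed.

Lemma differentiable_entry U m n (f : U -> 'M[R]_(m, n)) x i j :
  differentiable f x -> differentiable (fun y => f y i j) x.
Proof.
move=> df; apply: (@differentiable_comp _ _ _ _ f (fun N : 'M[R]_(m, n) => N i j)) => //.
exact: differentiable_coord.
Qed.

Lemma diff_entry U m n (f : U -> 'M[R]_(m, n)) x i j v :
  differentiable f x -> 'd (fun y => f y i j) x v = 'd f x v i j.
Proof.
move=> df; rewrite -!deriveE//; last exact: differentiable_entry.
by rewrite derive_mx ?mxE//; exact: diff_derivable.
Qed.

Lemma differentiable_sub U V (f g : U -> V) x :
  differentiable f x -> differentiable g x ->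
  differentiable (fun y => f y - g y) x.
Proof. by move=> df dg; have := differentiableB df dg. Qed.

Lemma diff_sub U V (f g : U -> V) x v :
  differentiable f x -> differentiable g x ->
  'd (fun y => f y - g y) x v = 'd f x v - 'd g x v.
Proof.
by move=> df dg; rewrite -[fun y => f y - g y]/(f - g) diffB.
Qed.

Lemma differentiable_bigsum U V k (f : 'I_k -> U -> V) x :
  (forall i, differentiable (f i) x) ->
  differentiable (fun y => \sum_(i < k) f i y) x.
Proof.
move=> df; have := differentiable_sum df.
by congr (differentiable _ _); apply/funext => y; rewrite fct_sumE.
Qed.

Lemma diff_bigsum U V k (f : 'I_k -> U -> V) x v :
  (forall i, differentiable (f i) x) ->
  'd (fun y => \sum_(i < k) f i y) x v = \sum_(i < k) 'd (f i) x v.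
Proof.
move=> df; rewrite -deriveE; last exact: differentiable_bigsum.
under [RHS]eq_bigr do rewrite -deriveE//.
rewrite -derive_sum => [|i]; last exact: diff_derivable.
by congr ('D_v _ x); apply/funext => y; rewrite fct_sumE.
Qed.

Lemma differentiable_rV U n (f : U -> 'rV[R]_n) x :
  (forall j, differentiable (fun y => f y 0 j) x) -> differentiable f x.
Proof.
move=> df; have -> : f = (fun y => \sum_j f y 0 j *: delta_mx 0 j).
  by apply/funext => y; exact: row_sum_delta.
by apply: differentiable_bigsum => j; exact: differentiableZl.
Qed.

Lemma differentiable_times U (a b : U -> R) x :
  differentiable a x -> differentiable b x -> differentiable (fun y => a y * b y) x.
Proof. by move=> da db; have := differentiableM da db. Qed.

Lemma diff_times U (a b : U -> R) x v :
  differentiable a x -> differentiable b x ->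
  'd (fun y => a y * b y) x v = a x * 'd b x v + b x * 'd a x v.
Proof. by move=> da db; rewrite -[fun y => a y * b y]/(a * b) diffM. Qed.

Lemma differentiable_scale U n (a : U -> R) (b : U -> 'rV[R]_n) x :
  differentiable a x -> differentiable b x ->
  differentiable (fun y => a y *: b y) x.
Proof.
move=> da db; apply: differentiable_rV => j; under eq_fun do rewrite mxE.
by apply: differentiable_times => //; exact: differentiable_entry.
Qed.

Lemma diff_scale U n (a : U -> R) (b : U -> 'rV[R]_n) x v :
  differentiable a x -> differentiable b x ->
  'd (fun y => a y *: b y) x v = a x *: 'd b x v + 'd a x v *: b x.
Proof.
move=> da db; apply/rowP => j.
rewrite -diff_entry; last exact: differentiable_scale.
under eq_fun do rewrite mxE.
rewrite diff_times//; last exact: differentiable_entry.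
by rewrite diff_entry// !mxE [X in _ = _ + X]mulrC.
Qed.

Lemma differentiable_cscale U V (k : R) (f : U -> V) x :
  differentiable f x -> differentiable (fun y => k *: f y) x.
Proof. by move=> df; have := differentiableZ k df. Qed.

Lemma diff_cscale U V (k : R) (f : U -> V) x v :
  differentiable f x -> 'd (fun y => k *: f y) x v = k *: 'd f x v.
Proof. by move=> df; rewrite -[fun y => k *: f y]/(k *: f) diffZ. Qed.

Section DiffApply.
Context {U P : normedModType R} {n k : nat}.
Variables (m : P -> 'rV[R]_k) (h : U -> P) (F : U -> 'rV[R]_n).
Variables (j : {linear 'rV[R]_n -> P}) (x : U).
Hypothesis dm : forall v, differentiable (fun q => 'd m q v) (h x).
Hypotheses (dh : differentiable h x) (dF : differentiable F x).

Let applyE u : 'd m (h u) (j (F u)) =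
  \sum_(i < n) F u 0 i *: 'd m (h u) (j (delta_mx 0 i)).
Proof.
rewrite {1}(row_sum_delta (F u)) !linear_sum.
by apply: eq_bigr => i _; rewrite !linearZ.
Qed.

Let dcol i : differentiable (fun u => 'd m (h u) (j (delta_mx 0 i))) x.
Proof.
exact: (@differentiable_comp _ _ _ _ h (fun q => 'd m q (j (delta_mx 0 i)))).
Qed.

Lemma differentiable_apply : differentiable (fun u => 'd m (h u) (j (F u))) x.
Proof.
under eq_fun do rewrite applyE.
apply: differentiable_bigsum => i; apply: differentiable_scale => //.
exact: differentiable_entry.
Qed.

(** The product rule for a differential whose base point and argument both vary. Expanding [F] in
    the standard basis reduces it to differentials at fixed vectors, the only ones known to be
    differentiable in the base point. *)
Lemma diff_apply X : 'd (fun u => 'd m (h u) (j (F u))) x X =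
  'd m (h x) (j ('d F x X)) + 'd (fun q => 'd m q (j (F x))) (h x) ('d h x X).
Proof.
under eq_fun do rewrite applyE.
rewrite diff_bigsum => [|i]; last first.
  by apply: differentiable_scale => //; exact: differentiable_entry.
under eq_bigr => i _.
  rewrite diff_scale//; last exact: differentiable_entry.
  rewrite diff_entry//.
  rewrite (@diff_comp _ _ _ _ h (fun q => 'd m q (j (delta_mx 0 i))) x dh (dm _)) /=.
over.
rewrite big_split /= addrC; congr (_ + _).
  rewrite [in RHS](row_sum_delta ('d F x X)) !linear_sum.
  by apply: eq_bigr => i _; rewrite !linearZ.
have -> : (fun q => 'd m q (j (F x))) =
    (fun q => \sum_(i < n) F x 0 i *: 'd m q (j (delta_mx 0 i))).
  apply/funext => q; rewrite {1}(row_sum_delta (F x)) !linear_sum.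
  by apply: eq_bigr => i _; rewrite !linearZ.
symmetry; apply: etrans (@diff_bigsum P _ n
  (fun i q => F x 0 i *: 'd m q (j (delta_mx 0 i))) (h x) ('d h x X) _) _.
  by move=> i; apply: (@differentiable_cscale P _ _ (fun q => 'd m q (j (delta_mx 0 i)))).
apply: eq_bigr => i _.
exact: (@diff_cscale P _ _ (fun q => 'd m q (j (delta_mx 0 i)))).
Qed.

End DiffApply.

Section DiffBilinear.
Context {U : normedModType R} {n1 n2 k : nat}.
Variables (b : 'rV[R]_n1 -> 'rV[R]_n2 -> 'rV[R]_k).
Variables (F : U -> 'rV[R]_n1) (G : U -> 'rV[R]_n2) (x : U).
Hypothesis bl : forall w, linear (b^~ w).
Hypothesis br : forall v, linear (b v).
Hypotheses (dF : differentiable F x) (dG : differentiable G x).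

Let blE v w : b v w = \sum_(i < n1) v 0 i *: b (delta_mx 0 i) w.
Proof.
pose f : {linear _ -> _} := HB.pack (b^~ w) (GRing.isLinear.Build _ _ _ _ _ (bl w)).
rewrite {1}(row_sum_delta v) -[LHS]/(f _) linear_sum.
by apply: eq_bigr => i _; rewrite linearZ.
Qed.

Let brE v w : b v w = \sum_(i < n2) w 0 i *: b v (delta_mx 0 i).
Proof.
pose f : {linear _ -> _} := HB.pack (b v) (GRing.isLinear.Build _ _ _ _ _ (br v)).
rewrite {1}(row_sum_delta w) -[LHS]/(f _) linear_sum.
by apply: eq_bigr => i _; rewrite linearZ.
Qed.

Let dcolG v : differentiable (fun u => b v (G u)) x.
Proof.
under eq_fun do rewrite brE.
apply: differentiable_bigsum => i; apply: differentiable_scale => //.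
exact: differentiable_entry.
Qed.

Let diffG v Z : 'd (fun u => b v (G u)) x Z = b v ('d G x Z).
Proof.
under eq_fun do rewrite brE.
apply: etrans (@diff_bigsum _ _ _ (fun i u => G u 0 i *: b v (delta_mx 0 i)) _ _ _) _.
  move=> i; apply: differentiable_scale; last by [].
  exact: differentiable_entry.
rewrite [RHS]brE; apply: eq_bigr => i _.
apply: etrans (@diff_scale _ _ (fun u => G u 0 i) (cst (b v (delta_mx 0 i))) _ _ _ _) _ => //.
  exact: differentiable_entry.
by rewrite diff_cst scaler0 add0r diff_entry.
Qed.

Lemma differentiable_bilinear : differentiable (fun u => b (F u) (G u)) x.
Proof.
under eq_fun do rewrite blE.
apply: differentiable_bigsum => i; apply: differentiable_scale => //.
exact: differentiable_entry.
Qed.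

Lemma diff_bilinear Z : 'd (fun u => b (F u) (G u)) x Z =
  b ('d F x Z) (G x) + b (F x) ('d G x Z).
Proof.
under eq_fun do rewrite blE.
apply: etrans (@diff_bigsum _ _ _ (fun i u => F u 0 i *: b (delta_mx 0 i) (G u)) _ _ _) _.
  by move=> i; apply: differentiable_scale => //; exact: differentiable_entry.
rewrite [X in _ = X + _]blE [X in _ = _ + X]blE -big_split; apply: eq_bigr => i _.
apply: etrans (@diff_scale _ _ (fun u => F u 0 i) (fun u => b (delta_mx 0 i) (G u)) _ _ _ _) _ => //.
  exact: differentiable_entry.
by rewrite diffG diff_entry// addrC.
Qed.

End DiffBilinear.

End Calculus.

(** * Symmetry of second derivatives *)

Section Schwarz.
Context {R : realType} {U : normedModType R}.
Implicit Types (p v w : U) (f : U -> R).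

Lemma MVT_line f p v (h : R) : 0 <= h ->
  (forall s, 0 <= s <= h -> differentiable f (p + s *: v)) ->
  exists2 s, 0 <= s <= h &
    f (p + h *: v) - f p = 'd f (p + s *: v) v * h.
Proof.
move=> h0 df.
have dF s : 0 <= s <= h ->
    is_derive s 1 (fun s => f (p + s *: v)) ('d f (p + s *: v) v).
  by move=> /df; apply: is_derive_comp_diff; exact: diff_line.
have [s|//|s sh] := @MVT_segment R (fun s => f (p + s *: v))
    (fun s => 'd f (p + s *: v) v) 0 h h0.
- by rewrite in_itv /= => /andP[s0 sh]; apply: dF; rewrite !ltW.
- apply: derivable_within_continuous => s; rewrite in_itv /= => /dF.
  by case.
- by rewrite scale0r addr0 subr0 => ->; exists s => //; rewrite in_itv in sh.
Qed.

(** The mean value theorem twice: along [v] for the increment [f (q + h *: w) - f q], then along [w]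
    for the derivative of [f] in the direction [v]. *)
Lemma double_difference f p v w (h : R) : 0 <= h ->
  (forall s t, 0 <= s <= h -> 0 <= t <= h ->
    differentiable f (p + s *: v + t *: w)) ->
  (forall s t, 0 <= s <= h -> 0 <= t <= h ->
    differentiable (fun q => 'd f q v) (p + s *: v + t *: w)) ->
  exists s t, [/\ 0 <= s <= h, 0 <= t <= h &
    f (p + h *: v + h *: w) - f (p + h *: w) - f (p + h *: v) + f p =
      'd (fun q => 'd f q v) (p + s *: v + t *: w) w * (h * h)].
Proof.
move=> h0 df ddf.
have hh : 0 <= h <= h by apply/andP; split.
have h00 : 0 <= (0 : R) <= h by apply/andP; split.
pose phi q := f (q + h *: w) - f q.
have dsh s : 0 <= s <= h -> differentiable (fun q => f (q + h *: w)) (p + s *: v) /\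
  'd (fun q => f (q + h *: w)) (p + s *: v) v = 'd f (p + s *: v + h *: w) v.
  move=> sh; have dsh : is_diff (p + s *: v) (fun q => q + h *: w) id.
    have := is_diffD (is_diff_id (p + s *: v)) (is_diff_cst (h *: w) (p + s *: v)).
    by rewrite addr0.
  split; first by apply: differentiable_comp => //; exact: df.
  by rewrite (@diff_comp _ _ _ _ (fun q => q + h *: w) f) ?diff_val//; exact: df.
have dphi s : 0 <= s <= h -> differentiable phi (p + s *: v) /\
    'd phi (p + s *: v) v = 'd f (p + s *: v + h *: w) v - 'd f (p + s *: v) v.
  move=> sh; have [d1 d2] := dsh s sh.
  have d3 : differentiable f (p + s *: v).
    by have := df s 0 sh h00; rewrite scale0r addr0.
  split; first exact: differentiable_sub.
  by rewrite diff_sub// d2.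
have [s sh phiE] := MVT_line h0 (fun s sh => (dphi s sh).1).
have [t th psiE] := @MVT_line (fun q => 'd f q v) (p + s *: v) w h h0 (fun t th => ddf s t sh th).
exists s, t; split => //; rewrite mulrA -psiE -(dphi s sh).2 -phiE /phi; ring.
Qed.

Lemma near_square p v w (P : set U) : (\forall q \near p, P q) ->
  exists2 e : R, 0 < e & forall s t, 0 <= s <= e -> 0 <= t <= e ->
    P (p + s *: v + t *: w).
Proof.
move=> /nbhs_ballP[e /= e0 eP].
(* The summand 1 keeps [d] positive when [v] and [w] vanish. *)
pose d := `|v| + `|w| + 1.
have d0 : 0 < d by rewrite ltr_pwDr// addr_ge0.
exists (e / d / 2); first by rewrite !divr_gt0.
move=> s t /andP[s0 se] /andP[t0 te]; apply: eP.
rewrite -ball_normE /= opprD addrA opprD addrA subrr sub0r -opprD normrN.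
rewrite (le_lt_trans (ler_normD _ _))// !normrZ !ger0_norm//.
apply: (@le_lt_trans _ _ (e / d / 2 * d)).
  rewrite /d !mulrDr -[leLHS]addr0 lerD ?mulr1//; last by rewrite !divr_ge0// ltW.
  by rewrite lerD// ler_wpM2r.
rewrite mulrAC divfK ?gt_eqF// ltr_pdivrMr// ltr_pMr// ltr1n//.
Qed.

(** Both mixed derivatives, each at some point of a small square, equal the same second difference
    divided by [a * a]; continuity compares these values with those at [p]. *)
Lemma schwarz f p v w :
  (\forall q \near p, differentiable f q) ->
  (\forall q \near p, differentiable (fun q => 'd f q v) q) ->
  (\forall q \near p, differentiable (fun q => 'd f q w) q) ->
  {for p, continuous (fun q => 'd (fun q => 'd f q v) q w)} ->
  {for p, continuous (fun q => 'd (fun q => 'd f q w) q v)} ->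
  'd (fun q => 'd f q v) p w = 'd (fun q => 'd f q w) p v.
Proof.
move=> df dfv dfw cvw cwv; apply/eqP; rewrite -subr_eq0 -normr_le0.
apply/ler_addgt0Pl => e e0; rewrite addr0.
have e20 : 0 < e / 2 by rewrite divr_gt0.
have nvw : \forall q \near p, `|'d (fun q => 'd f q v) p w - 'd (fun q => 'd f q v) q w| < e / 2.
  by move/cvgrPdist_lt: cvw; exact.
have nwv : \forall q \near p, `|'d (fun q => 'd f q w) p v - 'd (fun q => 'd f q w) q v| < e / 2.
  by move/cvgrPdist_lt: cwv; exact.
have [a a0 H] := near_square v w (filterI (filterI df dfv) (filterI dfw (filterI nvw nwv))).
have [s [t [sa ta E1]]] : exists s t, [/\ 0 <= s <= a, 0 <= t <= a &
    f (p + a *: v + a *: w) - f (p + a *: w) - f (p + a *: v) + f p =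
      'd (fun q => 'd f q v) (p + s *: v + t *: w) w * (a * a)].
  apply: double_difference; first exact: ltW.
    by move=> s t sa ta; have [[]] := H s t sa ta.
  by move=> s t sa ta; have [[]] := H s t sa ta.
have [t' [s' [ta' sa' E2]]] : exists t s, [/\ 0 <= t <= a, 0 <= s <= a &
    f (p + a *: w + a *: v) - f (p + a *: v) - f (p + a *: w) + f p =
      'd (fun q => 'd f q w) (p + t *: w + s *: v) v * (a * a)].
  apply: double_difference; first exact: ltW.
    by move=> t' s' ta' sa'; rewrite addrAC; have [[]] := H s' t' sa' ta'.
  by move=> t' s' ta' sa'; rewrite addrAC; have [_ []] := H s' t' sa' ta'.
have E : 'd (fun q => 'd f q v) (p + s *: v + t *: w) w =
         'd (fun q => 'd f q w) (p + s' *: v + t' *: w) v.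
  apply: (@mulIf _ (a * a)); first by rewrite mulf_neq0// gt_eqF.
  by rewrite -E1 [p + s' *: v + _]addrAC -E2 [p + a *: w + _]addrAC; ring.
have [_ [_ [B1 _]]] := H s t sa ta.
have [_ [_ [_ B2]]] := H s' t' sa' ta'.
rewrite (splitr e) -[X in `|X|](subrKA ('d (fun q => 'd f q v) (p + s *: v + t *: w) w)).
rewrite (le_trans (ler_normD _ _))// lerD// ltW//.
by rewrite E distrC.
Qed.

Lemma schwarz_rV n (f : U -> 'rV[R]_n) p v w :
  (\forall q \near p, differentiable f q) ->
  (\forall q \near p, differentiable (fun q => 'd f q v) q) ->
  (\forall q \near p, differentiable (fun q => 'd f q w) q) ->
  {for p, continuous (fun q => 'd (fun q => 'd f q v) q w)} ->
  {for p, continuous (fun q => 'd (fun q => 'd f q w) q v)} ->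
  'd (fun q => 'd f q v) p w = 'd (fun q => 'd f q w) p v.
Proof.
move=> df dfv dfw cvw cwv; apply/rowP => j.
pose fj q := f q 0 j.
have dfj : \forall q \near p, differentiable fj q.
  by apply: filterS df => q; exact: differentiable_entry.
have E x : \forall q \near p, 'd f q x 0 j = 'd fj q x.
  by apply: filterS df => q dq; rewrite /fj diff_entry.
have D x : (\forall q \near p, differentiable (fun q => 'd f q x) q) ->
    \forall q \near p, differentiable (fun q => 'd fj q x) q /\
      forall y, 'd (fun q => 'd f q x) q y 0 j = 'd (fun q => 'd fj q x) q y.
  move=> dfx; apply: filterS2 (near_join (E x)) dfx => q Eq dq.
  have dqj := differentiable_entry 0 j dq.
  split; first exact: near_eq_differentiable Eq dqj.
  move=> y; apply: etrans (esym (diff_entry 0 j y dq)) _.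
  exact: (esym (congr1 (fun F => F y) (near_eq_diff Eq dqj))).
have C x y : (\forall q \near p, differentiable (fun q => 'd f q x) q) ->
    {for p, continuous (fun q => 'd (fun q => 'd f q x) q y)} ->
    {for p, continuous (fun q => 'd (fun q => 'd fj q x) q y)}.
  move=> dfx cxy.
  have Exy : \forall q \near p,
      'd (fun q => 'd f q x) q y 0 j = 'd (fun q => 'd fj q x) q y.
    by apply: filterS (D x dfx) => q [_].
  rewrite /prop_for /continuous_at -(nbhs_singleton Exy).
  apply: cvg_trans (near_eq_cvg Exy) _.
  apply: (@cvg_comp _ _ _ (fun q => 'd (fun q => 'd f q x) q y)
    (fun N : 'rV[R]_n => N 0 j) (nbhs p) (nbhs ('d (fun q => 'd f q x) p y))).
    exact: cxy.
  exact: coord_continuous.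
have [_ D1] := nbhs_singleton (D v dfv).
have [_ D2] := nbhs_singleton (D w dfw).
rewrite D1 D2; apply: schwarz => //.
- by apply: filterS (D v dfv) => q [].
- by apply: filterS (D w dfw) => q [].
- exact: C.
- exact: C.
Qed.

End Schwarz.

(** * The adjoint representation *)

Section AdjointRepresentation.
Context {R : realType} {n : nat} {G : lieGroupType R n}.

Lemma mulg_cvg (T : topologicalType) (t : T) (f h : T -> G) (a b : G) :
  f @ t --> a -> h @ t --> b -> (fun x => f x * h x)%g @ t --> (a * b)%g.
Proof.
move=> fa hb; have fhab := cvg_pair fa hb.
apply: (@cvg_comp _ _ _ (fun x => (f x, h x)) (fun p : G * G => (p.1 * p.2)%g) (nbhs t) (nbhs (a, b)) (nbhs (a * b)%g)); first exact: fhab.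
exact: (@lie_mul_continuous R n G (a, b)).
Qed.

Lemma cstg_cvg (T : topologicalType) (t : T) (a : G) : (fun=> a) @ t --> a.
Proof. exact: cvg_cst. Qed.

Lemma invg_cvg (T : topologicalType) (t : T) (f : T -> G) (a : G) :
  f @ t --> a -> (fun x => (f x)^-1)%g @ t --> (a^-1)%g.
Proof.
by move=> fa; exact: (cvg_comp _ _ fa (@lie_inv_continuous R n G a)).
Qed.

Lemma near_chart_dom (d : chart R n G) (T : topologicalType) (t : T)
    (f : T -> G) (a : G) :
  atlas d -> f @ t --> a -> chart_dom d a -> \forall x \near t, chart_dom d (f x).
Proof.
move=> /atlas_chart[od _ _ _ _] fa da.
by apply: fa; exact: open_nbhs_nbhs.
Qed.

Lemma chart_invK (d : chart R n G) x :
  atlas d -> chart_dom d x -> chart_inv d (d x) = x.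
Proof. by move=> /atlas_chart[_ _ + _ _]; exact. Qed.

Lemma chart_cod_dom (d : chart R n G) x :
  chart_dom d x -> chart_cod d (d x).
Proof. by exists x. Qed.

Lemma chart_inv_cvg (d : chart R n G) x :
  atlas d -> chart_dom d x -> chart_inv d @ d x --> x.
Proof.
move=> ad dx; rewrite -[X in _ --> X](@chart_invK d x ad dx).
by have [_ _ _ _] := atlas_chart _ ad; apply; exact: chart_cod_dom.
Qed.

Lemma mul_chart_differentiable (d1 d2 d : chart R n G) (x y : G) :
  atlas d1 -> atlas d2 -> atlas d ->
  chart_dom d1 x -> chart_dom d2 y -> chart_dom d (x * y)%g ->
  differentiable (fun p : 'rV[R]_n * 'rV[R]_n =>
    d (chart_inv d1 p.1 * chart_inv d2 p.2)%g) (d1 x, d2 y).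
Proof.
move=> a1 a2 a dx dy dxy.
have [/(_ (d1 x, d2 y)) + _] := lie_mul_smooth _ _ _ a1 a2 a 1%N; apply.
by split => /=; rewrite ?chart_invK//; exact: chart_cod_dom.
Qed.

Variable c : chart R n G.
Hypotheses (atlas_c : atlas c) (c1 : chart_dom c 1%g).
Local Notation e := (c 1%g).
Local Notation cinv := (chart_inv c).
Local Notation V := 'rV[R]_n.

Let conj_chart (g : G) (u : V) : V := c (g * cinv u * g^-1)%g.

Lemma conj_cvg (g : G) : (fun u => g * cinv u * g^-1)%g @ e --> (1 : G)%g.
Proof.
rewrite -[X in _ --> X](mulgV g) -[X in _ --> (X * _)%g](mulg1 g).
apply: (@mulg_cvg _ _ (fun u => g * cinv u)%g (fun=> g^-1%g)).
  apply: (@mulg_cvg _ _ (fun=> g) cinv).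
    exact: cstg_cvg.
  exact: (@chart_inv_cvg c 1%g atlas_c c1).
exact: cstg_cvg.
Qed.

Lemma near_conj_dom (g : G) : \forall u \near e, chart_dom c (g * cinv u * g^-1)%g.
Proof. exact: near_chart_dom (conj_cvg g) c1. Qed.

Lemma conj_chart1 (g : G) : conj_chart g e = e.
Proof. by rewrite /conj_chart chart_invK// mulg1 mulgV. Qed.

(** Neither [g] nor its inverse need lie in the domain of [c]. The conjugation is a left translation
    into a chart around [g], followed by a right translation read with a chart around the
    inverse. *)
Lemma conj_differentiable (g : G) : differentiable (conj_chart g) e.
Proof.
have [d ad dg] := @atlas_cover R n G g.
have [d' ad' dg'] := @atlas_cover R n G g^-1%g.
pose L u := d (chart_inv d (d g) * cinv u)%g.
have L1 : L e = d g by rewrite /L !chart_invK// mulg1.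
have dL : differentiable L e.
  have := @mul_chart_differentiable d c d g 1%g ad atlas_c ad dg c1.
  rewrite mulg1 => /(_ dg) dm.
  have dp : differentiable (fun u : V => (d g, u)) e.
    by apply: differentiable_pair.
  exact: differentiable_comp dp dm.
have := @mul_chart_differentiable d d' c g g^-1%g ad ad' atlas_c dg dg'.
rewrite mulgV => /(_ c1); rewrite -L1 => dm.
have dp : differentiable (fun u : V => (L u, d' g^-1%g)) e.
  by apply: differentiable_pair.
have := differentiable_comp dp dm; apply: near_eq_differentiable.
have : \forall u \near e, chart_dom d (g * cinv u)%g.
  apply: near_chart_dom ad _ dg; rewrite -[X in _ --> X](mulg1 g).
  apply: (@mulg_cvg _ _ (fun=> g) cinv).
    exact: cstg_cvg.
  exact: (@chart_inv_cvg c 1%g atlas_c c1).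
apply: filterS => u du.
by rewrite /conj_chart /= /L !chart_invK.
Qed.

Lemma near_conj_comp (g h : G) :
  \forall u \near e, conj_chart g (conj_chart h u) = conj_chart (g * h)%g u.
Proof.
apply: filterS (near_conj_dom h) => u du.
by rewrite /conj_chart chart_invK// invgM !mulgA.
Qed.

Lemma Ad_mul (g h : G) v : Ad c (g * h)%g v = Ad c g (Ad c h v).
Proof.
have dh := conj_differentiable h.
have dg : differentiable (conj_chart g) (conj_chart h e).
  by rewrite conj_chart1; exact: conj_differentiable.
have E1 := near_eq_diff (near_conj_comp g h) (differentiable_comp dh dg).
have E2 := @diff_comp _ _ _ _ (conj_chart h) (conj_chart g) e dh dg.
have E3 x w : x = e -> 'd (conj_chart g) x w = 'd (conj_chart g) e w.
  by move=> ->.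
exact: (etrans (congr1 (fun F => F v) E1) (etrans (congr1 (fun F => F v) E2) (E3 _ _ (conj_chart1 h)))).
Qed.

Lemma Ad1 v : Ad c 1%g v = v.
Proof.
have : \forall u \near e, u = conj_chart 1%g u.
  have : \forall u \near e, chart_cod c u.
    have [_ oc _ _ _] := atlas_chart _ atlas_c.
    by apply: open_nbhs_nbhs; split => //; exact: chart_cod_dom.
  apply: filterS => u [x dx <-].
  by rewrite /conj_chart chart_invK// mul1g invg1 mulg1.
move=> ne; have di : differentiable (id : V -> V) e by [].
have E := congr1 (fun F => F v) (near_eq_diff ne di).
by apply: (etrans E); rewrite diff_val.
Qed.

Lemma AdK (g : G) v : Ad c g^-1%g (Ad c g v) = v.
Proof. by rewrite -Ad_mul mulVg Ad1. Qed.

Let mu (p : V * V) : V := c (cinv p.1 * cinv p.2)%g.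
Let iota (u : V) : V := c (cinv u)^-1%g.

Let A : set (V * V) := [set p : V * V |
  [/\ chart_cod c p.1, chart_cod c p.2 & chart_dom c (cinv p.1 * cinv p.2)%g]].

Lemma mu_smooth k : Ck k A mu.
Proof. exact: lie_mul_smooth. Qed.

Lemma cinv_e : cinv e = 1%g.
Proof. exact: chart_invK. Qed.

Lemma near_cod : \forall u \near e, chart_cod c u.
Proof.
have [_ oc _ _ _] := atlas_chart _ atlas_c.
by apply: open_nbhs_nbhs; split => //; exact: chart_cod_dom.
Qed.

Lemma near_A : \forall p \near (e, e), A p.
Proof.
have n1 : \forall p \near (e, e), chart_cod c p.1.
  by apply: (@cvg_fst _ _ (nbhs e) (nbhs e)); exact: near_cod.
have n2 : \forall p \near (e, e), chart_cod c p.2.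
  by apply: (@cvg_snd _ _ (nbhs e) (nbhs e)); exact: near_cod.
have n3 : \forall p \near (e, e), chart_dom c (cinv p.1 * cinv p.2)%g.
  apply: near_chart_dom atlas_c _ c1.
  rewrite -[X in _ --> X](mulg1 1%g).
  apply: (@mulg_cvg _ _ (fun p => cinv p.1) (fun p => cinv p.2)).
    by apply: (@cvg_comp _ _ _ fst cinv (nbhs (e, e)) (nbhs e));
      [exact: cvg_fst | exact: (@chart_inv_cvg c 1%g atlas_c c1)].
  by apply: (@cvg_comp _ _ _ snd cinv (nbhs (e, e)) (nbhs e));
    [exact: cvg_snd | exact: (@chart_inv_cvg c 1%g atlas_c c1)].
by apply: filterS2 n1 (filterI n2 n3) => p ? [].
Qed.

Lemma iota_e : iota e = e.
Proof. by rewrite /iota cinv_e invg1. Qed.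

Lemma iota_differentiable : differentiable iota e.
Proof.
have [/(_ e) + _] := lie_inv_smooth _ _ atlas_c atlas_c 1%N; apply.
by split; [exact: chart_cod_dom | rewrite cinv_e invg1].
Qed.

Lemma mu_differentiable p : A p -> differentiable mu p.
Proof. by have [dm _] := mu_smooth 1; exact: dm. Qed.

Lemma dmu_differentiable v p : A p -> differentiable (fun q => 'd mu q v) p.
Proof. by have [_ /(_ v)[dm _]] := mu_smooth 2; exact: dm. Qed.

Lemma ddmu_continuous v w p : A p ->
  {for p, continuous (fun q => 'd (fun q => 'd mu q v) q w)}.
Proof. by have [_ /(_ v)[_ /(_ w)]] := mu_smooth 2; exact. Qed.

Lemma chart_invl u : chart_cod c u -> c (cinv u) = u.
Proof. by move=> [x dx <-]; rewrite chart_invK. Qed.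

Lemma chart_inv_dom u : chart_cod c u -> chart_dom c (cinv u).
Proof. by move=> [x dx <-]; rewrite chart_invK. Qed.

Lemma A_le u : chart_cod c u -> A (u, e).
Proof.
move=> cu; split => //=; first exact: chart_cod_dom.
by rewrite cinv_e mulg1; exact: chart_inv_dom.
Qed.

Lemma A_er u : chart_cod c u -> A (e, u).
Proof.
move=> cu; split => //=; first exact: chart_cod_dom.
by rewrite cinv_e mul1g; exact: chart_inv_dom.
Qed.

Lemma mu_le u : chart_cod c u -> mu (u, e) = u.
Proof. by move=> cu; rewrite /mu /= cinv_e mulg1 chart_invl. Qed.

(** Differentiate [g w = (g w g^-1) g] in [w] at the identity, with [g = cinv u]. *)
Lemma Ad_translate u Y : chart_cod c u ->
  'd mu (u, e) (pairr Y) = 'd mu (e, u) (pairl (Ad c (cinv u) Y)).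
Proof.
move=> cu.
have d1 : is_diff e (fun w : V => (u, w)) (@pairr R V) by exact: is_diff_pair_cstl.
have d2 : is_diff e (fun w : V => (w, u)) (@pairl R V) by exact: is_diff_pair_cstr.
have m1 := mu_differentiable (A_le cu).
have m2 := mu_differentiable (A_er cu).
have L : 'd (fun w => mu (u, w)) e Y = 'd mu (u, e) (pairr Y).
  by rewrite (diff_chain Y (ex_diff (is_diff_def := d1)) erefl m1) (diff_val (is_diff_def := d1)).
have d3 : differentiable (fun w => (conj_chart (cinv u) w, u)) e.
  exact: differentiable_chain (conj_differentiable (cinv u)) (conj_chart1 _) (ex_diff (is_diff_def := d2)).
have Rr : 'd (fun w => mu (conj_chart (cinv u) w, u)) e Y =
    'd mu (e, u) (pairl (Ad c (cinv u) Y)).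
  apply: etrans (diff_chain Y d3 (congr1 (fun x => (x, u)) (conj_chart1 _)) m2) _.
  congr ('d mu (e, u) _).
  apply: etrans (diff_chain Y (conj_differentiable (cinv u)) (conj_chart1 _) (ex_diff (is_diff_def := d2))) _.
  exact: (congr1 (fun F => F _) (diff_val (is_diff_def := d2))).
apply: etrans (esym L) (etrans _ Rr).
have ne : \forall w \near e, mu (conj_chart (cinv u) w, u) = mu (u, w).
  apply: filterS (near_conj_dom (cinv u)) => w dw.
  by rewrite /mu /= /conj_chart chart_invK// mulgVK.
have dm : differentiable (fun w => mu (conj_chart (cinv u) w, u)) e.
  exact: differentiable_chain d3 (congr1 (fun x => (x, u)) (conj_chart1 _)) m2.
exact: (congr1 (fun F => F Y) (near_eq_diff ne dm)).
Qed.

Lemma near_inv_dom : \forall u \near e, chart_dom c (cinv u)^-1%g.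
Proof.
apply: near_chart_dom atlas_c _ c1; rewrite -[X in _ --> X]invg1.
apply: (@invg_cvg _ _ cinv); exact: (@chart_inv_cvg c 1%g atlas_c c1).
Qed.

Lemma A_iota u : chart_cod c u -> chart_dom c (cinv u)^-1%g -> A (u, iota u).
Proof.
move=> cu du; split => //=; first exact: chart_cod_dom.
by rewrite /iota chart_invK// mulgV.
Qed.

Lemma dmu_r_E u Y : chart_cod c u ->
  'd (fun w => mu (u, w)) e Y = 'd mu (u, e) (pairr Y).
Proof.
move=> cu; have d1 : is_diff e (fun w : V => (u, w)) (@pairr R V) by exact: is_diff_pair_cstl.
apply: etrans (diff_chain Y (ex_diff (is_diff_def := d1)) erefl (mu_differentiable (A_le cu))) _.
by rewrite (diff_val (is_diff_def := d1)).
Qed.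

Lemma mu_r_differentiable u : chart_cod c u -> differentiable (fun w => mu (u, w)) e.
Proof.
move=> cu; have d1 : is_diff e (fun w : V => (u, w)) (@pairr R V) by exact: is_diff_pair_cstl.
exact: differentiable_chain (ex_diff (is_diff_def := d1)) erefl (mu_differentiable (A_le cu)).
Qed.

(** Here the conjugation is read as [(g w) g^-1], with [g = cinv u]. The right-hand side depends on
    [u] only through differentials of [mu] and through [iota], so it can be differentiated in
    [u]. *)
Lemma Ad_factor Y u : chart_cod c u -> chart_dom c (cinv u)^-1%g ->
  Ad c (cinv u) Y = 'd mu (u, iota u) (pairl ('d mu (u, e) (pairr Y))).
Proof.
move=> cu du.
have d2 : is_diff (mu (u, e)) (fun w : V => (w, iota u)) (@pairl R V) by exact: is_diff_pair_cstr.
have m1 := mu_differentiable (A_iota cu du).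
have d3 : differentiable (fun w => (mu (u, w), iota u)) e.
  exact: differentiable_chain (mu_r_differentiable cu) erefl (ex_diff (is_diff_def := d2)).
have p3 : (mu (u, e), iota u) = (u, iota u) by rewrite mu_le.
have ne : \forall w \near e, mu (mu (u, w), iota u) = conj_chart (cinv u) w.
  have nd : \forall w \near e, chart_dom c (cinv u * cinv w)%g.
    apply: near_chart_dom atlas_c _ (chart_inv_dom cu).
    rewrite -[X in _ --> X]mulg1.
    apply: (@mulg_cvg _ _ (fun=> cinv u) cinv); first exact: cstg_cvg.
    exact: (@chart_inv_cvg c 1%g atlas_c c1).
  apply: filterS nd => w dw.
  by rewrite /mu /iota /conj_chart /= !chart_invK.
apply: etrans (congr1 (fun F => F Y) (near_eq_diff ne (differentiable_chain d3 p3 m1))) _.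
apply: etrans (diff_chain Y d3 p3 m1) _; congr ('d mu (u, iota u) _).
apply: etrans (diff_chain Y (mu_r_differentiable cu) erefl (ex_diff (is_diff_def := d2))) _.
apply: etrans (congr1 (fun F => F _) (diff_val (is_diff_def := d2))) _.
by congr pairl; exact: dmu_r_E.
Qed.

Lemma Ad_chart_differentiable Y : differentiable (fun u => Ad c (cinv u) Y) e.
Proof.
have Aee : A (e, e) by exact: A_le (chart_cod_dom c1).
have Aei : A (e, iota e) by rewrite iota_e.
have dG : differentiable (fun u => 'd mu (u, e) (pairr Y)) e.
  have d1 : is_diff e (fun w : V => (w, e)) (@pairl R V) by exact: is_diff_pair_cstr.
  exact: (@differentiable_chain _ _ _ _ _ (fun q => 'd mu q (pairr Y)) _ _
    (ex_diff (is_diff_def := d1)) erefl (dmu_differentiable _ Aee)).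
have dh : differentiable (fun u => (u, iota u)) e.
  by apply: differentiable_pair; last exact: iota_differentiable.
have := @differentiable_apply R V (V * V)%type n n mu (fun u => (u, iota u))
  (fun u => 'd mu (u, e) (pairr Y)) (@pairl R V) e
  (fun v => dmu_differentiable v Aei) dh dG.
apply: near_eq_differentiable; apply: filterS2 near_cod near_inv_dom => u cu du.
by rewrite -Ad_factor.
Qed.

(** Differentiating [Ad_translate] in [u] at the identity: by [diff_apply] its right-hand side
    yields the bracket and one second derivative of the multiplication, its left-hand side the
    other. *)
Lemma bracketE X Y : bracket c X Y =
  'd (fun q => 'd mu q (pairr Y)) (e, e) (pairl X) -
  'd (fun q => 'd mu q (pairl Y)) (e, e) (pairr X).
Proof.
have Aee : A (e, e) by exact: A_le (chart_cod_dom c1).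
have d1 : is_diff e (fun w : V => (w, e)) (@pairl R V) by exact: is_diff_pair_cstr.
have d2 : is_diff e (fun w : V => (e, w)) (@pairr R V) by exact: is_diff_pair_cstl.
have dA := Ad_chart_differentiable Y.
have Er := @diff_apply R V (V * V)%type n n mu (fun u => (e, u))
  (fun u => Ad c (cinv u) Y) (@pairl R V) e (fun v => dmu_differentiable v Aee)
  (ex_diff (is_diff_def := d2)) dA X.
have El : 'd (fun u => 'd mu (u, e) (pairr Y)) e X =
    'd (fun q => 'd mu q (pairr Y)) (e, e) (pairl X).
  apply: etrans (@diff_chain _ _ _ _ _ (fun q => 'd mu q (pairr Y)) _ _ X
    (ex_diff (is_diff_def := d1)) erefl (dmu_differentiable _ Aee)) _.
  by rewrite (diff_val (is_diff_def := d1)).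
have dr : differentiable (fun u => 'd mu (e, u) (pairl (Ad c (cinv u) Y))) e :=
  @differentiable_apply R V (V * V)%type n n mu (fun u => (e, u))
  (fun u => Ad c (cinv u) Y) (@pairl R V) e (fun v => dmu_differentiable v Aee)
  (ex_diff (is_diff_def := d2)) dA.
have ne : \forall u \near e, 'd mu (e, u) (pairl (Ad c (cinv u) Y)) = 'd mu (u, e) (pairr Y).
  by apply: filterS near_cod => u cu; exact: esym (Ad_translate Y cu).
have Elr : 'd (fun u => 'd mu (u, e) (pairr Y)) e X =
    'd (fun u => 'd mu (e, u) (pairl (Ad c (cinv u) Y))) e X.
  apply: (congr1 (fun F : V -> V => F X)).
  exact: (@near_eq_diff R V V (fun u => 'd mu (e, u) (pairl (Ad c (cinv u) Y)))
    (fun u => 'd mu (u, e) (pairr Y)) e ne dr).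
have muee Z : 'd mu (e, e) (pairl Z) = Z.
  have ni : \forall w \near e, mu (w, e) = w.
    by apply: filterS near_cod => u; exact: mu_le.
  have di : differentiable (fun w => mu (w, e)) e.
    exact: differentiable_chain (ex_diff (is_diff_def := d1)) erefl (mu_differentiable Aee).
  have E1 := diff_chain Z (ex_diff (is_diff_def := d1)) erefl (mu_differentiable Aee).
  have ni' : \forall w \near e, w = mu (w, e) by apply: filterS ni => w ->.
  have E2 := congr1 (fun F => F Z) (near_eq_diff ni' (@ex_diff _ _ _ _ _ _ _ (is_diff_id e))).
  have E3 : 'd (fun w : V => w) e Z = Z.
    exact: (congr1 (fun F => F Z) (@diff_val _ _ _ _ _ _ _ (is_diff_id e))).
  have E4 := congr1 (fun F => F Z) (diff_val (is_diff_def := d1)).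
  have E5 := congr1 ('d mu (e, e)) E4.
  exact: etrans (esym E5) (etrans (esym E1) (etrans E2 E3)).
have E6 := etrans (esym Er) (etrans (esym Elr) El).
have E7 := congr1 (fun F => F X) (diff_val (is_diff_def := d2)).
have E8 : Ad c (cinv e) Y = Y by rewrite cinv_e Ad1.
have E9 : 'd (fun q => 'd mu q (pairl (Ad c (cinv e) Y))) (e, e) ('d (fun u => (e, u)) e X) =
    'd (fun q => 'd mu q (pairl Y)) (e, e) (pairr X).
  apply: etrans (congr1 ('d (fun q => 'd mu q (pairl (Ad c (cinv e) Y))) (e, e)) E7) _.
  exact: (congr1 (fun Z => 'd (fun q => 'd mu q (pairl Z)) (e, e) (pairr X)) E8).
have E10 : bracket c X Y + 'd (fun q => 'd mu q (pairl Y)) (e, e) (pairr X) =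
    'd (fun q => 'd mu q (pairr Y)) (e, e) (pairl X).
  exact: etrans (esym (congr2 +%R (muee _) E9)) E6.
have sub_r (a b l : V) : a + b = l -> a = l - b by move=> <-; rewrite addrK.
exact: sub_r E10.
Qed.

(** Exchanging [X] and [Y] in [bracketE] exchanges the two terms, by the symmetry of the second
    derivative of the multiplication. *)
Lemma bracket_asym X Y : bracket c X Y = - bracket c Y X.
Proof.
have nd : \forall q \near (e, e), differentiable mu q.
  by apply: filterS near_A; exact: mu_differentiable.
have ndd v : \forall q \near (e, e), differentiable (fun q => 'd mu q v) q.
  by apply: filterS near_A; exact: dmu_differentiable.
have Aee : A (e, e) by exact: A_le (chart_cod_dom c1).
have S v w : 'd (fun q => 'd mu q v) (e, e) w = 'd (fun q => 'd mu q w) (e, e) v.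
  by apply: schwarz_rV => //; exact: ddmu_continuous.
have skew (x y p q p' q' : V) : x = p - q -> y = p' - q' -> p = q' -> q = p' -> x = - y.
  by move=> -> -> -> ->; rewrite opprB.
exact: skew (bracketE X Y) (bracketE Y X) (S _ _) (S _ _).
Qed.

End AdjointRepresentation.

(** * Lie algebra axioms for the bracket *)

Section LieAlgebra.
Context {R : realType} {n : nat} {G : lieGroupType R n}.
Variable c : chart R n G.
Hypotheses (atlas_c : atlas c) (c1 : chart_dom c 1%g).
Local Notation e := (c 1%g).
Local Notation cinv := (chart_inv c).
Local Notation V := 'rV[R]_n.

Lemma bracket_linearl Y : linear ((bracket c)^~ Y).
Proof. exact: (linearP ('d (fun u => Ad c (cinv u) Y) e)). Qed.

Lemma bracket_linearr X : linear (bracket c X).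
Proof.
move=> a Y Y'.
have lin (x y z x' y' z' : V) : x = - x' -> y = - y' -> z = - z' ->
    x' = a *: y' + z' -> x = a *: y + z.
  by move=> -> -> -> ->; rewrite opprD scalerN.
exact: lin (bracket_asym atlas_c c1 _ _) (bracket_asym atlas_c c1 _ _)
  (bracket_asym atlas_c c1 _ _) (bracket_linearl _ _ _ _).
Qed.

Lemma Ad_continuous g : continuous (Ad c g).
Proof. exact: diff_continuous (conj_differentiable atlas_c c1 g). Qed.

(** Differentiate [Ad g (Ad x Y) = Ad (g x g^-1) (Ad g Y)] in [x] at the identity in the direction
    [X]. *)
Lemma Ad_bracket g X Y :
  Ad c g (bracket c X Y) = bracket c (Ad c g X) (Ad c g Y).
Proof.
pose k u := c (g * cinv u * g^-1)%g.
pose A Z u := Ad c (cinv u) Z.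
have dk : differentiable k e := conj_differentiable atlas_c c1 g.
have ke : k e = e := conj_chart1 atlas_c c1 g.
have dA Z : differentiable (A Z) e := Ad_chart_differentiable atlas_c c1 Z.
have dg : differentiable (Ad c g) (A Y e).
  exact/linear_differentiable/Ad_continuous.
have ne : \forall u \near e, Ad c g (A Y u) = A (Ad c g Y) (k u).
  apply: filterS (near_conj_dom atlas_c c1 g) => u du.
  have kE : cinv (k u) = (g * cinv u * g^-1)%g by exact: chart_invK.
  have E : (g * cinv u = g * cinv u * g^-1 * g)%g by rewrite mulgVK.
  apply: etrans (esym (Ad_mul atlas_c c1 g (cinv u) Y)) _.
  apply: etrans (congr1 (fun x => Ad c x Y) E) _.
  apply: etrans (Ad_mul atlas_c c1 _ g Y) _.
  exact: (congr1 (fun x => Ad c x (Ad c g Y)) (esym kE)).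
have El := diff_chain X (dA Y) erefl dg.
have Er := diff_chain X dk ke (dA (Ad c g Y)).
have Elr := congr1 (fun F => F X) (near_eq_diff ne (differentiable_chain (dA Y) erefl dg)).
have Eg : 'd (Ad c g) (A Y e) ('d (A Y) e X) = Ad c g ('d (A Y) e X).
  exact: (congr1 (fun F : V -> V => F _) (diff_lin (A Y e) (@Ad_continuous g))).
have E5 : Ad c g ('d (A Y) e X) = 'd (A (Ad c g Y)) e ('d k e X).
  apply: etrans (esym Eg) _; apply: etrans (esym El) _.
  by apply: etrans (esym Elr) _; exact: Er.
exact: E5.
Qed.

(** The derivative in the direction [Z] of the fact that every [Ad x] preserves the bracket. *)
Lemma bracket_jacobi Z X Y : bracket c Z (bracket c X Y) =
  bracket c (bracket c Z X) Y + bracket c X (bracket c Z Y).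
Proof.
pose A W u := Ad c (cinv u) W.
have dA W : differentiable (A W) e := Ad_chart_differentiable atlas_c c1 W.
have Ae W : A W e = W by rewrite /A (cinv_e atlas_c c1) (Ad1 atlas_c c1).
have E1 := diff_bilinear bracket_linearl bracket_linearr (dA X) (dA Y) Z.
have E2 : A (bracket c X Y) = fun u => bracket c (A X u) (A Y u).
  by apply/funext => u; exact: Ad_bracket.
have E3 : bracket c (bracket c Z X) (A Y e) + bracket c (A X e) (bracket c Z Y) =
  bracket c (bracket c Z X) Y + bracket c X (bracket c Z Y) by rewrite !Ae.
have E4 := congr1 (fun f => 'd f e Z) E2.
exact: etrans E4 (etrans E1 E3).
Qed.

Lemma Ad_curve (gamma : R -> G) X Y :
  continuous gamma -> gamma 0 = 1%g -> is_derive (0 : R) 1 (fun t => c (gamma t)) X ->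
  is_derive (0 : R) 1 (fun t => Ad c (gamma t) Y) (bracket c X Y).
Proof.
move=> cg g0 dg.
have dA : differentiable (fun u => Ad c (cinv u) Y) (c (gamma 0)).
  by rewrite g0; exact: (Ad_chart_differentiable atlas_c c1 Y).
have E := is_derive_comp_diff dg dA.
have E' : is_derive (0 : R) 1 ((fun u => Ad c (cinv u) Y) \o (fun t => c (gamma t))) (bracket c X Y).
  by move: E; rewrite g0.
apply: near_eq_is_derive E'.
have nd : \forall t \near (0 : R), chart_dom c (gamma t).
  by apply: near_chart_dom atlas_c (cg 0) _; rewrite g0.
by apply: filterS nd => t dt /=; rewrite chart_invK.
Qed.

End LieAlgebra.

(** * One-parameter subgroups *)

Section OneParameter.
Context {R : realType}.

(** The interval leaves room for sums of two parameters between -1 and 1. *)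
Lemma local_antiderivative (f : R -> R) : continuous f ->
  exists F : R -> R, forall x : R, -2 < x < 2 -> is_derive x 1 F (f x).
Proof.
move=> cf; pose F x := (\int[lebesgue_measure]_(t in [set` `[(-2 : R), x]]) (f t))%R.
exists F => x /andP[x2 x2'].
have fi : lebesgue_measure.-integrable `[(-2 : R), 2] (EFin \o f).
  apply: continuous_compact_integrable; first exact: segment_compact.
  exact: continuous_subspaceT.
have [d1 d2] := @continuous_FTC1_closed R f (-2) x 2 x2' fi x2 (cf x).
exact: (DeriveDef d1 (etrans (esym (derive1E F x)) d2)).
Qed.

Lemma is_derive_translate (f : R -> R) (s t d : R) :
  is_derive (s + t) 1 f d -> is_derive t 1 (fun u => f (s + u)) d.
Proof.
move=> [df dE].
have d0 : is_derive t 1 (fun u : R => s + u) (0 + 1) by exact: is_deriveD.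
have dfd : differentiable f (s + t) by exact/derivable1_diffP.
have E : 'D_1 f (s + t) = 'd f (s + t) 1 by rewrite deriveE.
have E1 : 'd f (s + t) (0 + 1) = d by rewrite add0r -E.
exact: is_derive_eq (is_derive_comp_diff d0 dfd) E1.
Qed.

(** If [v] is in the kernel and its coordinate [i] is the largest in absolute value, the kernel
    equation at [i] gives [|v_i| <= |v_i| / 2]. *)
Lemma near_identity_unit r (M : 'M[R]_r) :
  (forall i j, `|M i j - (i == j)%:R| * (2 * r%:R) <= 1) -> M \in unitmx.
Proof.
move=> HM; rewrite -row_free_unit -kermx_eq0; apply/rowV0P => v /sub_kermxP vM.
apply/eqP/contraT => v0.
have [i0 vi0] : exists i, v 0 i != 0.
  apply/existsP; move: v0; apply: contraR; rewrite negb_exists => /forallP H.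
  by apply/eqP/rowP => i; have /negPn/eqP := H i; rewrite mxE.
have [i _ imax] : exists2 i, true & forall j, `|v 0 j| <= `|v 0 i|.
  have := @Order.TotalTheory.arg_maxP _ _ _ i0 xpredT (fun j => `|v 0 j|) isT.
  by case=> i _ H; exists i => // j; exact: H.
have vi : 0 < `|v 0 i| by apply: lt_le_trans (imax i0); rewrite normr_gt0.
have r0 : 0 < r%:R :> R by rewrite ltr0n; exact: leq_ltn_trans (leq0n _) (ltn_ord i).
have : v 0 i = - \sum_j v 0 j * (M j i - (j == i)%:R).
  have := congr1 (fun w : 'rV_r => w 0 i) vM; rewrite !mxE => vMi.
  under eq_bigr do rewrite mulrBr; rewrite sumrB vMi sub0r opprK.
  rewrite (bigD1 i)//= eqxx mulr1 big1 ?addr0// => j /negPf ->.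
  by rewrite mulr0.
move=> /(congr1 (fun x => `|x|)); rewrite normrN => E.
have : `|v 0 i| <= `|v 0 i| / 2.
  rewrite {1}E (le_trans (ler_norm_sum _ _ _))//.
  apply: (@le_trans _ _ (\sum_(j < r) (`|v 0 i| / (2 * r%:R)))).
    apply: ler_sum => j _; rewrite normrM ler_pM//.
    by rewrite -[leRHS]mul1r ler_pdivlMr ?mulr_gt0.
  rewrite sumr_const card_ord -[leLHS]mulr_natr.
  have -> // : `|v 0 i| / (2 * r%:R) * r%:R = `|v 0 i| / 2.
  by field; rewrite gt_eqF.
by rewrite leNgt ltr_pdivrMr// ltr_pMr// ltr1n.
Qed.

(** With an antiderivative [Q] of [P], integration of [P (s + t) = P s *m P t] gives
    [P s *m (Q a - Q 0) = Q (s + a) - Q s]. For small [a] the matrix [Q a - Q 0] is invertible, so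
    [P] is as differentiable as [Q]. *)
Lemma one_parameter_derivable r (P : R -> 'M[R]_r) :
  continuous P -> P 0 = 1%:M -> (forall s t, P (s + t) = P s *m P t) ->
  derivable P (0 : R) 1.
Proof.
move=> cP P0 PD.
have cPij i j : continuous (fun t => P t i j).
  move=> t; apply: (@cvg_comp _ _ _ P (fun N : 'M[R]_r => N i j) (nbhs t) (nbhs (P t))).
    exact: cP.
  exact: coord_continuous.
have [Q Qd] : exists Q : R -> 'M[R]_r, forall i j (x : R), -2 < x < 2 ->
    is_derive x 1 (fun t => Q t i j) (P x i j).
  have /choice[Q Qd] ij := @local_antiderivative _ (cPij ij.1 ij.2).
  exists (fun t => \matrix_(i, j) Q (i, j) t) => i j x xb.
  by under eq_fun do rewrite mxE; exact: (Qd (i, j)).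
have QE (s a : R) : -1 < s < 1 -> 0 < a < 1 -> P s *m (Q a - Q 0) = Q (s + a) - Q s.
  move=> /andP[s1 s2] /andP[a0 a1]; apply/matrixP => i j.
  (* Its derivative is an entry of [P (s + t) - P s *m P t], that is, zero. *)
  pose g t := Q (s + t) i j - \sum_k P s i k * Q t k j.
  have dg (t : R) : -1 < t < 1 -> is_derive t 1 g 0.
    move=> /andP[t1 t2].
    have d1 : is_derive t 1 (fun t => Q (s + t) i j) (P (s + t) i j).
      apply: (@is_derive_translate (fun u => Q u i j)); apply: Qd.
      by apply/andP; split; lra.
    have tb : -2 < t < 2 by apply/andP; split; lra.
    have d2 : is_derive t 1 (\sum_(k < r) (fun t => P s i k * Q t k j)) (\sum_k P s i k * P t k j).
      apply: is_derive_sum => k.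
      have dQ := Qd k j t tb.
      exact: (@is_deriveZ R R R (fun t => Q t k j) (P s i k) t 1 (P t k j)).
    have -> : g = (fun t => Q (s + t) i j) - (\sum_(k < r) (fun t => P s i k * Q t k j)).
      by apply/funext => u; rewrite /g fctE fct_sumE.
    have -> : 0 = P (s + t) i j - \sum_k P s i k * P t k j.
      by rewrite PD mxE subrr.
    exact: is_deriveB.
  have [t||t _] := @MVT_segment R g (fun=> 0) 0 a (ltW a0).
  - by rewrite in_itv /= => /andP[t0 ta]; apply: dg; apply/andP; split; lra.
  - apply: derivable_within_continuous => t; rewrite in_itv /= => /andP[t0 ta].
    by have [] : is_derive t 1 g 0 by apply: dg; apply/andP; split; lra.
  - rewrite mul0r => /eqP; rewrite subr_eq0 /g addr0 => /eqP E.
    rewrite !mxE; under eq_bigr do rewrite !mxE mulrBr; rewrite sumrB.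
    by move: E; lra.
have [a /andP[a0 a1] aU] : exists2 a : R, 0 < a < 1 & (Q a - Q 0) \in unitmx.
  (* [r + 1] in place of [r] keeps the bound positive for [r = 0]. *)
  have r1 : 0 < 2 * (r%:R + 1) :> R by rewrite mulr_gt0// ltr_wpDl.
  have nP : \forall t \near (0 : R), forall ij : 'I_r * 'I_r,
      `|P 0 ij.1 ij.2 - P t ij.1 ij.2| < (2 * (r%:R + 1))^-1.
    apply: (@filter_forall R _ (fun (ij : 'I_r * 'I_r) (t : R) =>
      `|P 0 ij.1 ij.2 - P t ij.1 ij.2| < (2 * (r%:R + 1))^-1) (nbhs (0 : R)) _) => -[i j] /=.
    by have /cvgrPdist_lt := cPij i j 0; apply; rewrite invr_gt0.
  have /nbhs_ballP[d /= d0 dP] := nP.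
  pose a := Num.min (d / 2) (2^-1).
  have a0 : 0 < a by rewrite lt_min !divr_gt0//= invr_gt0.
  have ad : a < d by rewrite gt_min ltr_pdivrMr// ltr_pMr// ltr1n.
  have a1 : a < 1 by rewrite gt_min invf_lt1// ltr1n orbT.
  exists a; first by rewrite a0.
  have : a^-1 *: (Q a - Q 0) \in unitmx.
    apply: near_identity_unit => i j.
    (* Each entry of the rescaled difference is the same entry of [P] at a point between 0 and [a],
       hence close to that of the identity. *)
    have [t||t] := @MVT_segment R (fun t => Q t i j) (fun t => P t i j) 0 a (ltW a0).
    - by rewrite in_itv /= => /andP[t0 ta]; apply: Qd; apply/andP; split; lra.
    - apply: derivable_within_continuous => t; rewrite in_itv /= => /andP[t0 ta].
      by have [] : is_derive t 1 (fun t => Q t i j) (P t i j) by apply: Qd; apply/andP; split; lra.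
    - rewrite in_itv /= => /andP[t0 ta]; rewrite subr0 => E.
      rewrite !mxE E.
      have -> : a^-1 * (P t i j * a) = P t i j by field; rewrite gt_eqF.
      have := dP t; rewrite -ball_normE /= sub0r normrN ger0_norm// => /(_ _)/(_ (i, j)) /=.
      rewrite P0 mxE distrC => H.
      have {}H := H (le_lt_trans ta ad).
      apply: (@le_trans _ _ ((2 * (r%:R + 1))^-1 * (2 * r%:R))).
        by rewrite ler_wpM2r ?mulr_ge0// ltW.
      by rewrite mulrC ler_pdivrMr// mul1r ler_pM2l// lerDl.
  by rewrite -!row_free_unit /row_free mxrank_scale_nz// invr_eq0 gt_eqF.
apply: (@near_eq_derivable _ _ _ (fun s => (Q (s + a) - Q s) *m invmx (Q a - Q 0))).
  near=> s; rewrite -QE ?mulmxK//; last by rewrite a0.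
  have : `|s| < 1.
    near: s; apply/nbhs_ballP; exists 1 => //= x.
    by rewrite -ball_normE /= sub0r normrN.
  by rewrite ltr_norml.
apply/derivable_mxP => i j.
have -> : (fun s => ((Q (s + a) - Q s) *m invmx (Q a - Q 0)) i j) =
  \sum_(k < r) (fun s => (Q (s + a) i k - Q s i k) * invmx (Q a - Q 0) k j).
  apply/funext => s; rewrite mxE fct_sumE; apply: eq_bigr => k _.
  by rewrite !mxE.
apply: derivable_sum => k.
have dQ : is_derive (0 : R) 1 (fun s => Q s i k) (P 0 i k).
  by apply: Qd; apply/andP; split; lra.
have dQa : differentiable (fun s => Q (s + a) i k) (0 : R).
  apply: (@differentiable_chain R R R R (fun s => s + a) (fun s => Q s i k) 0 a).
  - exact/derivable1_diffP.
  - by rewrite add0r.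
  - by apply/derivable1_diffP; have [] : is_derive a 1 (fun s => Q s i k) (P a i k)
      by apply: Qd; apply/andP; split; lra.
apply/derivable1_diffP; apply: differentiable_times => //.
by apply: differentiable_sub => //; apply/derivable1_diffP; case: dQ.
Unshelve. all: by end_near. Qed.

End OneParameter.

Section DeriveLinear.
Context {R : realType} {n k : nat}.
Variable f : {linear 'rV[R]_n -> 'rV[R]_k}.

Lemma linear_rV_differentiable x : differentiable f x.
Proof.
have -> : f = (fun v => \sum_(i < n) v 0 i *: f (delta_mx 0 i)) :> (_ -> _).
  apply/funext => v; rewrite {1}(row_sum_delta v) linear_sum.
  by apply: eq_bigr => i _; rewrite linearZ.
apply: differentiable_bigsum => i; apply: differentiable_scale => //.
exact: differentiable_coord.
Qed.

Lemma linear_rV_continuous : continuous f.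
Proof. by move=> x; apply: differentiable_continuous; exact: linear_rV_differentiable. Qed.

Lemma is_derive_linear (h : R -> 'rV[R]_n) (t : R) (d : 'rV[R]_n) :
  is_derive t 1 h d -> is_derive t 1 (fun u => f (h u)) (f d).
Proof.
move=> dh; have := is_derive_comp_diff dh (linear_rV_differentiable (h t)).
move/is_derive_eq; apply.
exact: (congr1 (fun F => F d) (diff_lin (h t) linear_rV_continuous)).
Qed.

End DeriveLinear.

Section SoBasis.
Context {R : realType} {r : nat} {vT : vectType R}.
Variable phi : 'M[R]_r -> 'End(vT).
Hypothesis phi_rep : is_lie_representation phi.

Lemma so0 : 0 \in so R r.
Proof. by rewrite inE trmx0 oppr0. Qed.

Lemma soP (A : 'M[R]_r) : reflect (A^T = - A) (A \in so R r).
Proof. by rewrite inE; exact: eqP. Qed.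

Lemma so_lin a (A A' : 'M[R]_r) : A \in so R r -> A' \in so R r -> a *: A + A' \in so R r.
Proof.
move=> /soP hA /soP hA'; apply/soP.
by rewrite linearP /= hA hA' scalerN opprD.
Qed.

Lemma phi0 : phi 0 = 0.
Proof.
have [/(_ (-1) _ _ so0 so0)] := phi_rep.
by rewrite scaler0 addr0 scaleN1r addNr.
Qed.

Lemma phi_sum (I : Type) (s : seq I) (a : I -> R) (A : I -> 'M[R]_r) :
  (forall i, A i \in so R r) ->
  \sum_(i <- s) a i *: A i \in so R r /\
  phi (\sum_(i <- s) a i *: A i) = \sum_(i <- s) a i *: phi (A i).
Proof.
move=> hA; elim: s => [|i s [IH1 IH2]]; first by rewrite !big_nil phi0 so0.
rewrite !big_cons; split; first exact: so_lin.
by have [-> // _] := phi_rep; rewrite IH2.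
Qed.

Let e2 (ij : 'I_r * 'I_r) : 'M[R]_r := 2^-1 *: (delta_mx ij.1 ij.2 - delta_mx ij.2 ij.1).

Lemma so_delta ij : e2 ij \in so R r.
Proof.
apply/soP; rewrite /e2 linearZ /= linearB /= !trmx_delta -scalerN opprB //.
Qed.

Lemma so_sumE (S : 'M[R]_r) : S \in so R r -> S = \sum_ij S ij.1 ij.2 *: e2 ij.
Proof.
move=> /soP hS; apply/matrixP => i j; rewrite summxE.
rewrite (eq_bigr (fun ij => 2^-1 * (S ij.1 ij.2 * ((i == ij.1) && (j == ij.2))%:R)
   - 2^-1 * (S ij.1 ij.2 * ((i == ij.2) && (j == ij.1))%:R))); last first.
  by move=> ij _; rewrite !mxE; ring.
rewrite sumrB (bigD1 (i, j))//= big1 => [|[a b] /= ne]; last first.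
  case: eqP => [ia|]; case: eqP => [jb|]; rewrite ?mulr0 ?andbF//=.
  by rewrite ia jb eqxx in ne.
rewrite (bigD1 (j, i))//= big1 => [|[a b] /= ne]; last first.
  case: eqP => [ia|]; case: eqP => [jb|]; rewrite ?mulr0 ?andbF//=.
  by rewrite ia jb eqxx in ne.
rewrite !eqxx !addr0 !mulr1.
have := congr1 (fun M : 'M[R]_r => M i j) hS; rewrite !mxE => ->.
by field.
Qed.

(** [phi] after skew-symmetrization. It is linear on all matrices, while [phi] is only known to be
    linear on so(r), and it takes row vectors to suit [is_derive_bilinear]. *)
Definition phi_ext (m : 'rV[R]_(r * r)) : 'End(vT) :=
  \sum_ij vec_mx m ij.1 ij.2 *: phi (e2 ij).

Lemma phi_extE S : S \in so R r -> phi_ext (mxvec S) = phi S.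
Proof.
move=> hS; rewrite /phi_ext mxvecK {2}(so_sumE hS).
have [_ ->] := @phi_sum _ (index_enum _) (fun ij => S ij.1 ij.2) e2 so_delta.
by [].
Qed.

Lemma phi_ext_linear : linear phi_ext.
Proof.
move=> a m m'; rewrite /phi_ext scaler_sumr -big_split; apply: eq_bigr => ij _.
by rewrite linearP !mxE scalerDl scalerA.
Qed.

End SoBasis.

Section DeriveBilinear.
Context {R : realType} {n1 n2 k : nat}.
Variables (b : 'rV[R]_n1 -> 'rV[R]_n2 -> 'rV[R]_k).
Hypothesis bl : forall w, linear (b^~ w).
Hypothesis br : forall v, linear (b v).

Lemma is_derive_bilinear (F : R -> 'rV[R]_n1) (G : R -> 'rV[R]_n2) (t : R) dF dG :
  is_derive t 1 F dF -> is_derive t 1 G dG ->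
  is_derive t 1 (fun u => b (F u) (G u)) (b dF (G t) + b (F t) dG).
Proof.
move=> [F1 F2] [G1 G2].
have hF : differentiable F t by exact/derivable1_diffP.
have hG : differentiable G t by exact/derivable1_diffP.
have E := diff_bilinear bl br hF hG 1.
have EF : 'D_1 F t = 'd F t 1 by rewrite deriveE.
have EG : 'D_1 G t = 'd G t 1 by rewrite deriveE.
have E' : b ('d F t 1) (G t) + b (F t) ('d G t 1) = b dF (G t) + b (F t) dG.
  by rewrite -EF -EG F2 G2.
have hb := differentiable_bilinear bl br hF hG.
have Eb : 'D_1 (fun u => b (F u) (G u)) t = 'd (fun u => b (F u) (G u)) t 1.
  by rewrite deriveE.
exact: DeriveDef (diff_derivable hb) (etrans Eb (etrans E E')).
Qed.

End DeriveBilinear.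

Lemma is_derive_mxvec (R : realType) r s (P : R -> 'M[R]_(r, s)) (t : R) :
  derivable P t 1 -> is_derive t 1 (fun u => mxvec (P u)) (mxvec ('D_1 P t)).
Proof.
move=> dP; have d1 : derivable (fun u => mxvec (P u)) t 1.
  apply/derivable_mxP => i j; rewrite ord1; case/mxvec_indexP: j => j k.
  by under eq_fun do rewrite mxvecE; have /derivable_mxP := dP; apply.
apply: (DeriveDef d1); apply/rowP => j; rewrite (derive_mx d1) mxE.
case/mxvec_indexP: j => j k; rewrite mxvecE (derive_mx dP) mxE.
by congr ('D_1 _ t); apply/funext => u; rewrite mxvecE.
Qed.

Lemma is_derive_conj (R : realType) r (S : 'M[R]_r) (P : R -> 'M[R]_r) (t : R) :
  derivable P t 1 -> is_derive t 1 (fun u => mxvec (P u *m S *m (P u)^T))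
    (mxvec ('D_1 P t *m S *m (P t)^T + P t *m S *m ('D_1 P t)^T)).
Proof.
move=> dP; pose b (M N : 'rV[R]_(r * r)) := mxvec (vec_mx M *m S *m (vec_mx N)^T).
have bl w : linear (b^~ w).
  by move=> a M M'; rewrite /b linearP /= !mulmxDl -!scalemxAl linearP.
have br M : linear (b M).
  by move=> a w w'; rewrite /b linearP /= linearP /= mulmxDr -!scalemxAr linearP.
have := is_derive_bilinear bl br (is_derive_mxvec dP) (is_derive_mxvec dP).
rewrite /b !mxvecK -linearD /= => D.
by under eq_fun do rewrite -[P _ in X in X *m S]mxvecK -[P _ in X in X^T]mxvecK.
Qed.

(** * Differentiating the isotropy action and the equivariance *)

Section InfinitesimalIsotropy.
Context {R : realType} {n : nat} {G : lieGroupType R n}.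
Variables (c : chart R n G) (H : set G) (hh : {vspace 'rV[R]_n}).
Hypotheses (atlas_c : atlas c) (c1 : chart_dom c 1%g).
Hypothesis lie_H : is_lie_algebra_of c H hh.
Variable B : {dot 'rV[R]_n for idfun}.
Local Notation m := (orthov B hh).
Hypothesis metric : homogeneous_metric c m H B.
Local Notation V := 'rV[R]_n.

Lemma one_parameter1 (gamma : R -> G) :
  (forall s t, gamma (s + t) = (gamma s * gamma t)%g) -> gamma 0 = 1%g.
Proof.
move=> gD; have := gD 0 0; rewrite addr0 => /(congr1 (fun x => (gamma 0)^-1 * x)%g).
by rewrite mulVg mulgA mulVg mul1g.
Qed.

Lemma dot_addl u v w : B (u + v) w = B u w + B v w.
Proof. exact: linearDl. Qed.

Lemma dot_scalel a u w : B (a *: u) w = a * B u w.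
Proof. exact: linearZl_LR. Qed.

Lemma dot_sym u v : B u v = B v u.
Proof. by rewrite hermC expr0 mul1r. Qed.

Lemma dot_gt0 u : u != 0 -> 0 < B u u.
Proof. exact: neq0_dnorm_gt0. Qed.

Fact form_linear W : linear (fun v : V => (B v W)%:M : 'rV[R]_1).
Proof.
move=> a v v'; apply/matrixP => i j.
by rewrite dot_addl dot_scalel !mxE mulrnDl -mulrnAr.
Qed.

(** Along the one-parameter subgroup of [X], [Ad] keeps [Y] in [m], so its product with any [W] in
    [hh] is identically zero; the derivative at 0 of this product is that of the bracket with
    [W]. *)
Lemma hh_stable X Y : X \in hh -> Y \in m -> bracket c X Y \in m.
Proof.
move=> /lie_H[gamma [cg gD gH dg]] Ym.
have g0 := one_parameter1 gD.
have dA := Ad_curve atlas_c c1 Y cg g0 dg.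
apply/mem_orthovP => W Wh.
pose f : {linear V -> 'rV[R]_1} := HB.pack (fun v : V => (B v W)%:M : 'rV[R]_1)
  (GRing.isLinear.Build _ _ _ _ _ (form_linear W)).
have d1 := is_derive_linear f dA.
have d2 : is_derive (0 : R) 1 (fun t => f (Ad c (gamma t) Y)) 0.
  have -> : (fun t => f (Ad c (gamma t) Y)) = cst 0.
    apply/funext => t; rewrite /f /=; have [/(_ _ Ym) /mem_orthovP -> // _] := metric (gH t).
    by apply/matrixP => i j; rewrite !mxE mul0rn.
  exact: is_derive_cst.
have /(congr1 (fun M : 'rV[R]_1 => M 0 0)) : f (bracket c X Y) = 0.
  by rewrite -(@derive_val _ _ _ _ _ _ _ d1) (@derive_val _ _ _ _ _ _ _ d2).
by rewrite !mxE eqxx.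
Qed.

Section Structure.
Variables (r : nat) (rho : G -> 'M[R]_r) (phi : 'M[R]_r -> 'End(subvs_of m)).
Hypothesis rho_rep : is_orthogonal_representation H rho.
Hypothesis phi_rep : is_lie_representation phi.
Hypothesis equivariant : forall h, H h -> {in so R r, forall A,
    (isotropy c m h \o phi A \o (isotropy c m h)^-1)%VF =
    phi (rho h *m A *m invmx (rho h))}.

Lemma isotropyE h v : isotropy c m h v = vsproj m (Ad c h (vsval v)).
Proof.
pose f : {linear subvs_of m -> subvs_of m} := vsproj m \o (Ad c h \o vsval).
exact: (lfunE f).
Qed.

Lemma vsval_isotropy h v : H h -> vsval (isotropy c m h v) = Ad c h (vsval v).
Proof.
move=> /metric[st _]; rewrite isotropyE vsprojK//.
by apply: st; exact: subvsP.
Qed.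

(** The equivariance evaluated at [isotropy c m h v], which removes the inverse; this uses that
    [isotropy c m h] is injective, as [Ad] of the inverse undoes it. With the transpose for the
    inverse of [rho h], the right-hand side is bilinear in [rho h] and can be differentiated. *)
Lemma equivariant_curve h S v : H h -> S \in so R r ->
  Ad c h (vsval (phi S v)) =
  vsval (phi (rho h *m S *m (rho h)^T) (vsproj m (Ad c h (vsval v)))).
Proof.
move=> Hh hS; have [_ orth _] := rho_rep.
have rhoV : invmx (rho h) = (rho h)^T.
  have := orth h Hh; rewrite inE => /andP[/eqP E _].
  have U : rho h \in unitmx by case: (mulmx1_unit E).
  by rewrite -[RHS](mulKmx U) E mulmx1.
have := equivariant Hh hS; rewrite rhoV => <-.
rewrite -vsval_isotropy// -isotropyE !lfunE /= !lfunE /=.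
congr (vsval (isotropy c m h (phi S _))).
have : (isotropy c m h)^-1%VF (isotropy c m h v) = ((isotropy c m h)^-1 \o isotropy c m h)%VF v.
  by rewrite lfunE.
rewrite lker0_compVf ?id_lfunE//; apply/lker0P => x y.
move/(congr1 vsval); rewrite !vsval_isotropy// => E; apply/val_inj => /=.
apply: etrans (esym (AdK atlas_c c1 h (vsval x))) _.
exact: etrans (congr1 (Ad c h^-1%g) E) (AdK atlas_c c1 h (vsval y)).
Qed.

(** [A] is the derivative at 0 of [rho] along the one-parameter subgroup of [X]; continuity of [rho]
    suffices by [one_parameter_derivable]. The formula is the product rule for
    [equivariant_curve]. *)
Lemma infinitesimal_equivariance X : X \in hh ->
  exists2 A, A \in so R r & forall S v, S \in so R r ->
    bracket c X (vsval (phi S v)) =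
    vsval (phi (A *m S - S *m A) v) +
    vsval (phi S (vsproj m (bracket c X (vsval v)))).
Proof.
move=> /lie_H[gamma [cg gD gH dg]].
have g0 := one_parameter1 gD.
have [rho_c rho_O rho_M] := rho_rep.
pose P t := rho (gamma t).
have PD s t : P (s + t) = P s *m P t by rewrite /P gD rho_M.
have PO t : P t *m (P t)^T = 1%:M.
  by have := rho_O _ (gH t); rewrite inE => /andP[/eqP].
have P0 : P 0 = 1%:M.
  have U : P 0 \in unitmx by case: (mulmx1_unit (PO 0)).
  by rewrite -(mulKmx U (P 0)) -PD addr0 mulVmx.
have cP : continuous P.
  move=> t; have cr := (subspace_continuousP _ _).1 rho_c (gamma t) (gH t).
  have cgt : gamma @ t --> within H (nbhs (gamma t)).
    move=> U /= WU; rewrite /within /= in WU.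
    have W : \forall s \near t, H (gamma s) -> U (gamma s) by exact: cg t _ WU.
    have W' : \forall s \near t, U (gamma s) by apply: filterS W => s; apply; exact: gH.
    exact: W'.
  exact: (cvg_comp _ _ cgt cr).
have dP := one_parameter_derivable cP P0 PD.
pose A := 'D_1 P (0 : R).
have dconj S : is_derive (0 : R) 1 (fun t => mxvec (P t *m S *m (P t)^T))
    (mxvec (A *m S + S *m A^T)).
  by have := is_derive_conj S dP; rewrite P0 mul1mx trmx1 mulmx1.
(* The case [S = 1] of [dconj], where the curve is constant by orthogonality. *)
have skA : A^T = - A.
  have := dconj 1%:M; rewrite mulmx1 mul1mx.
  have -> : (fun t => mxvec (P t *m 1%:M *m (P t)^T)) = cst (mxvec 1%:M).
    by apply/funext => t; rewrite mulmx1 PO.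
  move=> [_]; rewrite derive_cst => /esym/eqP; rewrite mxvec_eq0 addrC.
  by rewrite addr_eq0 => /eqP.
have soA : A \in so R r by apply/soP.
exists A => // S v hS.
have conj_so t : P t *m S *m (P t)^T \in so R r.
  apply/soP; rewrite !trmx_mul trmxK (soP _ hS).
  by rewrite mulNmx mulmxN mulmxA.
have com_so : A *m S - S *m A \in so R r.
  apply/soP; rewrite linearB /= !trmx_mul skA (soP _ hS) !mulNmx !mulmxN !opprK.
  by rewrite opprB.
pose b (M : 'rV[R]_(r * r)) (w : V) : V := vsval (phi_ext phi M (vsproj m w)).
have bl w : linear (b^~ w).
  by move=> a M M'; rewrite /b phi_ext_linear add_lfunE scale_lfunE linearP.
have br M : linear (b M).
  by move=> a w w'; rewrite /b (linearP (vsproj m)) (linearP (phi_ext phi M)).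
pose F t := mxvec (P t *m S *m (P t)^T).
pose K t := Ad c (gamma t) (vsval v).
have dF : is_derive (0 : R) 1 F _ := dconj S.
have dK : is_derive (0 : R) 1 K _ := Ad_curve atlas_c c1 (vsval v) cg g0 dg.
have E1 : is_derive (0 : R) 1 (fun t => Ad c (gamma t) (vsval (phi S v))) _ :=
  Ad_curve atlas_c c1 _ cg g0 dg.
have FK : (fun t => Ad c (gamma t) (vsval (phi S v))) = (fun t => b (F t) (K t)).
  apply/funext => t; rewrite /b /F phi_extE//; exact: equivariant_curve.
have E2 := is_derive_bilinear bl br dF dK.
have E3 : bracket c X (vsval (phi S v)) =
    b (mxvec (A *m S + S *m A^T)) (K 0) + b (F 0) (bracket c X (vsval v)).
  have := @derive_val _ _ _ _ _ _ _ E1; rewrite FK => <-.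
  exact: (@derive_val _ _ _ _ _ _ _ E2).
have K0 : K 0 = vsval v by rewrite /K g0; exact: (Ad1 atlas_c c1).
have F0 : F 0 = mxvec S by rewrite /F P0 mul1mx trmx1 mulmx1.
by rewrite E3 K0 F0 /b !phi_extE ?skA ?mulmxN// vsvalK.
Qed.

End Structure.

End InfinitesimalIsotropy.

(** * Cartan subalgebras *)

Section LieRank.
Context {R : realType} {n : nat} {G : lieGroupType R n}.
Variable c : chart R n G.
Hypotheses (atlas_c : atlas c) (c1 : chart_dom c 1%g).
Local Notation V := 'rV[R]_n.

Lemma dim_abelian_le (k a : {vspace V}) : (a <= k)%VS ->
  {in a &, forall X Y, bracket c X Y = 0} -> (\dim a <= lie_rank c k)%N.
Proof.
move=> ak ab; have an : (\dim a < n.+1)%N.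
  by rewrite ltnS; have := dimvS (subvf a); rewrite dimvf /dim /= mul1n.
rewrite /lie_rank -[leqLHS]/(nat_of_ord (Ordinal an)).
by apply: leq_bigmax_cond; apply/asboolP; exists a.
Qed.

Lemma exists_cartan (k : {vspace V}) : exists a : {vspace V},
  [/\ (a <= k)%VS, \dim a = lie_rank c k &
      {in a &, forall X Y, bracket c X Y = 0}].
Proof.
have P0 : `[< exists a : {vspace V}, [/\ (a <= k)%VS, \dim a = (@ord0 n) &
    {in a &, forall X Y, bracket c X Y = 0}] >].
  apply/asboolP; exists 0%VS; split; rewrite ?sub0v ?dimv0// => X Y.
  rewrite !memv0 => /eqP -> _; have := bracket_linearl c Y (-1) 0 0.
  by rewrite scaler0 addr0 scaleN1r addNr.
rewrite /lie_rank (bigop.bigmax_eq_arg _ P0); case: arg_maxnP => // i /asboolP[a [ak ai ab]] _.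
by exists a.
Qed.

(** Adjoining [x] to [t] gives an abelian subalgebra of the whole Lie algebra, whose dimension is at
    most the rank of [G], that is, the dimension of [t]. *)
Lemma cartan_self_centralizing (hh t : {vspace V}) : lie_rank c fullv = lie_rank c hh ->
  \dim t = lie_rank c hh -> {in t &, forall X Y, bracket c X Y = 0} ->
  forall x, (forall X, X \in t -> bracket c X x = 0) -> x \in t.
Proof.
move=> rk dt ab x cx.
have brr X : bracket c X X = 0.
  apply/eqP; have := bracket_asym atlas_c c1 X X => /eqP.
  by rewrite -addr_eq0 -mulr2n -scaler_nat scaler_eq0 pnatr_eq0.
have ab' : {in (t + <[x]>)%VS &, forall X Y, bracket c X Y = 0}.
  move=> _ _ /memv_addP[X Xt [_ /vlineP[p ->] ->]] /memv_addP[Y Yt [_ /vlineP[q ->] ->]].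
  have L Z := bracket_linearl c Z; have Rr Z := bracket_linearr atlas_c c1 Z.
  have xY : bracket c x Y = 0 by rewrite bracket_asym// cx// oppr0.
  rewrite addrC L [Y + _]addrC !Rr xY brr (cx _ Xt) (ab _ _ Xt Yt).
  by rewrite !scaler0 !addr0 scaler0.
have tx : (t + <[x]>)%VS = t.
  apply/esym/eqP; rewrite eqEdim addvSl dt -rk dim_abelian_le//; exact: subvf.
by rewrite -tx; apply: (subvP (addvSr t <[x]>)); exact: memv_line.
Qed.

End LieRank.

(** * Rank bounds for a homogeneous Clifford structure *)

Section Structure.
Context {R : realType} {n : nat} {G : lieGroupType R n}.
Variables (c : chart R n G) (H : set G) (hh : {vspace 'rV[R]_n}).
Hypotheses (atlas_c : atlas c) (c1 : chart_dom c 1%g).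
Hypothesis lie_H : is_lie_algebra_of c H hh.
Hypothesis rank_eq : lie_rank c fullv = lie_rank c hh.
Variable B : {dot 'rV[R]_n for idfun}.
Local Notation m := (orthov B hh).
Hypothesis invB : ad_invariant c B.
Hypothesis metric : homogeneous_metric c m H B.
Hypothesis pos_dim : (0 < \dim m)%N.
Variables (r : nat) (rho : G -> 'M[R]_r) (phi : 'M[R]_r -> 'End(subvs_of m)).
Hypothesis struct : is_homogeneous_clifford_structure c H B rho phi.

Lemma structure_rank : (5 <= r)%N ->
  [/\ odd r -> (r < 11)%N, ~~ odd r -> (r < 18)%N & r <> 14%N].
Proof.
move=> r5; have [t [th dt t_ab]] := exists_cartan c hh.
have [Phi [[Phi1 PhiL PhiM] Phi_spin]] := hcs_extends struct.
(* The Clifford operators, extended to the whole Lie algebra by first projecting to [m]. *)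
pose op x z := vsval (Phi x (vsproj m z)).
have op_m x z : op x z \in m by exact: subvsP.
have proj_op x z : vsproj m (op x z) = Phi x (vsproj m z) by exact: vsvalK.
have mP x : x \in m <-> (forall Y, Y \in hh -> B x Y = 0).
  by split=> [/mem_orthovP//|?]; exact/mem_orthovP.
apply: (@rank_restrictions R n r (bracket c) (bracket_linearl c) (bracket_linearr atlas_c c1)
  (bracket_asym atlas_c c1) (bracket_jacobi atlas_c c1) B (dot_addl B) (dot_scalel B)
  (dot_sym B) (@dot_gt0 _ _ B) invB t m hh t_ab
  (cartan_self_centralizing atlas_c c1 rank_eq dt t_ab) _ mP
  (hh_stable atlas_c c1 lie_H metric) op) => //.
- by move=> X Xt; exact: (subvP th).
- by move=> x a z z'; rewrite /op !linearP.
- by move=> z zm; rewrite /op Phi1 id_lfunE vsprojK.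
- by move=> x y z xe ye; rewrite /op PhiM// comp_lfunE vsvalK.
- by move=> a x y z xe ye; rewrite /op PhiL// add_lfunE scale_lfunE linearP.
- move=> u w uw z z' zm zm'; have hs := wedge_so u w.
  have := hcs_skew struct hs (vsproj m z) (vsproj m z').
  by rewrite -Phi_spin// spin_wedge// !vsprojK.
- move=> X Xh; have [A As hA] := infinitesimal_equivariance atlas_c c1 lie_H metric
    (hcs_rho struct) (hcs_phi struct) (hcs_equivariant struct) Xh.
  exists A; split; first by apply/eqP; have := As; rewrite inE.
  move=> u w uw z zm; have hs := wedge_so u w.
  have sA : spin A \in even_clifford by apply: spin_even; apply/eqP; have := As; rewrite inE.
  have sS : spin (wedge u w) \in even_clifford.
    by apply: spin_even; apply/eqP; have := hs; rewrite inE.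
  have PhiB x y v : x \in even_clifford -> y \in even_clifford ->
      Phi (x - y) v = Phi x v - Phi y v.
    move=> xe ye; rewrite addrC -scaleN1r PhiL// add_lfunE scale_lfunE scaleN1r.
    by rewrite addrC.
  have := hA _ (vsproj m z) hs; rewrite vsprojK// (hcs_phi struct).2// -!Phi_spin//.
  rewrite -!PhiM// add_lfunE opp_lfunE -PhiB ?evenM// spin_wedge//.
- exists (vsval (vpick (fullv : {vspace subvs_of m}))); first exact: subvsP.
  rewrite -[0](linear0 (@vsval _ _ m)) (inj_eq val_inj) vpick0 -dimv_eq0 dimvf.
  by rewrite /dim /= -lt0n.
Qed.

End Structure.

(** A finite check over [r = 2, ..., 17]. *)
Lemma allowed_ranks (r : nat) : (2 <= r < 18)%N -> (odd r -> (r < 11)%N) -> r <> 14%N ->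
  [/\ (r <= 16)%N,
      (odd r -> r \in [:: 3; 5; 7; 9]%N),
      (r = 2 %[mod 4] -> r \in [:: 2; 6; 10]%N),
      (r = 4 %[mod 8] -> r \in [:: 4; 12]%N) &
      (r = 0 %[mod 8] -> r \in [:: 8; 16]%N)].
Proof.
move=> r_range r_odd /eqP r14.
have /allP/(_ r) : all (fun r => (odd r ==> (r < 11)%N) && (r != 14%N) ==>
  [&& (r <= 16)%N, odd r ==> (r \in [:: 3; 5; 7; 9]%N),
   (r == 2 %[mod 4]) ==> (r \in [:: 2; 6; 10]%N),
   (r == 4 %[mod 8]) ==> (r \in [:: 4; 12]%N) &
   (r == 0 %[mod 8]) ==> (r \in [:: 8; 16]%N)]) (iota 2 16) by [].
rewrite mem_iota => /(_ r_range); rewrite r14 andbT => /implyP.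
move=> /(_ (introT implyP r_odd)) /and5P[r16 /implyP? /implyP h2 /implyP h4 /implyP h8].
by split=> // /eqP.
Qed.

Theorem theorem4p1 (R : realType) (n : nat) (G : lieGroupType R n)
    (compactG : compact [set: G])
    (H : set G) (closedH : closed_subgroup H)
    (c : chart R n G) (atlas_c : atlas c) (c1 : chart_dom c 1%g)
    (hh : {vspace 'rV[R]_n}) (lie_H : is_lie_algebra_of c H hh)
    (rank_eq : lie_rank c fullv = lie_rank c hh)
    (B : {dot 'rV[R]_n for idfun}) (invB : ad_invariant c B)
    (metric : homogeneous_metric c (orthov B hh) H B)
    (pos_dim : (0 < \dim (orthov B hh))%N)
    (faithful : {in hh &, injective (inf_isotropy c (orthov B hh))})
    (r : nat) (rho : G -> 'M[R]_r)
    (phi : 'M[R]_r -> 'End(subvs_of (orthov B hh)))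
    (struct : is_homogeneous_clifford_structure c H B rho phi) :
  [/\ (r <= 16)%N,
      (odd r -> r \in [:: 3; 5; 7; 9]%N),
      (r = 2 %[mod 4] -> r \in [:: 2; 6; 10]%N),
      (r = 4 %[mod 8] -> r \in [:: 4; 12]%N) &
      (r = 0 %[mod 8] -> r \in [:: 8; 16]%N)].
Proof.
apply: allowed_ranks.
(* Ranks up to 4 satisfy all the bounds; [structure_rank] takes over from 5. *)
- rewrite (hcs_rank struct) /=; have [r4|r5] := ltnP r 5; first exact: leq_trans r4 _.
  have [r_odd r_even _] := structure_rank atlas_c c1 lie_H rank_eq invB metric pos_dim struct r5.
  by have [oddr|/r_even//] := boolP (odd r); exact: leq_trans (r_odd oddr) _.
- move=> oddr; have [r4|r5] := ltnP r 5; first exact: leq_trans r4 _.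
  by have [->] := structure_rank atlas_c c1 lie_H rank_eq invB metric pos_dim struct r5.
- have [r4|r5] := ltnP r 5; first by move=> r14; rewrite r14 in r4.
  by have [] := structure_rank atlas_c c1 lie_H rank_eq invB metric pos_dim struct r5.
Qed.
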